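(* Let the Gaussian fully connected network, the inputs $\{x_\alpha\}_{\alpha\in A}$, and all the notation be as in the context, and assume: (i) $\sigma$ is continuous and bounded; (ii) there exist $\widehat{\ell}\in\{1,\ldots,L\}$ and $\gamma_1,\ldots,\gamma_L\in[1,\infty]$ such that $\lim_{n\to\infty}n_\ell(n)/n_{\widehat{\ell}}(n)=\gamma_\ell$ for all $\ell=1,\ldots,L$; set $v_n^*:=n_{\widehat{\ell}}(n)$. Then, for every sequence of positive numbers $\{a_n\}_n$ with $a_n\to0$ and $a_nv_n^*\to\infty$, the sequence $\{(\sqrt{a_n}Z_h^{(L+1)}(x_\alpha))_{\alpha\in A,\,h=1,\ldots,n_{L+1}}\}_n$ satisfies the large deviation principle on $\mathbb{R}^{|A|\times n_{L+1}}$ with speed $1/a_n$ and good rate function $$\widetilde{I}_{Z^{(L+1)}(\underline{x})}(z):=\inf_{r\in\mathbb{R}^{|A|\times n_{L+1}}}\{\|r\|^2/2:\ \widehat{g}^{(L),\#}_{\underline{x}}r=z\},$$ where $\|\cdot\|$ is the Euclidean norm and $\widehat g^{(L),\#}_{\underline{x}}r=(\sum_{\gamma}\widehat g^{(L),\#}_{\underline{x},\alpha\gamma}r_{\gamma h})_{\alpha h}$. In particular, if $\widehat{g}^{(L)}_{\underline{x}}$ is invertible, then $\widetilde{I}_{Z^{(L+1)}(\underline{x})}(z)=\|(\widehat g^{(L),\#}_{\underline{x}})^{-1}z\|^2/2$.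
   Context: Fix integers $L\ge1$, $n_0\ge1$, $n_{L+1}\ge1$, constants $C_b\ge0$, $C_W>0$ and a function $\sigma:\mathbb{R}\to\mathbb{R}$. For each $n\ge1$ let $n_1(n),\ldots,n_L(n)$ be positive integers with $n_\ell(n)\to\infty$ as $n\to\infty$ (write $n_\ell=n_\ell(n)$). The network is defined, for $x=(x_1,\ldots,x_{n_0})\in\mathbb{R}^{n_0}$, by $Z_i^{(1)}(x)=b_i^{(1)}+\sum_{r=1}^{n_0}W^{(1)}_{ir}x_r$ ($i=1,\ldots,n_1$) and $Z_i^{(\ell+1)}(x)=b_i^{(\ell+1)}+\sum_{j=1}^{n_\ell}W^{(\ell+1)}_{ij}\sigma(Z_j^{(\ell)}(x))$ ($i=1,\ldots,n_{\ell+1}$, $1\le\ell\le L$), where all biases $b_i^{(\ell)}$ are centered Normal with variance $C_b$ (degenerate at $0$ if $C_b=0$), all weights $W_{ij}^{(\ell+1)}$ ($0\le\ell\le L$) are centered Normal with variance $C_W/n_\ell$, and all these random variables are independent. Let $A$ be a finite set and $x_\alpha=(x_{\alpha,1},\ldots,x_{\alpha,n_0})\in\mathbb{R}^{n_0}$, $\alpha\in A$, fixed inputs; $\underline{x}$ denotes $\{x_\alpha\}_{\alpha\in A}$. For a symmetric positive semidefinite $A\times A$ matrix $q$, $q^\#$ is its unique symmetric positive semidefinite square root. $\mathbf{1}$ is the $A\times A$ all-ones matrix. Let $(N_\gamma)_{\gamma\in A}$ be i.i.d. standard Normal and $y(q)$ the $A\times A$ matrix with entries $y_{\alpha\beta}(q):=\mathbb{E}[\sigma(\sum_{\gamma}q^\#_{\alpha\gamma}N_\gamma)\sigma(\sum_\gamma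 q^\#_{\beta\gamma}N_\gamma)]$. Define $\widehat g^{(0)}_{\underline{x}}$ as the matrix with entries $C_b+\frac{C_W}{n_0}\sum_{r=1}^{n_0}x_{\alpha,r}x_{\beta,r}$, and recursively $\widehat g^{(\ell)}_{\underline{x}}:=C_b\mathbf{1}+C_W\,y(\widehat g^{(\ell-1)}_{\underline{x}})$ for $\ell=1,\ldots,L$. A sequence satisfies the LDP with speed $v_n\to\infty$ and rate function $I$ if $\limsup\frac1{v_n}\log P(\cdot\in C)\le-\inf_C I$ for closed $C$ and $\liminf\frac1{v_n}\log P(\cdot\in O)\ge-\inf_O I$ for open $O$; $I$ is good if its sublevel sets are compact. *)

(* Defs.v *)
From HB Require Import structures.
From mathcomp Require Import all_boot all_order all_algebra.
From mathcomp Require Import all_classical all_reals all_analysis.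
Set Implicit Arguments. Unset Strict Implicit. Unset Printing Implicit Defensive.
Import Order.TTheory GRing.Theory Num.Theory.
Import numFieldNormedType.Exports.
Local Open Scope classical_set_scope.
Local Open Scope ring_scope.

Section Defs.
Context {R : realType}.

(** Centered Gaussian law with variance [v]; degenerate at 0 if [v = 0]
    (the library's [normal_prob m s] has standard deviation [s]). *)
Definition gauss_law (v : R) : set R -> \bar R :=
  if v == 0 then @dirac _ R 0 R else normal_prob 0 (Num.sqrt v).

Context {d : measure_display} {T : measurableType d}.

Definition has_law (P : probability T R) (X : T -> R) (mu : set R -> \bar R) :=
  forall B : set R, measurable B -> P (X @^-1` B) = mu B.

Definition mutually_independent {I : eqType} (P : probability T R)
    (X : I -> T -> R) (J : set I) :=
  forall (s : seq I) (B : I -> set R),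
    uniq s -> (forall i, i \in s -> J i) -> (forall i, measurable (B i)) ->
    P (\bigcap_(i in [set i | i \in s]) (X i @^-1` B i)) =
    (\prod_(i <- s) P (X i @^-1` B i))%E.

End Defs.

Definition width (n0 nL1 L : nat) (w : nat -> nat) (l : nat) : nat :=
  if l == 0%N then n0 else if l == L.+1 then nL1 else w l.

Section Network.
Context {R : realType} {T : Type}.
Variables (sigma : R -> R) (n0 nL1 L : nat) (w : nat -> nat).
Variables (W : nat -> nat -> nat -> T -> R) (b : nat -> nat -> T -> R).
Variable (x : nat -> R).

(** [preact k i om] = Z^{(k)}_i(x) (k >= 1). *)
Fixpoint preact (k : nat) (i : nat) (om : T) : R :=
  match k with
  | 0%N => 0
  | k'.+1 => b k'.+1 i om +
      \sum_(j < width n0 nL1 L w k')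
        W k'.+1 i j om *
        (match k' with 0%N => x j | _ => sigma (preact k' j om) end)
  end.
End Network.

Definition param_index := ((nat * nat * nat) + (nat * nat))%type.

Definition params {T R : Type} (W : nat -> nat -> nat -> T -> R)
  (b : nat -> nat -> T -> R) (k : param_index) : T -> R :=
  match k with inl (l, i, j) => W l i j | inr (l, i) => b l i end.

Definition param_set (n0 nL1 L : nat) (w : nat -> nat) : set param_index :=
  fun k => match k with
  | inl (l, i, j) => [/\ (1 <= l <= L.+1)%N, (i < width n0 nL1 L w l)%N
                        & (j < width n0 nL1 L w l.-1)%N]
  | inr (l, i) => (1 <= l <= L.+1)%N /\ (i < width n0 nL1 L w l)%N
  end.

Section Matrices.
Context {R : realType}.

Definition psd_mx m (q : 'M[R]_m) :=
  q^T = q /\ forall v : 'rV[R]_m, 0 <= (v *m q *m v^T) 0 0.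

(** q^# : the (unique) symmetric positive semidefinite square root. *)
Definition msqrt m (q : 'M[R]_m) : 'M[R]_m :=
  xget 0 [set S | psd_mx S /\ S *m S = q].

(** [gint k f] = E[f(N_0,...,N_{k-1},0,0,...)] with N_j i.i.d. standard
    normal (iterated integral against the standard normal law). *)
Fixpoint gint (k : nat) (f : (nat -> R) -> R) : R :=
  match k with
  | 0%N => f (fun _ => 0)
  | k'.+1 => gint k' (fun v =>
       Rintegral (normal_prob 0 1) setT
         (fun t => f (fun j => if j == k' then t else v j)))
  end.

Definition ymx (sigma : R -> R) m (q : 'M[R]_m) : 'M[R]_m :=
  \matrix_(al < m, be < m)
    gint m (fun N => sigma (\sum_(g < m) msqrt q al g * N g) *
                     sigma (\sum_(g < m) msqrt q be g * N g)).

Fixpoint ghat (sigma : R -> R) (Cb CW : R) (n0 : nat) m (xs : 'I_m -> nat -> R)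
    (l : nat) : 'M[R]_m :=
  match l with
  | 0%N => \matrix_(al < m, be < m)
       (Cb + CW / n0%:R * \sum_(r < n0) xs al r * xs be r)
  | l'.+1 => Cb *: const_mx 1 + CW *: ymx sigma (ghat sigma Cb CW n0 xs l')
  end.

Definition sqnorm m p (r : 'M[R]_(m, p)) : R := \sum_(i < m) \sum_(j < p) r i j ^+ 2.

Definition rateI m p (G : 'M[R]_m) (z : 'M[R]_(m, p)) : \bar R :=
  ereal_inf [set (sqnorm r / 2)%:E | r in [set r : 'M[R]_(m, p) | msqrt G *m r = z]].

Definition lnE (x : \bar R) : \bar R :=
  match x with
  | EFin r => if 0 < r then EFin (ln r) else (-oo)%E
  | EPInf => (+oo)%E
  | ENInf => (-oo)%E
  end.

End Matrices.

Section LDP.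
Context {R : realType} {d : measure_display} {T : measurableType d}.

Definition LDP {V : topologicalType} (P : probability T R) (Y : nat -> T -> V)
    (v : nat -> R) (I : V -> \bar R) :=
  (forall C : set V, closed C ->
     (limn_esup (fun n => ((v n)^-1)%:E * lnE (P (Y n @^-1` C)))
       <= - ereal_inf (I @` C))%E) /\
  (forall O : set V, open O ->
     (- ereal_inf (I @` O)
       <= limn_einf (fun n => ((v n)^-1)%:E * lnE (P (Y n @^-1` O))))%E).

Definition good_rate {V : topologicalType} (I : V -> \bar R) :=
  (forall z, (0 <= I z)%E) /\ forall a : R, compact [set z | (I z <= a%:E)%E].
End LDP.

(* Main.v *)
(** Given the layers up to [k], the pre-activations of layer [k+1] are i.i.d. across
    neurons and centered Gaussian over the inputs, with covariance
    [C_b + (C_W / n_k) sum_j sigma(Z_j) sigma(Z_j)^T].  Since [sigma] is bounded, a Chernoff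
    bound shows that this covariance concentrates around [ghat k] with an error
    exponential in the width, i.e. superexponential at speed [1 / a_n]; the induction
    over [k] uses that [q |-> E (sigma U sigma V)], for [(U, V)] Gaussian of covariance [q],
    is continuous, and this is obtained by approximating [(u, v) |-> sigma u * sigma v] by
    trigonometric polynomials, whose Gaussian means are explicit in [q].
    Conditioning on the hidden layers, the Laplace transform of the rescaled output at
    [la / a_n] is the mean of [exp (<la, G_n la> / (2 a_n))] with [G_n] the last random
    covariance, hence is [exp ((<la, G la> / 2 + o(1)) / a_n)].  The upper bound follows by
    exponential Markov inequalities and compactness, the lower bound by comparing Laplace
    transforms at nearby tilts, and duality of the quadratic form identifies the rate. *)
Require Import Defs.
From HB Require Import structures.
From mathcomp Require Import all_boot all_order all_algebra.
From mathcomp Require Import all_classical all_reals all_analysis.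
From mathcomp Require Import measurable_realfun spectral complex ring lra.
Import Order.TTheory GRing.Theory Num.Theory.
Import numFieldNormedType.Exports.
Local Open Scope classical_set_scope.
Local Open Scope ring_scope.
Set Implicit Arguments.
Unset Strict Implicit.
Unset Printing Implicit Defensive.

(** * Gaussian integrals *)

(** Neither [G] nor the intermediate covariances may be assumed invertible. Densities are therefore
    used in dimension one only; a Gaussian pair is handled through the means of [cos] and [exp] of
    its linear forms, which are explicit for singular covariances too. The record
    [gaussian_functional] collects these properties, so that two realizations of such a pair,
    iterated integrals through a square root of [q] and independent parameters with frozen
    coefficients, are compared without identifying their laws. Singularity reappears in the rate,
    infinite off the range of [G]. The limiting Laplace exponent is a finite quadratic form with
    gradient [G *m la], and every point of finite rate is such a gradient, so a finite tilt reaches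
    it. The growth of the widths enters through one fact: each eventually exceeds [K / a n], for
    every [K]. *)

Section normal_integrals.
Context {R : realType}.
Implicit Types m s c : R.
Local Notation mu := (@lebesgue_measure R).
Import HBNNSimple.

Let integral_normal_nnsfun m s (f : {nnsfun measurableTypeR R >-> R}) :
  (\int[normal_prob m s]_x (f x)%:E =
   \int[mu]_x ((f x)%:E * (normal_pdf m s x)%:E))%E.
Proof.
under [LHS]eq_integral do rewrite fimfunE -fsumEFin//.
rewrite [LHS]ge0_integral_fsum//; last 2 first.
- by move=> r; exact/measurable_EFinP/measurableT_comp.
- by move=> n x _; rewrite EFinM nnfun_muleindic_ge0.
under [RHS]eq_integral.
  move=> x xD; rewrite fimfunE -fsumEFin// muleC ge0_mule_fsumr; last first.
    by move=> r; rewrite EFinM nnfun_muleindic_ge0.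
  over.
rewrite [RHS]ge0_integral_fsum//; last 2 first.
- move=> r; apply: emeasurable_funM.
    by apply/measurable_EFinP; exact: measurable_normal_pdf.
  by apply/measurable_EFinP; apply/measurableT_comp.
- move=> n x _; rewrite EFinM mule_ge0//; last by rewrite nnfun_muleindic_ge0.
  by rewrite lee_fin normal_pdf_ge0.
apply: eq_fsbigr => r _.
rewrite integralZl_indic_nnsfun// integral_indic// setIT.
have mfr : measurable (f @^-1` [set r]) by [].
have [r0|r0] := ltP r 0.
  rewrite preimage_nnfun0// measure0 mule0 integral0_eq// => x _.
  by rewrite indic0 mulr0 mule0.
rewrite -[X in (_ * X)%E]/(\int[mu]_(x in f @^-1` [set r]) (normal_pdf m s x)%:E)%E.
rewrite [in LHS]integral_mkcond -ge0_integralZl//.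
- apply: eq_integral => x _; rewrite patchE indicE.
  by case: ifPn => _; rewrite ?mulr1 ?mulr0 ?mule0// muleC.
- apply/(measurable_restrictT _ _).1 => //.
  by apply/measurable_EFinP/measurable_funTS; exact: measurable_normal_pdf.
- by move=> x _; rewrite erestrict_ge0// => y _; rewrite lee_fin normal_pdf_ge0.
Qed.

(** Simple functions, then monotone convergence along [nnsfun_approx]. The density turns normal
    integrals into Lebesgue integrals, where substitution is available. *)
Lemma integral_normal_prob m s (f : R -> \bar R) :
  measurable_fun setT f -> (forall x, 0 <= f x)%E ->
  (\int[normal_prob m s]_x f x = \int[mu]_x (f x * (normal_pdf m s x)%:E))%E.
Proof.
move=> mf f0.
have mf' : measurable_fun [set: measurableTypeR R] f by [].
pose f_ := nnsfun_approx measurableT mf'.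
have ndf x a b : (a <= b)%N -> f_ a x <= f_ b x.
  by move=> ab; exact/lefP/nd_nnsfun_approx.
have mfn1 n : measurable_fun setT (fun x => (f_ n x)%:E) by apply/measurable_EFinP.
have mfn n : measurable_fun setT (fun x => (f_ n x)%:E * (normal_pdf m s x)%:E)%E.
  apply: emeasurable_funM; apply/measurable_EFinP => //.
  exact: measurable_normal_pdf.
have p0 x : (0 <= (normal_pdf m s x)%:E)%E by rewrite lee_fin normal_pdf_ge0.
transitivity (lim (\int[normal_prob m s]_x (f_ n x)%:E @[n --> \oo])%E).
  rewrite -monotone_convergence//=.
  - apply: eq_integral => ? /[!inE] xD; apply/esym/cvg_lim => //=.
    exact: cvg_nnsfun_approx.
  - by move=> n ? _; rewrite lee_fin.
  - by move=> ? _ ? ? mn; rewrite lee_fin; exact: ndf.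
rewrite [RHS](_ : _ = lim
    (\int[mu]_x ((f_ n x)%:E * (normal_pdf m s x)%:E) @[n --> \oo])%E).
  by apply: congr_lim; apply/funext => n /=; exact: integral_normal_nnsfun.
rewrite -monotone_convergence//=.
- apply: eq_integral => x /[!inE] xD; apply/esym/cvg_lim => //.
  apply: cvgeZr => //.
  exact: cvg_nnsfun_approx.
- by move=> n ? _; rewrite mule_ge0// lee_fin.
- move=> x _ ? ? ?; rewrite lee_wpmul2r//.
  by rewrite lee_fin; exact: ndf.
Qed.

Lemma normal_pdf_std m s x : 0 < s ->
  normal_pdf m s (m + s * x) * s = normal_pdf 0 1 x.
Proof.
move=> s0; have sN0 : s != 0 by rewrite gt_eqF.
rewrite (normal_pdfE _ sN0) normal_pdfE ?oner_eq0// /normal_peak /normal_fun.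
have -> : - (m + s * x - m) ^+ 2 / (s ^+ 2 *+ 2) = - (x - 0) ^+ 2 / (1 ^+ 2 *+ 2).
  by field.
rewrite mulrAC; congr (_ * _).
rewrite -mulrnAr sqrtrM ?sqr_ge0// sqrtr_sqr (gtr0_norm s0) invfM.
by rewrite mulrAC mulVf// mul1r expr1n mul1r.
Qed.

Lemma integral_normal_prob_std m s (f : R -> R) : 0 < s -> continuous f ->
  (forall x, 0 <= f x) ->
  (\int[normal_prob m s]_x (f x)%:E =
   \int[normal_prob 0 1]_x (f (m + s * x))%:E)%E.
Proof.
move=> s0 cf f0.
have mf : measurable_fun setT f by exact: continuous_measurable_fun.
pose F x := m + s * x.
have F' : (F^`()%classic) = cst s.
  by apply/funext => x; rewrite /F derive1E deriveD// derive_cst deriveMl//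
    derive_id add0r mulr1.
have cF : continuous F.
  by move=> x; apply: cvgD; [exact: cvg_cst|apply: cvgM; [exact: cvg_cst|exact: cvg_id]].
rewrite integral_normal_prob; last 2 first.
- exact/measurable_EFinP.
- by move=> x; rewrite lee_fin.
rewrite integral_normal_prob; last 2 first.
- apply/measurable_EFinP; apply: (measurableT_comp mf).
  exact: continuous_measurable_fun.
- by move=> x; rewrite lee_fin.
under eq_integral do rewrite -EFinM.
rewrite (@increasing_ge0_integration_by_substitutionT _ F)//.
- apply: eq_integral => x _; rewrite /= F' /= -EFinM; congr EFin.
  rewrite -mulrA; congr (_ * _); exact: normal_pdf_std.
- by move=> x y xy; rewrite /F ltrD2l ltr_pM2l.
- by rewrite F' => ?; exact: cvg_cst.
- by rewrite F'; exact: is_cvg_cst.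
- by rewrite F'; exact: is_cvg_cst.
- apply: (cvg_comp (fun x => s * x) (fun y => m + y)); last exact: cvg_addrl_Ny.
  by apply/gt0_cvgMrNy => //; exact: cvg_id.
- apply: (cvg_comp (fun x => s * x) (fun y => m + y)); last exact: cvg_addrl.
  by apply/gt0_cvgMry => //; exact: cvg_id.
- by move=> x; apply: cvgM; [exact: cf|apply: continuous_normal_pdf; rewrite gt_eqF].
- by move=> x; rewrite mulr_ge0// normal_pdf_ge0.
Qed.

(** Completing the square: tilting [N(0,1)] by [e^{c t}] shifts it by [c]. *)
Lemma integral_normal_tilt c (f : R -> R) : continuous f ->
  (forall x, 0 <= f x) ->
  (\int[normal_prob 0 1]_x (expR (c * x) * f x)%:E =
   (expR (c ^+ 2 / 2))%:E * \int[normal_prob 0 1]_x (f (c + x))%:E)%E.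
Proof.
move=> cf f0.
have mf : measurable_fun setT f by exact: continuous_measurable_fun.
rewrite integral_normal_prob; last 2 first.
- apply/measurable_EFinP; apply: measurable_funM => //.
  by apply: measurableT_comp => //; exact: measurable_funM.
- by move=> x; rewrite lee_fin mulr_ge0// expR_ge0.
under [X in _ = (_ * X)%E]eq_integral do rewrite -[X in c + X]mul1r.
rewrite -integral_normal_prob_std// integral_normal_prob; last 2 first.
- exact/measurable_EFinP.
- by move=> x; rewrite lee_fin.
have mfp : measurable_fun [set: measurableTypeR R]
    (fun x => (f x)%:E * (normal_pdf c 1 x)%:E)%E.
  apply: emeasurable_funM; apply/measurable_EFinP => //.
  exact: measurable_normal_pdf.
rewrite -ge0_integralZl; first last.
- by rewrite lee_fin expR_ge0.
- by move=> x _; rewrite mule_ge0// lee_fin ?normal_pdf_ge0.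
- exact: mfp.
- exact: measurableT.
- apply: eq_integral => x _; rewrite -!EFinM; congr EFin.
  rewrite -mulrA mulrCA [in RHS]mulrCA; congr (_ * _).
  rewrite !normal_pdfE// /normal_peak mulrCA [in RHS]mulrCA; congr (_ * _).
  by rewrite /normal_fun -!expRD; congr expR; field.
Qed.

Lemma normal_mgf c :
  (\int[normal_prob 0 1]_x (expR (c * x))%:E = (expR (c ^+ 2 / 2))%:E)%E.
Proof.
have := @integral_normal_tilt c (cst 1) (fun=> cvg_cst _) (fun=> ler01).
have -> : (\int[normal_prob 0 1]_x ((cst 1 (c + x) : R)%:E) = 1 :> \bar R)%E.
  transitivity (\int[normal_prob (0 : R) 1]_x (cst 1%E) x)%E; first by [].
  by rewrite integral_cst// mul1e; exact: (@probability_setT _ _ _ (normal_prob 0 1)).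
by rewrite mule1 => <-; apply: eq_integral => x _; rewrite /= mulr1.
Qed.

End normal_integrals.

(** * Cosine means under the standard normal law *)

Section normal_trig.
Context {R : realType}.
Implicit Types c s th y : R.
Local Notation N := (normal_prob (0 : R) 1).

Let mexp c : measurable_fun [set: R] (fun y => expR (c * y)).
Proof. by apply: measurableT_comp => //; exact: measurable_funM. Qed.

Lemma integrable_normal_exp c : N.-integrable setT (fun y => (expR (c * y))%:E).
Proof.
apply/integrableP; split.
  by apply/measurable_EFinP; exact: mexp.
under eq_integral do rewrite gee0_abs ?lee_fin ?expR_ge0//.
by rewrite normal_mgf ltry.
Qed.

Lemma normal_integrable_dom (f : R -> R) (K c : R) : measurable_fun setT f ->
  (forall y, `|f y| <= K * (expR (c * y) + expR (- c * y))) ->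
  N.-integrable setT (EFin \o f).
Proof.
move=> mf fK.
have iG : N.-integrable setT
    (fun y => K%:E * ((expR (c * y))%:E + (expR (- c * y))%:E))%E.
  by apply: integrableZl => //; apply: integrableD => //;
    exact: integrable_normal_exp.
apply: le_integrable iG => //; first exact/measurable_EFinP.
by move=> y _ /=; rewrite lee_fin (le_trans (fK y))// ler_norm.
Qed.

(** Differentiation under the integral with one fixed kind of majorant, a multiple of exp(c y) +
    exp(-c y), integrable by [normal_mgf]. The bounds are local in [x] because the tilts
    [expR (s * y)] below have no majorant uniform in [s]. *)
Lemma normal_derive_under (f f' : R -> R -> R) (K c a : R) :
  (forall x, measurable_fun setT (f x)) ->
  (forall x y, `|x - a| < 1 -> `|f x y| <= K * (expR (c * y) + expR (- c * y))) ->
  (forall x y : R, is_derive x (1 : R) (f^~ y) (f' x y)) ->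
  (forall x y, `|x - a| < 1 -> `|f' x y| <= K * (expR (c * y) + expR (- c * y))) ->
  is_derive a (1 : R) (fun x : R => \int[N]_y f x y) (\int[N]_y f' a y).
Proof.
move=> mf fK df f'K.
have Ix x : `]a - 1, a + 1[%classic x -> `|x - a| < 1.
  by rewrite /= in_itv/= ltr_distl.
pose G y := K * (expR (c * y) + expR (- c * y)).
have G0 y : 0 <= G y.
  by rewrite (le_trans _ (fK a y _))// subrr normr0.
have iG : N.-integrable setT (EFin \o G).
  apply: (@normal_integrable_dom _ K c).
    apply: measurable_funM => //; apply: measurable_funD;
    by apply: measurableT_comp => //; exact: measurable_funM.
  by move=> y; rewrite ger0_norm.
have Ia : `]a - 1, a + 1[%classic a by rewrite /= in_itv/=; lra.
have p1 x y : partial1of2 f x y = f' x y.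
  by rewrite partial1of2E; apply: derive_val; exact: df.
have intf x : `]a - 1, a + 1[%classic x -> N.-integrable setT (EFin \o f x).
  by move=> /Ix xa; apply: (@normal_integrable_dom _ K c) => // y; exact: fK.
have der x y : `]a - 1, a + 1[%classic x -> [set: R] y -> derivable (f^~ y) x 1.
  by move=> _ _; apply: ex_derive; exact: df.
have ub x y : `]a - 1, a + 1[%classic x -> [set: R] y -> `|partial1of2 f x y| <= G y.
  by move=> /Ix xa _; rewrite p1; exact: f'K.
apply: DeriveDef.
  exact: (@derivable_under_integral _ _ _ N f setT measurableT a (a - 1) (a + 1)
    Ia intf der G G0 iG ub).
rewrite -derive1E.
rewrite (@differentiation_under_integral _ _ _ N f setT measurableT a (a - 1) (a + 1)
    Ia intf der G G0 iG ub).
by apply: eq_Rintegral => y _; rewrite p1.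
Qed.

Let absle y : `|y| <= expR (1 * y) + expR (- 1 * y).
Proof.
rewrite mulN1r mul1r; have [y0|y0] := leP 0 y.
  rewrite ger0_norm//; have := expR_ge1Dx y; have := expR_ge0 (- y); lra.
rewrite ltr0_norm//; have := expR_ge1Dx (- y); have := expR_ge0 y; lra.
Qed.

Let explle s y : `|s| < 1 -> expR (s * y) <= expR (1 * y) + expR (- 1 * y).
Proof.
rewrite mulN1r mul1r ltr_norml => /andP[s1 s2]; have [y0|y0] := leP 0 y.
  have : expR (s * y) <= expR y by rewrite ler_expR; nra.
  have := expR_ge0 (- y); lra.
have : expR (s * y) <= expR (- y) by rewrite ler_expR; nra.
have := expR_ge0 y; lra.
Qed.

Let prodle (y p q : R) : `|p| <= expR (1 * y) + expR (- 1 * y) ->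
  `|q| <= expR (1 * y) + expR (- 1 * y) ->
  `|p * q| <= 4 * (expR (2 * y) + expR (- 2 * y)).
Proof.
move=> hp hq; rewrite normrM.
apply: (@le_trans _ _ ((expR (1 * y) + expR (- 1 * y)) ^+ 2)).
  by rewrite expr2 ler_pM.
rewrite mulN1r mul1r (_ : 2 * y = y + y); last by lra.
rewrite (_ : - 2 * y = (- y) + (- y)); last by lra.
rewrite !expRD; have := sqr_ge0 (expR y - expR (-y)); nra.
Qed.

Let msin c th : measurable_fun [set: R] (fun y => sin (c * y + th)).
Proof.
apply: continuous_measurable_fun => y; apply: continuous_comp.
  by apply: cvgD; [apply: cvgM; [exact: cvg_cst|exact: cvg_id]|exact: cvg_cst].
exact: continuous_sin.
Qed.

Let mcos c th : measurable_fun [set: R] (fun y => cos (c * y + th)).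
Proof.
apply: continuous_measurable_fun => y; apply: continuous_comp.
  by apply: cvgD; [apply: cvgM; [exact: cvg_cst|exact: cvg_id]|exact: cvg_cst].
exact: continuous_cos.
Qed.

Let one_le (y : R) : 1 <= expR (1 * y) + expR (- 1 * y).
Proof.
rewrite mulN1r mul1r.
have [y0|y0] := leP 0 y; have := expR_ge1Dx y; have := expR_ge1Dx (- y);
  have := expR_gt0 y; have := expR_gt0 (- y); lra.
Qed.

Let F c th := \int[N]_y cos (c * y + th).

Let F_derive c th : is_derive c 1 (F ^~ th) (\int[N]_y (- y * sin (c * y + th))).
Proof.
apply: (@normal_derive_under (fun c y => cos (c * y + th))
  (fun c y => - y * sin (c * y + th)) 1 1) => //.
- by move=> x y _; rewrite mul1r (le_trans (cos_max _))//; exact: one_le.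
- move=> x y; apply: is_derive_eq; rewrite /= scaler0 addr0 ?addr0 /GRing.scale/=; ring.
- move=> x y _; rewrite mul1r normrM normrN.
  by rewrite (le_trans _ (absle y))// ler_piMr// sin_max.
Qed.

Let tilt_sin c th s : \int[N]_y (expR (s * y) * sin (c * y + th)) =
  expR (s ^+ 2 / 2) * \int[N]_y sin (c * y + (c * s + th)).
Proof.
(* [integral_normal_tilt] is for nonnegative functions, so it is applied to 1 + sin; the part due to
   1 is then cancelled by [normal_mgf]. *)
have cs u : continuous (fun y : R => 1 + sin (c * y + u)).
  move=> y; apply: cvgD; first exact: cvg_cst.
  apply: continuous_comp; last exact: continuous_sin.
  by apply: cvgD; [apply: cvgM; [exact: cvg_cst|exact: cvg_id]|exact: cvg_cst].
have s0 (u : R) : 0 <= 1 + sin u by have := sin_geN1 u; lra.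
have := integral_normal_tilt s (cs th) (fun x => s0 _).
have i1 u v : N.-integrable setT (fun y => (expR (u * y) * sin (c * y + v))%:E).
  apply: (@normal_integrable_dom _ 1 u).
    by apply: measurable_funM; [exact: mexp|exact: msin].
  move=> y; rewrite normrM ger0_norm ?expR_ge0// mul1r.
  have := sin_max (c * y + v); have := expR_ge0 (u * y); have := expR_ge0 (- u * y).
  have := normr_ge0 (sin (c * y + v)); nra.
have i2 v : N.-integrable setT (fun y => (sin (c * y + v))%:E).
  by have := i1 0 v; under eq_fun do rewrite mul0r expR0 mul1r.
have -> : (\int[N]_x (expR (s * x) * (1 + sin (c * x + th)))%:E)%E =
    (\int[N]_x ((expR (s * x))%:E + (expR (s * x) * sin (c * x + th))%:E))%E.
  by apply: eq_integral => y _; rewrite mulrDr mulr1 EFinD.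
have -> : (\int[N]_x (1 + sin (c * (s + x) + th))%:E)%E =
    (\int[N]_x (1%:E + (sin (c * x + (c * s + th)))%:E))%E.
  by apply: eq_integral => y _; rewrite -EFinD; congr (1 + sin _)%:E; ring.
have i3 : N.-integrable setT (fun=> 1%:E).
  exact: finite_measure_integrable_cst.
rewrite (integralD measurableT (integrable_normal_exp s) (i1 s th)).
rewrite (integralD measurableT i3 (i2 _)) normal_mgf.
rewrite (_ : \int[N]_x 1%:E = 1)%E; last first.
  by rewrite integral_cst// mul1e; exact: (@probability_setT _ _ _ N).
rewrite /Rintegral.
have := integrable_fin_num measurableT (i1 s th).
have := integrable_fin_num measurableT (i2 (c * s + th)).
case: (\int[N]_x _)%E => // p _; case: (\int[N]_x _)%E => // q _ /=.
by move=> /(congr1 fine) /=; lra.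
Qed.

(** Integration by parts E[Y f(Y)] = E[f'(Y)] for the sine, obtained by differentiating both sides
    of [tilt_sin] in [s] at 0, where the prefactor exp(s^2 / 2) is stationary. *)
Let stein c th : \int[N]_y (y * sin (c * y + th)) = c * F c th.
Proof.
have D1 : is_derive (0 : R) 1 (fun s => \int[N]_y (expR (s * y) * sin (c * y + th)))
    (\int[N]_y (y * expR (0 * y) * sin (c * y + th))).
  apply: (@normal_derive_under (fun s y => expR (s * y) * sin (c * y + th))
    (fun s y => y * expR (s * y) * sin (c * y + th)) 4 2) => //.
  - by move=> x; apply: measurable_funM; [exact: mexp|exact: msin].
  - move=> x y; rewrite subr0 => x1; apply: prodle.
      by rewrite ger0_norm ?expR_ge0// explle.
    by rewrite (le_trans (sin_max _))// one_le.
  - by move=> x y; apply: is_derive_eq; rewrite /= /GRing.scale/=; ring.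
  - move=> x y; rewrite subr0 => x1.
    have hx : `|expR (x * y)| <= expR (1 * y) + expR (- 1 * y).
      by rewrite ger0_norm ?expR_ge0// explle.
    rewrite normrM (le_trans _ (prodle (absle y) hx))//.
    by rewrite ler_piMr// sin_max.
have D2 : is_derive (0 : R) 1 (fun s => \int[N]_y sin (c * y + (c * s + th)))
    (\int[N]_y (c * cos (c * y + (c * 0 + th)))).
  apply: (@normal_derive_under (fun s y => sin (c * y + (c * s + th)))
    (fun s y => c * cos (c * y + (c * s + th))) (1 + `|c|) 1) => //.
  - move=> x y _; rewrite (le_trans (sin_max _))//.
    have := one_le y; have := normr_ge0 c; nra.
  - by move=> x y; apply: is_derive_eq; rewrite /= /GRing.scale/=; ring.
  - move=> x y _; rewrite normrM; have := cos_max (c * y + (c * x + th)).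
    have := one_le y; have := normr_ge0 c;
    have := normr_ge0 (cos (c * y + (c * x + th))); nra.
have D3 : is_derive (0 : R) 1
  (fun s => expR (s ^+ 2 / 2) * \int[N]_y sin (c * y + (c * s + th)))
  (\int[N]_y (c * cos (c * y + (c * 0 + th)))).
  apply: is_derive_eq; rewrite /= /GRing.scale/= expr0n/= mul0r expR0.
  by rewrite ?(mul0r,mulr0,add0r,addr0,mul1r).
have : \int[N]_y (y * expR (0 * y) * sin (c * y + th)) =
    \int[N]_y (c * cos (c * y + (c * 0 + th))).
  move: D1; rewrite (funext (tilt_sin c th)) => D1.
  by have := @derive_val _ _ _ _ _ _ _ D1; rewrite (@derive_val _ _ _ _ _ _ _ D3).
under eq_Rintegral do rewrite mul0r expR0 mulr1.
move=> ->; rewrite mulr0 add0r RintegralZl//.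
apply: (@normal_integrable_dom _ 1 1) => // y.
by rewrite mul1r (le_trans (cos_max _))//; exact: one_le.
Qed.

(** By [F_derive] and [stein] the mean F solves F'(c) = - c F(c), so F(c) exp(c^2 / 2) is constant,
    equal to its value cos th at frequency 0. This real form of the characteristic function avoids
    complex integrals. *)
Lemma normal_cos c th :
  \int[N]_y cos (c * y + th) = cos th * expR (- (c ^+ 2 / 2)).
Proof.
pose h x := F x th * expR (x ^+ 2 / 2).
have dh (x : R) : is_derive x (1 : R) h 0.
  have dF := F_derive x th.
  rewrite /h; apply: is_derive_eq.
  have -> : \int[N]_y (- y * sin (x * y + th)) = - (x * F x th).
    rewrite -stein -[RHS]mulN1r -RintegralZl//.
      by apply: eq_Rintegral => y _; rewrite mulN1r mulNr.
    apply: (@normal_integrable_dom _ 1 1) => //.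
      by apply: measurable_funM.
    move=> y; rewrite mul1r normrM (le_trans _ (absle y))// ler_piMr//.
    exact: sin_max.
  by rewrite /= /GRing.scale/=; field.
have := is_derive_0_is_cst c 0 dh.
rewrite /h expr0n/= mul0r expR0 mulr1 /F.
under [in X in _ = X -> _]eq_Rintegral do rewrite mul0r add0r.
have N1 : fine (N setT) = 1 := congr1 fine (@probability_setT _ _ _ N).
rewrite Rintegral_cst// [fine _]N1 mulr1 => <-.
by rewrite -mulrA -expRD addrN expR0 mulr1.
Qed.

End normal_trig.

(** * Independence and freezing *)

Section generated_sigma_algebra.
Context {R : realType} {I : eqType}.

Definition sigma_gen {T : Type} (X : I -> T -> R) (J : set I) : set (set T) :=
  [set A | exists2 i, J i & exists2 B, measurable B & A = X i @^-1` B].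

(* finite intersections of generators: a pi-system generating the same sigma-algebra *)
Definition sigma_cyl {T : Type} (X : I -> T -> R) (J : set I) : set (set T) :=
  [set A | exists s : seq I, exists B : I -> set R,
    [/\ uniq s, forall i, i \in s -> J i, forall i, measurable (B i) &
        A = \bigcap_(i in [set i | i \in s]) (X i @^-1` B i)]].

(** The points of [T] are kept and its measurable sets reduced to those generated by the block [J]:
    measurability on [sigma_of X J] expresses dependence on that block alone. *)
Definition sigma_of {T : pointedType} (X : I -> T -> R) (J : set I) :
  measurableType (sigma_display (sigma_gen X J)) :=
  g_sigma_algebraType (sigma_gen X J).

Lemma sigma_gen_cyl (T : Type) (X : I -> T -> R) J :
  sigma_gen X J `<=` sigma_cyl X J.
Proof.
move=> A [i Ji [B mB ->]]; exists [:: i], (fun=> B); split => //.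
- by move=> j; rewrite inE => /eqP ->.
- apply/seteqP; split => w /=; first by move=> Bw j /=; rewrite mem_seq1 => /eqP ->.
  by move/(_ i); apply; rewrite /= mem_seq1.
Qed.

Lemma sigma_cylI (T : Type) (X : I -> T -> R) J : setI_closed (sigma_cyl X J).
Proof.
move=> _ _ [s1 [B1 [u1 s1J mB1 ->]]] [s2 [B2 [u2 s2J mB2 ->]]].
exists (undup (s1 ++ s2)), (fun i => (if i \in s1 then B1 i else setT) `&`
  (if i \in s2 then B2 i else setT)); split.
- exact: undup_uniq.
- by move=> i; rewrite mem_undup mem_cat => /orP[/s1J|/s2J].
- by move=> i; apply: measurableI; case: ifP.
- apply/seteqP; split => w /=.
    by move=> [h1 h2] i _; split; case: ifPn => // i1; [exact: h1|exact: h2].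
  move=> h; split => i /= i1; have /= := h i; rewrite mem_undup mem_cat i1 ?orbT.
    by move=> /(_ isT)[].
  by move=> /(_ isT)[].
Qed.

Lemma sigma_of_measurable (T : pointedType) (X : I -> T -> R) (J : set I) i :
  J i -> measurable_fun [set: sigma_of X J] (X i : sigma_of X J -> R).
Proof.
move=> Ji _ B mB; rewrite setTI; apply: sub_sigma_algebra.
by exists i => //; exists B.
Qed.

Lemma sigma_cyl_sub (T : pointedType) (X : I -> T -> R) J :
  sigma_cyl X J `<=` (@measurable _ (sigma_of X J)).
Proof.
move=> _ [s [B [us sJ mB ->]]].
apply: (@fin_bigcap_measurable _ (sigma_of X J)).
  exact: finite_seq.
move=> i /sJ Ji; rewrite -[X in measurable X]setTI.
by apply: (@sigma_of_measurable _ X J i Ji).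
Qed.

Lemma sigma_cylE (T : pointedType) (X : I -> T -> R) J :
  @measurable _ (sigma_of X J) = <<s sigma_cyl X J >>.
Proof.
apply/seteqP; split.
  by apply: sub_smallest2r; [exact: smallest_sigma_algebra|exact: sigma_gen_cyl].
apply: smallest_sub; last exact: sigma_cyl_sub.
exact: (@sigma_algebra_measurable _ (sigma_of X J)).
Qed.

End generated_sigma_algebra.

Section independence.
Context {R : realType} {d} {T : measurableType d} (P : probability T R).
Context {I : eqType} (X : I -> T -> R) (J0 : set I).
Hypothesis mX : forall i, J0 i -> measurable_fun setT (X i).
Hypothesis indX : mutually_independent P X J0.
Implicit Types J : set I.

Lemma sigma_of_sub J : J `<=` J0 ->
  (@measurable _ (sigma_of X J) : set (set T)) `<=` measurable.
Proof.
move=> JJ; apply: smallest_sub; first exact: sigma_algebra_measurable.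
move=> _ [i Ji [B mB ->]]; rewrite -[X in measurable X]setTI.
by apply: mX => //; exact: JJ.
Qed.

Lemma measurable_id_sigma_of J : J `<=` J0 ->
  measurable_fun [set: T] (id : T -> sigma_of X J).
Proof. by move=> JJ _ A mA; rewrite setTI; exact: (sigma_of_sub JJ). Qed.

Lemma sigma_of_measurableT J d' (U : measurableType d') (f : T -> U) : J `<=` J0 ->
  measurable_fun [set: sigma_of X J] (f : sigma_of X J -> U) ->
  measurable_fun setT f.
Proof.
move=> JJ mf _ B mB; rewrite setTI; apply: (sigma_of_sub JJ).
by rewrite -[X in measurable X]setTI; exact: mf.
Qed.

Variables J1 J2 : set I.
Hypotheses (J10 : J1 `<=` J0) (J20 : J2 `<=` J0).
Hypothesis J12 : forall i, J1 i -> J2 i -> False.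

Let cyl_measurable J : J `<=` J0 -> sigma_cyl X J `<=` (@measurable _ T).
Proof. by move=> JJ A /sigma_cyl_sub mA; exact: (sigma_of_sub JJ). Qed.

Let indep_cyl A B : sigma_cyl X J1 A -> sigma_cyl X J2 B ->
  P (A `&` B) = (P A * P B)%E.
Proof.
move=> [s1 [B1 [u1 s1J mB1 ->]]] [s2 [B2 [u2 s2J mB2 ->]]].
pose C i := if i \in s1 then B1 i else B2 i.
have s12 i : i \in s2 -> (i \in s1) = false.
  by move=> i2; apply/negP => i1; exact: J12 (s1J _ i1) (s2J _ i2).
have mC i : measurable (C i) by rewrite /C; case: ifP.
have -> : \bigcap_(i in [set i | i \in s1]) (X i @^-1` B1 i) `&`
    \bigcap_(i in [set i | i \in s2]) (X i @^-1` B2 i) =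
  \bigcap_(i in [set i | i \in s1 ++ s2]) (X i @^-1` C i).
  apply/seteqP; split => w /=.
    move=> [h1 h2] i /=; rewrite mem_cat /C; case: ifPn => [i1 _|_ /= i2].
      exact: h1.
    exact: h2.
  move=> h; split => i /= ii; have /= := h i; rewrite mem_cat ii ?orbT /C.
    by rewrite ii => /(_ isT).
  by rewrite s12// => /(_ isT).
have -> : \bigcap_(i in [set i | i \in s1]) (X i @^-1` B1 i) =
   \bigcap_(i in [set i | i \in s1]) (X i @^-1` C i).
  by apply: eq_bigcapr => i /= ii; rewrite /C ii.
have -> : \bigcap_(i in [set i | i \in s2]) (X i @^-1` B2 i) =
   \bigcap_(i in [set i | i \in s2]) (X i @^-1` C i).
  by apply: eq_bigcapr => i /= ii; rewrite /C s12.
rewrite !indX//.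
- by rewrite big_cat.
- by move=> i /s2J /J20.
- by move=> i /s1J /J10.
- rewrite cat_uniq u1 u2 andbT /=; apply/hasPn => i /s12 /= ->//.
- by move=> i; rewrite mem_cat => /orP[/s1J/J10|/s2J/J20].
Qed.

(* Dynkin extension in the first argument *)
Let indep_ext J (B : set T) : J `<=` J0 -> measurable B ->
  (forall A, sigma_cyl X J A -> P (A `&` B) = (P A * P B)%E) ->
  forall A, @measurable _ (sigma_of X J) A -> P (A `&` B) = (P A * P B)%E.
Proof.
move=> JJ mB h A mA.
have JT A' : @measurable _ (sigma_of X J) A' -> d.-measurable A'.
  exact: sigma_of_sub.
have PBf : P B \is a fin_num by exact: fin_num_measure.
apply: (@dynkin_induction _ (sigma_of X J) (sigma_cyl X J)
  (fun A => P (A `&` B) = (P A * P B)%E)) => //.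
- exact: sigma_cylE.
- exact: sigma_cylI.
- by rewrite setTI probability_setT mul1e.
- move=> S /JT mS hS.
  have hD : P (B `\` S) = (P B - P (B `&` S))%E.
    by apply: measureD => //; rewrite -ge0_fin_numE.
  have hC : P (~` S) = (1 - P S)%E by exact: probability_setC.
  have hS' : P (B `&` S) = (P S * P B)%E by rewrite setIC; exact: hS.
  have PSf : P S \is a fin_num by exact: fin_num_measure.
  rewrite setIC -setDE [P (B `\` S)]hD hS' [P (~` S)]hC.
  have alg (p q : \bar R) : p \is a fin_num -> q \is a fin_num ->
      (q - p * q = (1 - p) * q)%E.
    by case: p q => [p| |] [q| |] //= _ _; congr EFin; ring.
  exact: alg.
- move=> F mF0 tF hF.
  have mF i : d.-measurable (F i) := JT _ (mF0 i).
  have mFB i : d.-measurable ((F i : set T) `&` B) by exact: measurableI.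
  have tFB : trivIset [set: nat] (fun i => (F i : set T) `&` B).
    exact: trivIset_setIr.
  rewrite setI_bigcupl.
  rewrite (@measure_bigcup _ _ _ P setT (fun i => (F i : set T) `&` B))//.
  rewrite (@measure_bigcup _ _ _ P setT F)//.
  rewrite muleC -(fineK PBf) -nneseriesZl//; apply: eq_eseriesr => i _.
  by rewrite fineK// muleC; exact: hF.
- by rewrite -sigma_cylE.
Qed.

(** [indep_ext] is applied twice: it extends the second event while the first is still a cylinder,
    then the first event with the second arbitrary. *)
Lemma sigma_of_indep A B : @measurable _ (sigma_of X J1) A ->
  @measurable _ (sigma_of X J2) B -> P (A `&` B) = (P A * P B)%E.
Proof.
move=> mA mB; apply: (indep_ext J10) => //; first exact: (sigma_of_sub J20).
move=> A' cA'; rewrite setIC muleC; apply: (indep_ext J20) => //.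
  exact: cyl_measurable cA'.
by move=> B' cB'; rewrite setIC muleC; exact: indep_cyl.
Qed.

(** Freezing: a function of two independent blocks may be integrated one block
    at a time; the blocks are kept as sub-sigma-algebras of the same [T], so the
    joint law is that of the diagonal map. *)
Lemma integral_freeze (f : T -> T -> \bar R) :
  measurable_fun [set: sigma_of X J1 * sigma_of X J2]
    ((fun z => f z.1 z.2) : sigma_of X J1 * sigma_of X J2 -> \bar R) ->
  (forall w w', 0 <= f w w')%E ->
  (\int[P]_w f w w = \int[P]_w \int[P]_w' f w w')%E.
Proof.
move=> mf f0.
have m1 := measurable_id_sigma_of J10.
have m2 := measurable_id_sigma_of J20.
pose mix1 := isMeasurableFun.Build _ _ _ _ _ m1.
pose id1 : {mfun T >-> sigma_of X J1} := HB.pack (id : T -> sigma_of X J1) mix1.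
pose mix2 := isMeasurableFun.Build _ _ _ _ _ m2.
pose id2 : {mfun T >-> sigma_of X J2} := HB.pack (id : T -> sigma_of X J2) mix2.
pose diag (w : T) : sigma_of X J1 * sigma_of X J2 := (w, w).
have md : measurable_fun [set: T] diag by exact: measurable_fun_pair.
pose mixd := isMeasurableFun.Build _ _ _ _ _ md.
pose idd : {mfun T >-> (sigma_of X J1 * sigma_of X J2)%type} := HB.pack diag mixd.
(* The law of the diagonal agrees with the product of its marginals on rectangles, by independence,
   hence everywhere. *)
have E : forall C, measurable C ->
    (distribution P id1 \x distribution P id2)%E C = distribution P idd C.
  by apply: product_measure_unique => A B mA mB; exact: sigma_of_indep.
transitivity (\int[distribution P idd]_z f z.1 z.2)%E.
  by rewrite ge0_integral_distribution.
transitivity (\int[distribution P id1 \x distribution P id2]_z f z.1 z.2)%E.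
  by apply: eq_measure_integral => C mC _; exact/esym/E.
rewrite fubini_tonelli1//= ge0_integral_distribution//.
- apply: eq_integral => w _; rewrite /fubini_F /= ge0_integral_distribution//.
  have mp : measurable_fun [set: sigma_of X J2]
      (fun w' : sigma_of X J2 => ((w : sigma_of X J1), w')).
    exact: measurable_fun_pair.
  exact: (measurableT_comp mf mp).
- exact: measurable_fun_fubini_tonelli_F.
- by move=> w; exact: integral_ge0.
Qed.

End independence.

(** * Integrals of Gaussian variables and of independent Gaussian sums *)

Section gaussian_law.
Context {R : realType} {d} {T : measurableType d} (P : probability T R).
Local Notation N := (normal_prob (0 : R) 1).

(** Writing the variable as sqrt(v) times a standard normal one treats the Dirac case [v = 0], met
    by the biases when [Cb = 0], with the same formula. *)
Lemma integral_gauss_law (X : T -> R) (v : R) (f : R -> R) : 0 <= v ->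
  measurable_fun setT X -> has_law P X (gauss_law v) -> continuous f ->
  (forall x, 0 <= f x) ->
  (\int[P]_w (f (X w))%:E = \int[N]_t (f (Num.sqrt v * t))%:E)%E.
Proof.
move=> v0 mX lX cf f0.
have mf : measurable_fun setT f by exact: continuous_measurable_fun.
have mX' : measurable_fun setT (X : T -> measurableTypeR R) by exact: mX.
pose mixX := isMeasurableFun.Build _ _ _ _ _ mX'.
pose X' : {mfun T >-> measurableTypeR R} := HB.pack (X : T -> measurableTypeR R) mixX.
have mfE : measurable_fun [set: measurableTypeR R] (fun x => (f x)%:E).
  by apply/measurable_EFinP; exact: mf.
have f0E x : (0 <= (f x)%:E)%E by rewrite lee_fin.
have -> : (\int[P]_w (f (X w))%:E = \int[distribution P X']_x (f x)%:E)%E.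
  by rewrite (ge0_integral_distribution X' mfE f0E).
have [v00|vN0] := eqVneq v 0.
  rewrite v00 sqrtr0.
  have -> : (\int[distribution P X']_x (f x)%:E = \int[\d_(0%R : measurableTypeR R)]_x (f x)%:E)%E.
    apply: eq_measure_integral => B mB _.
    by have := lX B mB; rewrite /gauss_law v00 eqxx.
  rewrite integral_dirac// diracT mul1e.
  have -> : (\int[N]_t (f (0 * t))%:E = \int[N]_t (cst (f 0)%:E) t)%E.
    by apply: eq_integral => t _; rewrite mul0r.
  by rewrite integral_cst// [X in (_ * X)%E](@probability_setT _ _ _ N) mule1.
have s0 : 0 < Num.sqrt v by rewrite sqrtr_gt0 lt_neqAle eq_sym vN0.
have -> : (\int[distribution P X']_x (f x)%:E =
    \int[normal_prob 0 (Num.sqrt v)]_x (f x)%:E)%E.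
  apply: eq_measure_integral => B mB _.
  by have := lX B mB; rewrite /gauss_law (negbTE vN0).
rewrite (@integral_normal_prob_std _ 0 _ f s0 cf f0).
by apply: eq_integral => t _; rewrite add0r.
Qed.

Lemma integral_gauss_exp (X : T -> R) (v c b : R) : 0 <= v ->
  measurable_fun setT X -> has_law P X (gauss_law v) ->
  (\int[P]_w (expR (b + c * X w))%:E = (expR (b + c ^+ 2 * v / 2))%:E)%E.
Proof.
move=> v0 mX lX.
have cf : continuous (fun x : R => expR (b + c * x)).
  move=> x; apply: continuous_comp; last exact: continuous_expR.
  by apply: cvgD; [exact: cvg_cst|apply: cvgM; [exact: cvg_cst|exact: cvg_id]].
rewrite (integral_gauss_law v0 mX lX cf (fun x => expR_ge0 _)).
have := @integral_normal_tilt R (c * Num.sqrt v) (cst (expR b)) (fun=> cvg_cst _)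
  (fun=> expR_ge0 _).
have -> : (\int[N]_x (cst (expR b) (c * Num.sqrt v + x))%:E = (expR b)%:E)%E.
  transitivity (\int[N]_x (cst (expR b)%:E) x)%E; first by [].
  by rewrite integral_cst// [X in (_ * X)%E](@probability_setT _ _ _ N) mule1.
rewrite -EFinM -expRD exprMn sqr_sqrtr// addrC => <-.
by apply: eq_integral => t _; congr EFin; rewrite /= [RHS]mulrC -expRD mulrA.
Qed.

(** The summand 1 makes the integrand nonnegative, as freezing and the change of law require. *)
Lemma integral_gauss_cos (X : T -> R) (v c th : R) : 0 <= v ->
  measurable_fun setT X -> has_law P X (gauss_law v) ->
  (\int[P]_w (1 + cos (th + c * X w))%:E =
   (1 + cos th * expR (- (c ^+ 2 * v / 2)))%:E)%E.
Proof.
move=> v0 mX lX.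
have cf : continuous (fun x : R => 1 + cos (th + c * x)).
  move=> x; apply: cvgD; first exact: cvg_cst.
  apply: continuous_comp; last exact: continuous_cos.
  by apply: cvgD; [exact: cvg_cst|apply: cvgM; [exact: cvg_cst|exact: cvg_id]].
have f0 (x : R) : 0 <= 1 + cos (th + c * x).
  by have := cos_geN1 (th + c * x); lra.
rewrite (integral_gauss_law v0 mX lX cf f0).
have mc : measurable_fun [set: R] (fun y => cos (c * Num.sqrt v * y + th)).
  apply: continuous_measurable_fun => y; apply: continuous_comp.
    by apply: cvgD; [apply: cvgM; [exact: cvg_cst|exact: cvg_id]|exact: cvg_cst].
  exact: continuous_cos.
have ic : N.-integrable setT (fun y => (cos (c * Num.sqrt v * y + th))%:E).
  apply: (@normal_integrable_dom _ _ 1 0) => // y.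
  by rewrite mul0r oppr0 mul0r expR0 mul1r (le_trans (cos_max _))//; lra.
have i1 : N.-integrable setT (fun=> 1%:E) by exact: finite_measure_integrable_cst.
transitivity (\int[N]_t (1%:E + (cos (c * Num.sqrt v * t + th))%:E))%E.
  by apply: eq_integral => t _; rewrite -EFinD mulrA addrC (addrC th) addrC.
rewrite (integralD measurableT i1 ic).
have -> : (\int[N]_x 1%:E = 1)%E.
  by rewrite integral_cst// mul1e; exact: (@probability_setT _ _ _ N).
have := normal_cos (c * Num.sqrt v) th; rewrite /Rintegral exprMn sqr_sqrtr//.
have := integrable_fin_num measurableT ic.
by case: (\int[N]_x _)%E => // x _ /= ->.
Qed.

End gaussian_law.

Lemma integral_prob_cst (R : realType) d (T : measurableType d)
    (P : probability T R) (r : R) : (\int[P]_w r%:E = r%:E)%E.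
Proof. by rewrite integral_cst// [X in (_ * X)%E](@probability_setT _ _ _ P) mule1. Qed.

Lemma measurable_lin (R : realType) d (U : measurableType d) (I : eqType)
    (s : seq I) (c : I -> R) (f : I -> U -> R) :
  (forall j, j \in s -> measurable_fun setT (f j)) ->
  measurable_fun setT (fun w => \sum_(j <- s) c j * f j w).
Proof.
elim: s => [|j s ih] mf.
  by under eq_fun do rewrite big_nil; exact: measurable_cst.
under eq_fun do rewrite big_cons.
apply: measurable_funD; last by apply: ih => k ks; apply: mf; rewrite in_cons ks orbT.
by apply: measurable_funM => //; apply: mf; rewrite mem_head.
Qed.

Section linear_combinations.
Context {R : realType} {d} {T : measurableType d} (P : probability T R).
Context {I : eqType} (X : I -> T -> R) (J : set I) (v : I -> R).
Hypothesis mX : forall i, J i -> measurable_fun setT (X i).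
Hypothesis indX : mutually_independent P X J.
Hypothesis lX : forall i, J i -> has_law P (X i) (gauss_law (v i)).
Hypothesis v0 : forall i, J i -> 0 <= v i.

Let freeze_last (s : seq I) i (c : I -> R) (h : R -> R -> R) :
  uniq (i :: s) -> (forall j, j \in i :: s -> J j) ->
  measurable_fun setT (fun z : R * R => h z.1 z.2) -> (forall x y, 0 <= h x y) ->
  (\int[P]_w (h (\sum_(j <- s) c j * X j w) (X i w))%:E =
   \int[P]_w \int[P]_w' (h (\sum_(j <- s) c j * X j w) (X i w'))%:E)%E.
Proof.
move=> /= /andP[iNs us] sJ mh h0.
pose J1 := [set j | j \in s]; pose J2 := [set i].
apply: (@integral_freeze _ _ _ P _ X J mX indX J1 J2 _ _ _
  (fun w w' => (h (\sum_(j <- s) c j * X j w) (X i w'))%:E)).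
- by move=> j js; apply: sJ; rewrite in_cons js orbT.
- by move=> j ->; apply: sJ; rewrite mem_head.
- by move=> j js ji; move: iNs; rewrite -ji js.
- apply/measurable_EFinP.
  have m1 : measurable_fun [set: sigma_of X J1 * sigma_of X J2]
      (fun z => \sum_(j <- s) c j * X j z.1).
    rewrite (_ : (fun z => _) =
      (fun w : sigma_of X J1 => \sum_(j <- s) c j * X j w) \o fst) //.
    apply: measurableT_comp => //.
    by apply: measurable_lin => j js; exact: sigma_of_measurable.
  have m2 : measurable_fun [set: sigma_of X J1 * sigma_of X J2] (fun z => X i z.2).
    rewrite (_ : (fun z => _) = (X i : sigma_of X J2 -> R) \o snd) //.
    by apply: measurableT_comp => //; exact: sigma_of_measurable.
  exact: (measurableT_comp mh (measurable_fun_pair m1 m2)).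
- by move=> w w'; rewrite lee_fin.
Qed.

Let variance (s : seq I) (c : I -> R) := \sum_(j <- s) c j ^+ 2 * v j.

Lemma integral_lin_exp (s : seq I) (c : I -> R) (b : R) :
  uniq s -> (forall j, j \in s -> J j) ->
  (\int[P]_w (expR (b + \sum_(j <- s) c j * X j w))%:E =
   (expR (b + variance s c / 2))%:E)%E.
Proof.
rewrite /variance; elim: s b => [|i s ih] b us sJ.
  under eq_integral do rewrite big_nil.
  by rewrite big_nil mul0r integral_prob_cst.
have sJ' j : j \in s -> J j by move=> js; apply: sJ; rewrite in_cons js orbT.
have Ji : J i by apply: sJ; rewrite mem_head.
have us' : uniq s by case/andP: us.
under eq_integral do rewrite big_cons addrA addrAC.
transitivity (\int[P]_w \int[P]_w'
    (expR (b + \sum_(j <- s) c j * X j w + c i * X i w'))%:E)%E.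
  apply: (@freeze_last s i c (fun x y => expR (b + x + c i * y))) => //.
  apply: measurableT_comp => //; apply: measurable_funD.
    exact: measurable_funD.
  exact: measurable_funM.
transitivity (\int[P]_w
    (expR (b + c i ^+ 2 * v i / 2 + \sum_(j <- s) c j * X j w))%:E)%E.
  apply: eq_integral => w _.
  by rewrite (integral_gauss_exp _ _ (v0 Ji) (mX Ji) (lX Ji)) addrAC.
by rewrite ih// big_cons; congr (expR _)%:E; field.
Qed.

Lemma integral_lin_cos (s : seq I) (c : I -> R) (th : R) :
  uniq s -> (forall j, j \in s -> J j) ->
  (\int[P]_w (1 + cos (th + \sum_(j <- s) c j * X j w))%:E =
   (1 + cos th * expR (- (variance s c / 2)))%:E)%E.
Proof.
rewrite /variance; elim: s th => [|i s ih] th us sJ.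
  under eq_integral do rewrite big_nil.
  by rewrite big_nil mul0r integral_prob_cst addr0 oppr0 expR0 mulr1.
have sJ' j : j \in s -> J j by move=> js; apply: sJ; rewrite in_cons js orbT.
have Ji : J i by apply: sJ; rewrite mem_head.
have us' : uniq s by case/andP: us.
have mcos (f : T -> R) : measurable_fun setT f -> measurable_fun setT (fun w => cos (f w)).
  by move=> mf; apply: measurableT_comp mf; apply: continuous_measurable_fun; exact: continuous_cos.
under eq_integral do rewrite big_cons addrA addrAC.
transitivity (\int[P]_w \int[P]_w'
    (1 + cos (th + \sum_(j <- s) c j * X j w + c i * X i w'))%:E)%E.
  apply: (@freeze_last s i c (fun x y => 1 + cos (th + x + c i * y))) => //.
    apply: measurable_funD => //; apply: (measurableT_comp (f := cos)).
      by apply: continuous_measurable_fun; exact: continuous_cos.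
    apply: measurable_funD; first exact: measurable_funD.
    exact: measurable_funM.
under eq_integral => w _.
  rewrite (integral_gauss_cos _ _ (v0 Ji) (mX Ji) (lX Ji)); over.
pose e := expR (- (c i ^+ 2 * v i / 2)).
have e1 : e <= 1.
  by rewrite -[leRHS]expR0 ler_expR oppr_le0 divr_ge0// mulr_ge0 ?sqr_ge0// v0.
have e0 : 0 <= e by exact: expR_ge0.
(* Integrating out [X i] multiplies the cosine by [e]. As [e <= 1], 1 + e cos = (1 - e) + e (1 +
   cos) is a sum of nonnegative terms, and the induction hypothesis applies to the second. *)
transitivity (\int[P]_w ((1 - e)%:E +
    e%:E * (1 + cos (th + \sum_(j <- s) c j * X j w))%:E))%E.
  by apply: eq_integral => w _; rewrite -EFinM -EFinD -/e; congr EFin; ring.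
have mS : measurable_fun setT (fun w => \sum_(j <- s) c j * X j w).
  by apply: measurable_lin => j js; apply: mX; exact: sJ'.
have mc : measurable_fun setT
    (fun w => (1 + cos (th + \sum_(j <- s) c j * X j w))%:E).
  apply/measurable_EFinP; apply: measurable_funD => //; apply: mcos.
  exact: measurable_funD.
have c0 w : (0 <= (1 + cos (th + \sum_(j <- s) c j * X j w))%:E)%E.
  by rewrite lee_fin; have := cos_geN1 (th + \sum_(j <- s) c j * X j w); lra.
rewrite ge0_integralD//; last 3 first.
- by move=> w _; rewrite lee_fin subr_ge0.
- by move=> w _; rewrite mule_ge0.
- exact: measurable_funeM.
rewrite integral_prob_cst ge0_integralZl// ih//.
rewrite -EFinM -EFinD; congr EFin.
rewrite big_cons mulrDl opprD expRD -/e; ring.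
Qed.

End linear_combinations.

(** * Trigonometric approximation and Gaussian functionals *)

Section trig_polynomials.
Context {R : realType}.
Implicit Types (f g : R -> R) (F : R -> R -> R).

(** Entries are (amplitude, frequencies, phase). With phases, cosines are enough: a sine is a
    shifted cosine, and products stay in the class by the product-to-sum formula. *)
Definition trig2 F := exists l : seq (R * (R * R) * R), forall u v,
  F u v = \sum_(p <- l) p.1.1 * cos (p.1.2.1 * u + p.1.2.2 * v + p.2).

Lemma trig2D F1 F2 : trig2 F1 -> trig2 F2 -> trig2 (fun u v => F1 u v + F2 u v).
Proof.
move=> [l1 h1] [l2 h2]; exists (l1 ++ l2) => u v.
by rewrite big_cat /= h1 h2.
Qed.

Lemma trig2_cos c s t th : trig2 (fun u v => c * cos (s * u + t * v + th)).
Proof. by exists [:: (c, (s, t), th)] => u v; rewrite big_seq1. Qed.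

Lemma trig2_cst c : trig2 (fun u v => c).
Proof.
exists [:: (c, (0, 0), 0)] => u v.
by rewrite big_seq1 /= !mul0r !addr0 cos0 mulr1.
Qed.

Lemma trig2_ext F1 F2 : (forall u v, F1 u v = F2 u v) -> trig2 F1 -> trig2 F2.
Proof. by move=> e [l h]; exists l => u v; rewrite -e. Qed.

Lemma trig2_sum (I : Type) (s : seq I) (F : I -> R -> R -> R) :
  (forall i, trig2 (F i)) -> trig2 (fun u v => \sum_(i <- s) F i u v).
Proof.
move=> h; elim: s => [|i s ih].
  by apply: trig2_ext (trig2_cst 0) => u v; rewrite big_nil.
by apply: trig2_ext (trig2D (h i) ih) => u v; rewrite big_cons.
Qed.

Lemma trig2M F1 F2 : trig2 F1 -> trig2 F2 -> trig2 (fun u v => F1 u v * F2 u v).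
Proof.
move=> [l1 h1] [l2 h2].
apply: (@trig2_ext (fun u v => \sum_(p <- l1) \sum_(q <- l2)
  (p.1.1 * cos (p.1.2.1 * u + p.1.2.2 * v + p.2) *
   (q.1.1 * cos (q.1.2.1 * u + q.1.2.2 * v + q.2))))).
  by move=> u v; rewrite h1 h2 big_distrlr.
apply: trig2_sum => -[[c [s t]] th]; apply: trig2_sum => -[[c' [s' t']] th'] /=.
apply: trig2_ext (trig2D
  (trig2_cos (c * c' / 2) (s + s') (t + t') (th + th'))
  (trig2_cos (c * c' / 2) (s - s') (t - t') (th - th'))) => u v.
set a := s * u + t * v + th; set b := s' * u + t' * v + th'.
have -> : (s + s') * u + (t + t') * v + (th + th') = a + b by rewrite /a /b; ring.
have -> : (s - s') * u + (t - t') * v + (th - th') = a - b by rewrite /a /b; ring.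
by rewrite cosD cosB; field.
Qed.

(* [bern p n phi k] is the expectation of [phi (k + Bin(n, p))] *)
Fixpoint bern (p : R) (n : nat) (phi : nat -> R) (k : nat) : R :=
  if n is n'.+1 then p * bern p n' phi k.+1 + (1 - p) * bern p n' phi k
  else phi k.

Lemma bern_le p n phi psi k : 0 <= p <= 1 -> (forall j, phi j <= psi j) ->
  bern p n phi k <= bern p n psi k.
Proof.
move=> /andP[p0 p1] h; elim: n k => [|n ih] k //=.
by apply: lerD; apply: ler_wpM2l => //; lra.
Qed.

(** The quadratic moment of k + Bin(n, p) about c: squared distance of the mean k + n p from c, plus
    the variance n p (1 - p). *)
Lemma bern_square p n a b c k :
  bern p n (fun j => a + b * (j%:R - c) ^+ 2) k =
  a + b * ((k%:R + n%:R * p - c) ^+ 2 + n%:R * (p * (1 - p))).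
Proof.
elim: n k => [|n ih] k /=; first by rewrite !mul0r !addr0.
by rewrite !ih -!natr1; ring.
Qed.

Lemma bern_cst p n a k : bern p n (fun=> a) k = a.
Proof. by elim: n k => [|n ih] k //=; rewrite !ih; ring. Qed.

Lemma bernN p n phi k : bern p n (fun j => - phi j) k = - bern p n phi k.
Proof. by elim: n k => [|n ih] k //=; rewrite !ih; ring. Qed.

Lemma bernB p n phi a k : bern p n (fun j => phi j - a) k = bern p n phi k - a.
Proof. by elim: n k => [|n ih] k //=; rewrite !ih; ring. Qed.

Lemma bern_bound p n phi k M : 0 <= p <= 1 -> (forall j, `|phi j| <= M) ->
  `|bern p n phi k| <= M.
Proof.
move=> p01 h; rewrite ler_norml; apply/andP; split.
  rewrite -(bern_cst p n (- M) k); apply: bern_le => // j.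
  by have := h j; rewrite ler_norml => /andP[].
rewrite -[leRHS](bern_cst p n M k); apply: bern_le => // j.
by have := h j; rewrite ler_norml => /andP[].
Qed.

(** Chebyshev's inequality as in Bernstein's proof of the Weierstrass theorem: the quadratic
    majorant of the error has mean at most [e + A * n], since the binomial variance is at most
    [n]. *)
Lemma bern_approx p n phi y e A : 0 <= p <= 1 ->
  (forall j, `|phi j - y| <= e + A * (j%:R - n%:R * p) ^+ 2) -> 0 <= A ->
  `|bern p n phi 0 - y| <= e + A * n%:R.
Proof.
move=> p01 h A0.
have B : bern p n (fun j => e + A * (j%:R - n%:R * p) ^+ 2) 0 <= e + A * n%:R.
  rewrite bern_square add0r subrr expr0n/= add0r lerD2l; apply: ler_wpM2l => //.
  by rewrite ler_piMr//; move: p01 => /andP[]; nra.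
rewrite -bernB ler_norml; apply/andP; split.
  rewrite lerNl -bernN (le_trans _ B)//; apply: bern_le => // j.
  by have := h j; rewrite ler_norml => /andP[]; lra.
rewrite (le_trans _ B)//; apply: bern_le => // j.
by have := h j; rewrite ler_norml => /andP[].
Qed.

Lemma trig2_bern F n phi k : trig2 F -> trig2 (fun u v => bern (F u v) n phi k).
Proof.
move=> hF; elim: n k => [|n ih] k /=; first exact: trig2_cst.
apply: trig2D; apply: trig2M => //.
by apply: trig2D; [exact: trig2_cst|
  apply: trig2_ext (trig2M (trig2_cst (-1)) hF) => u v; rewrite mulN1r].
Qed.

(** Heine-Cantor in which only [x] runs over the segment: [y] may leave it, as the nodes j / n of a
    Bernstein polynomial do below. *)
Lemma locally_uniform_continuity f (a b e : R) : 0 < e ->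
  (forall x, a <= x <= b -> {for x, continuous f}) ->
  exists2 r : R, 0 < r & forall x y, a <= x <= b -> `|x - y| <= r -> `|f x - f y| <= e.
Proof.
move=> e0 cf.
have /compact_near_coveringP nc := @segment_compact R a b.
have H : \forall r \near (0 : R)^'+, forall x, `[a, b]%classic x ->
    forall y, `|x - y| <= r -> `|f x - f y| <= e.
  apply: nc => x0 /=; rewrite in_itv /= => /cf cfx.
  have /cvgrPdist_lt/(_ (e / 2)) := cfx.
  rewrite divr_gt0// => /(_ isT) /nbhs_ballP[r /= r0 hr].
  near=> x r' => /= y xy.
  have h1 : ball x0 r x.
    by near: x; apply: nbhsx_ballx.
  have h1' : ball x0 (r / 2) x.
    by near: x; apply: nbhsx_ballx; rewrite divr_gt0.
  have h2 : ball x0 r y.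
    have r'r : r' < r / 2.
      by near: r'; apply: nbhs_right_lt; rewrite divr_gt0.
    move: h1'; rewrite /ball/= => h1'.
    by rewrite -(subrKA x) (le_lt_trans (ler_normD _ _))//; lra.
  have := hr _ h1; have := hr _ h2 => /= g2 g1.
  rewrite -(subrKA (f x0)) (le_trans (ler_normD _ _))//.
  by rewrite distrC; lra.
near (0 : R)^'+ => r; exists r => //.
move=> x y xab; have := near H r; apply => //.
Unshelve. all: by end_near. Qed.

Section one_variable.
Variables (sigma : R -> R) (M : R).
Hypotheses (csigma : continuous sigma) (sigmaM : forall t, `|sigma t| <= M).

(** A sine change of variable carries [-K, K] into [0, 1]; the Bernstein polynomial of the
    transported [sigma], evaluated at the sine, is a trigonometric polynomial. Being an average of
    values of [sigma], it keeps the bound [M] on the whole line. *)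
Lemma trig_approx K e : 0 < K -> 0 < e -> exists T : R -> R,
  [/\ trig2 (fun u v => T u), trig2 (fun u v => T v), forall u, `|T u| <= M &
      forall u, `|u| <= K -> `|sigma u - T u| <= e].
Proof.
move=> K0 e0.
have M0 : 0 <= M by rewrite (le_trans _ (sigmaM 0)).
have pi2 : 1 <= pi / 2 :> R by exact: pihalf_ge1.
(* With K' = 2 K the angle u / K' stays in [-1/2, 1/2], where [asin] inverts [sin], and [g u] stays
   away from the endpoints 0 and 1. *)
pose K' := 2 * K; have K'0 : 0 < K' by rewrite mulr_gt0.
pose g (u : R) := (1 + sin (u / K')) / 2.
pose f (p : R) := sigma (K' * asin (2 * p - 1)).
have g01 u : 0 <= g u <= 1.
  by rewrite /g; have := sin_geN1 (u / K'); have := sin_le1 (u / K'); lra.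
pose s := sin (1 / 2 : R).
have s1 : s < 1.
  rewrite -sin_pihalf ltr_sin ?in_itv //=; lra.
have gK u : `|u| <= K -> (1 - s) / 2 <= g u <= (1 + s) / 2 /\ f (g u) = sigma u.
  move=> uK.
  have : - (1 / 2) <= u / K' <= 1 / 2.
    rewrite ler_pdivlMr// ler_pdivrMr// /K'.
    by move: uK; rewrite ler_norml; lra.
  move=> /andP[u1 u2]; split.
    have h1 : sin (u / K') <= s.
      by rewrite leNgt ltr_sin ?in_itv/= -?leNgt; lra.
    have h2 : sin (- (1 / 2)) <= sin (u / K').
      by rewrite leNgt ltr_sin ?in_itv/= -?leNgt; lra.
    by move: h2; rewrite sinN -/s /g; lra.
  rewrite /f /g (_ : 2 * _ - 1 = sin (u / K')); last by field.
  rewrite sinK ?in_itv/=; last by lra.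
  by rewrite mulrC divfK// gt_eqF.
have cf x : (1 - s) / 2 <= x <= (1 + s) / 2 -> {for x, continuous f}.
  move=> /andP[x1 x2]; rewrite /f.
  apply: (cvg_comp (fun p => K' * asin (2 * p - 1)) sigma); last exact: csigma.
  apply: cvgM; first exact: cvg_cst.
  apply: (cvg_comp (fun p => 2 * p - 1) asin).
    apply: cvgB; last exact: cvg_cst.
    by apply: cvgM; [exact: cvg_cst|exact: cvg_id].
  by apply: continuous_asin; lra.
have e20 : 0 < e / 2 by rewrite divr_gt0.
have [r r0 hr] := locally_uniform_continuity e20 cf.
(* Nodes farther than [r] from [g u] satisfy A n (j - n g u)^2 >= 2 M, the trivial bound on the
   error, while A n * n = 2 M / (n r^2) tends to 0. *)
pose A n : R := 2 * M / (n%:R ^+ 2 * r ^+ 2).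
have A0 n : 0 <= A n by apply: divr_ge0; rewrite mulr_ge0 ?sqr_ge0.
have [n n0 hn] : exists2 n : nat, (0 < n)%N & A n * n%:R <= e / 2.
  pose x : R := 4 * M / (r ^+ 2 * e).
  exists (Num.truncn x).+1 => //.
  have : x < (Num.truncn x).+1%:R by exact: truncnS_gt.
  set n := (Num.truncn x).+1 => xn.
  have n0 : 0 < n%:R :> R by rewrite ltr0n.
  rewrite /A (_ : _ * n%:R = 2 * M / (n%:R * r ^+ 2)); last first.
    by field; rewrite ?gt_eqF.
  move: xn; rewrite /x ltr_pdivrMr ?mulr_gt0 ?exprn_gt0//.
  rewrite ler_pdivrMr ?mulr_gt0 ?exprn_gt0//; lra.
pose T u := bern (g u) n (fun j => f (j%:R / n%:R)) 0.
have tg (h : R -> R -> R) : trig2 (fun u v => sin (h u v / K')) ->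
    trig2 (fun u v => T (h u v)).
  move=> th; apply: trig2_bern; rewrite /g.
  apply: trig2_ext (trig2D (trig2_cst (1/2)) (trig2M (trig2_cst (1/2)) th)) => u v.
  by field.
have nR : 0 < n%:R :> R by rewrite ltr0n.
exists T; split.
- apply: (tg (fun u v => u)).
  apply: trig2_ext (trig2_cos 1 K'^-1 0 (- (pi / 2))) => u v.
  by rewrite mul1r mul0r addr0 mulrC cosBpihalf.
- apply: (tg (fun u v => v)).
  apply: trig2_ext (trig2_cos 1 0 K'^-1 (- (pi / 2))) => u v.
  by rewrite mul1r mul0r add0r mulrC cosBpihalf.
- by move=> u; apply: bern_bound => // j; exact: sigmaM.
- move=> u uK; have [gu fg] := gK u uK.
  rewrite distrC (le_trans (@bern_approx _ _ _ _ (e / 2) (A n) (g01 u) _ _))//.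
  + move=> j; have [jr|jr] := leP `|g u - j%:R / n%:R| r.
      rewrite -fg distrC (le_trans (hr _ _ gu jr))// lerDl.
      by rewrite mulr_ge0// ?sqr_ge0// A0.
    rewrite (le_trans (ler_normB _ _))//.
    have : 2 * M <= A n * (j%:R - n%:R * g u) ^+ 2.
      have -> : A n * (j%:R - n%:R * g u) ^+ 2 = 2 * M * (`|g u - j%:R / n%:R| / r) ^+ 2.
        rewrite expr_div_n -normrX ger0_norm ?sqr_ge0// /A.
        by field; rewrite ?gt_eqF.
      rewrite ler_peMr ?mulr_ge0// expr_ge1// ?divr_ge0 ?ltW//.
      by rewrite ltr_pdivlMr// mul1r.
      exact: lt_trans jr.
    by have := sigmaM (K' * asin (2 * (j%:R / n%:R) - 1)); have := sigmaM u;
      rewrite -/(f _); lra.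
  + by rewrite [leRHS](splitr e) lerD2l.
Qed.

Lemma trig2_approx e : 0 < e -> exists2 F : R -> R -> R, trig2 F &
  forall u v, `|sigma u * sigma v - F u v| <=
    e * (1 + (expR u + expR (- u)) + (expR v + expR (- v))).
Proof.
move=> e0.
have M0 : 0 <= M by rewrite (le_trans _ (sigmaM 0)).
(* Beyond [K] the weight wins: e (exp u + exp(-u)) >= e K >= 2 M^2, the trivial bound on the
   error. *)
pose K := 2 * M ^+ 2 / e + 1.
have K0 : 0 < K by rewrite ltr_wpDl// divr_ge0 ?mulr_ge0 ?sqr_ge0// ltW.
have e10 : 0 < e / (2 * M + 1) by rewrite divr_gt0//; lra.
have [T [t1 t2 TM TK]] := trig_approx K0 e10.
exists (fun u v => T u * T v); first exact: trig2M.
have big u : K < `|u| -> 2 * M ^+ 2 <= e * (expR u + expR (- u)).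
  move=> Ku; have h : 2 * M ^+ 2 <= e * K.
    have -> : e * K = 2 * M ^+ 2 + e by rewrite /K; field; rewrite gt_eqF.
    lra.
  rewrite (le_trans h)// ler_pM2l//.
  have [u0|u0] := leP 0 u.
    have := expR_ge1Dx u; have := expR_ge0 (- u).
    by move: Ku; rewrite ger0_norm//; lra.
  have := expR_ge1Dx (- u); have := expR_ge0 u.
  by move: Ku; rewrite ltr0_norm//; lra.
move=> u v; have eu := expR_ge0 u; have eu' := expR_ge0 (- u).
have ev := expR_ge0 v; have ev' := expR_ge0 (- v).
have crude : `|sigma u * sigma v - T u * T v| <= 2 * M ^+ 2.
  rewrite (le_trans (ler_normB _ _))// !normrM.
  have := ler_pM (normr_ge0 _) (normr_ge0 _) (sigmaM u) (sigmaM v).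
  have := ler_pM (normr_ge0 _) (normr_ge0 _) (TM u) (TM v).
  by rewrite expr2; lra.
have [uK|/big uK] := leP `|u| K; last by nra.
have [vK|/big vK] := leP `|v| K; last by nra.
have -> : sigma u * sigma v - T u * T v =
  sigma u * (sigma v - T v) + (sigma u - T u) * T v by ring.
rewrite (le_trans (ler_normD _ _))// !normrM.
have h1 := ler_pM (normr_ge0 _) (normr_ge0 _) (sigmaM u) (TK v vK).
have h2 := ler_pM (normr_ge0 _) (normr_ge0 _) (TK u uK) (TM v).
have h3 : 2 * M * (e / (2 * M + 1)) <= e.
  by rewrite mulrA ler_pdivrMr; nra.
nra.
Qed.

End one_variable.
End trig_polynomials.

(** * Continuity of Gaussian means in the covariance *)

Section gaussian_functionals.
Context {R : realType}.
Implicit Types (F : R -> R -> R).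

Definition ecosh (x : R) := expR x + expR (- x).

Lemma ecosh_ge0 x : 0 <= ecosh x.
Proof. by rewrite addr_ge0// expR_ge0. Qed.

(* the weight is a sum of exponentials, so that its Gaussian mean is explicit *)
Definition exp_growth F :=
  measurable_fun setT (fun z : R * R => F z.1 z.2) /\
  exists A, forall u v, `|F u v| <= A * (1 + ecosh u + ecosh v).

(* [Psi F] behaves like [E (F (U, V))] for [(U, V)] centered Gaussian with
   covariance [((q11, q12), (q12, q22))] *)
Record gaussian_functional (Psi : (R -> R -> R) -> R) (q11 q12 q22 : R) : Prop :=
  GaussianFunctional {
  gfD : forall F1 F2, exp_growth F1 -> exp_growth F2 ->
    Psi (fun u v => F1 u v + F2 u v) = Psi F1 + Psi F2 ;
  gfZ : forall c F, exp_growth F -> Psi (fun u v => c * F u v) = c * Psi F ;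
  gf_le : forall F1 F2, exp_growth F1 -> exp_growth F2 ->
    (forall u v, F1 u v <= F2 u v) -> Psi F1 <= Psi F2 ;
  gf_cos : forall s t th, Psi (fun u v => cos (s * u + t * v + th)) =
    cos th * expR (- ((s ^+ 2 * q11 + 2 * s * t * q12 + t ^+ 2 * q22) / 2)) ;
  gf_exp : forall s t, Psi (fun u v => expR (s * u + t * v)) =
    expR ((s ^+ 2 * q11 + 2 * s * t * q12 + t ^+ 2 * q22) / 2) }.

Lemma exp_growthD F1 F2 : exp_growth F1 -> exp_growth F2 ->
  exp_growth (fun u v => F1 u v + F2 u v).
Proof.
move=> [m1 [A1 h1]] [m2 [A2 h2]]; split; first exact: measurable_funD.
exists (A1 + A2) => u v; rewrite (le_trans (ler_normD _ _))// mulrDl.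
by apply: lerD.
Qed.

Lemma exp_growthZ c F : exp_growth F -> exp_growth (fun u v => c * F u v).
Proof.
move=> [m1 [A1 h1]]; split; first exact: measurable_funM.
by exists (`|c| * A1) => u v; rewrite normrM -mulrA ler_wpM2l.
Qed.

Let continuous2_measurable (f : R -> R) (s t th : R) : continuous f ->
  measurable_fun setT (fun z : R * R => f (s * z.1 + t * z.2 + th)).
Proof.
move=> cf; apply: measurableT_comp; first exact: continuous_measurable_fun.
apply: measurable_funD => //; apply: measurable_funD; apply: measurable_funM => //.
Qed.

Lemma exp_growth_cos s t th : exp_growth (fun u v => cos (s * u + t * v + th)).
Proof.
split; first by apply: (continuous2_measurable _ _ _ (@continuous_cos R)).
exists 1 => u v; rewrite mul1r (le_trans (cos_max _))//.
by have := ecosh_ge0 u; have := ecosh_ge0 v; lra.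
Qed.

Lemma exp_growth_exp s t : `|s| + `|t| <= 1 -> s * t = 0 ->
  exp_growth (fun u v => expR (s * u + t * v)).
Proof.
move=> st1 st0; split.
  have := continuous2_measurable s t 0 (@continuous_expR R).
  by under eq_fun do rewrite addr0.
have h (c x : R) : `|c| <= 1 -> expR (c * x) <= 1 + ecosh x.
  rewrite ler_norml /ecosh => /andP[c1 c2].
  have e1 := expR_gt0 x; have e2 := expR_gt0 (- x).
  have [x0|x0] := leP 0 x.
    have : expR (c * x) <= expR x by rewrite ler_expR; nra.
    lra.
  have : expR (c * x) <= expR (- x) by rewrite ler_expR; nra.
  lra.
exists 1 => u v; rewrite mul1r ger0_norm ?expR_ge0//.
have eu := ecosh_ge0 u; have ev := ecosh_ge0 v.
have s0 := normr_ge0 s; have t0 := normr_ge0 t.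
move/eqP : st0; rewrite mulf_eq0 => /orP[] /eqP z; rewrite z mul0r.
  by rewrite add0r (le_trans (h t v _))//; lra.
by rewrite addr0 (le_trans (h s u _))//; lra.
Qed.

Lemma exp_growth_bounded F M : measurable_fun setT (fun z : R * R => F z.1 z.2) ->
  (forall u v, `|F u v| <= M) -> exp_growth F.
Proof.
move=> mF h; split => //; exists M => u v; rewrite (le_trans (h u v))//.
have M0 : 0 <= M by rewrite (le_trans _ (h 0 0)).
by rewrite ler_peMr//; have := ecosh_ge0 u; have := ecosh_ge0 v; lra.
Qed.

Lemma exp_growth_cst c : exp_growth (fun _ _ => c).
Proof. by apply: (@exp_growth_bounded _ `|c|). Qed.

(** Puts the weight in a form that the record evaluates: the constant 1 as cos 0, the rest as four
    exponentials. *)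
Let H F1 : F1 = (fun u v : R => 1 + ecosh u + ecosh v) ->
  F1 = (fun u v => ((((cos (0 * u + 0 * v + 0)) + expR (1 * u + 0 * v)) +
    expR (- 1 * u + 0 * v)) + expR (0 * u + 1 * v)) + expR (0 * u + - 1 * v)).
Proof.
move=> ->; apply/funext => u; apply/funext => v.
by rewrite /ecosh !(mul0r, mul1r, mulN1r, addr0, add0r) cos0; ring.
Qed.

Let e1 : exp_growth (fun u v => expR (1 * u + 0 * v)).
Proof. by apply: exp_growth_exp; rewrite ?normr1 ?normr0 ?mulr0 ?addr0. Qed.
Let e2 : exp_growth (fun u v => expR (- 1 * u + 0 * v)).
Proof. by apply: exp_growth_exp; rewrite ?normrN1 ?normr0 ?mulr0 ?addr0. Qed.
Let e3 : exp_growth (fun u v => expR (0 * u + 1 * v)).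
Proof. by apply: exp_growth_exp; rewrite ?normr1 ?normr0 ?mul0r ?add0r. Qed.
Let e4 : exp_growth (fun u v => expR (0 * u + - 1 * v)).
Proof. by apply: exp_growth_exp; rewrite ?normrN1 ?normr0 ?mul0r ?add0r. Qed.

Lemma exp_growth_weight : exp_growth (fun u v => 1 + ecosh u + ecosh v).
Proof.
rewrite (H erefl); do 4 (apply: exp_growthD => //); exact: exp_growth_cos.
Qed.

Lemma gf_weight Psi q11 q12 q22 : gaussian_functional Psi q11 q12 q22 ->
  Psi (fun u v => 1 + ecosh u + ecosh v) =
  1 + 2 * expR (q11 / 2) + 2 * expR (q22 / 2).
Proof.
move=> G; rewrite (H erefl).
have c0 := exp_growth_cos 0 0 0.
have a1 := exp_growthD c0 e1; have a2 := exp_growthD a1 e2.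
have a3 := exp_growthD a2 e3.
rewrite (gfD G a3 e4) (gfD G a2 e3) (gfD G a1 e2) (gfD G c0 e1).
rewrite (gf_cos G) !(gf_exp G) cos0.
rewrite !(expr0n, expr1n, sqrrN, mul0r, mulr0, mul1r, add0r, addr0) /=.
by rewrite !(mul0r, mulr0, add0r, addr0, oppr0) expR0; ring.
Qed.

Let trig_value (l : seq (R * (R * R) * R)) (q11 q12 q22 : R) := \sum_(p <- l)
  p.1.1 * (cos p.2 * expR (- ((p.1.2.1 ^+ 2 * q11 + 2 * p.1.2.1 * p.1.2.2 * q12 +
    p.1.2.2 ^+ 2 * q22) / 2))).

Lemma gf_trig Psi q11 q12 q22 (l : seq (R * (R * R) * R)) :
  gaussian_functional Psi q11 q12 q22 ->
  let F u v := \sum_(p <- l) p.1.1 * cos (p.1.2.1 * u + p.1.2.2 * v + p.2) in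
  exp_growth F /\ Psi F = trig_value l q11 q12 q22.
Proof.
move=> G /=; rewrite /trig_value; elim: l => [|p l [ih1 ih2]].
  have -> : (fun u v => \sum_(p <- [::])
      p.1.1 * cos (p.1.2.1 * u + p.1.2.2 * v + p.2)) = (fun u v => 0 * (0 : R)).
    by apply/funext => u; apply/funext => v; rewrite big_nil mul0r.
  split; first by apply: exp_growthZ; exact: exp_growth_cst.
  by rewrite (gfZ G)//; [rewrite big_nil mul0r|exact: exp_growth_cst].
have -> : (fun u v => \sum_(p <- p :: l)
    p.1.1 * cos (p.1.2.1 * u + p.1.2.2 * v + p.2)) =
  (fun u v => p.1.1 * cos (p.1.2.1 * u + p.1.2.2 * v + p.2) +
    \sum_(p <- l) p.1.1 * cos (p.1.2.1 * u + p.1.2.2 * v + p.2)).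
  by apply/funext => u; apply/funext => v; rewrite big_cons.
have c1 := exp_growth_cos p.1.2.1 p.1.2.2 p.2.
split; first by apply: exp_growthD => //; exact: exp_growthZ.
rewrite (gfD G)//; last exact: exp_growthZ.
by rewrite (gfZ G)// (gf_cos G) ih2 big_cons.
Qed.

Let trig_value_continuous (l : seq (R * (R * R) * R)) (q11 q12 q22 e : R) : 0 < e ->
  exists2 r : R, 0 < r & forall q11' q12' q22', `|q11' - q11| <= r ->
    `|q12' - q12| <= r -> `|q22' - q22| <= r ->
    `|trig_value l q11' q12' q22' - trig_value l q11 q12 q22| <= e.
Proof.
rewrite /trig_value; elim: l e => [|p l ih] e e0.
  by exists 1 => // *; rewrite !big_nil subrr normr0 ltW.
have [r1 r10 h1] := ih (e / 2) (divr_gt0 e0 (ltr0n _ 2)).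
set c := p.1.1; set s := p.1.2.1; set t := p.1.2.2; set th := p.2.
pose x := - ((s ^+ 2 * q11 + 2 * s * t * q12 + t ^+ 2 * q22) / 2).
have e20 : 0 < e / 2 / (`|c| + 1) by rewrite !divr_gt0//; have := normr_ge0 c; lra.
have := @continuous_expR R x => /cvgrPdist_lt/(_ _ e20)/nbhs_ballP[r2 /= r20 h2].
pose B := (`|s| + `|t|) ^+ 2 + 1.
have B0 : 0 < B by rewrite ltr_wpDl// sqr_ge0.
pose r := Num.min r1 (r2 / B).
have r0 : 0 < r by rewrite lt_min r10 divr_gt0.
exists r => // q11' q12' q22' d11 d12 d22.
have rr1 : r <= r1 by rewrite ge_min lexx.
have rr2 : r * B <= r2 by rewrite -ler_pdivlMr// ge_min lexx orbT.
rewrite !big_cons opprD addrACA (le_trans (ler_normD _ _))//.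
rewrite [leRHS](splitr e) lerD//; last by apply: h1; exact: le_trans rr1.
pose x' := - ((s ^+ 2 * q11' + 2 * s * t * q12' + t ^+ 2 * q22') / 2).
rewrite -/c -/s -/t -/th -/x -/x'.
have hx : `|expR x - expR x'| < e / 2 / (`|c| + 1).
  apply: h2; rewrite /ball /=.
  have -> : x - x' = (s ^+ 2 * (q11' - q11) + 2 * (s * t) * (q12' - q12) +
      t ^+ 2 * (q22' - q22)) / 2 by rewrite /x /x'; field.
  rewrite normrM [X in _ * X]ger0_norm; last by rewrite invr_ge0.
  rewrite ltr_pdivrMr//.
  have n1 : `|s ^+ 2 * (q11' - q11)| <= `|s| ^+ 2 * r.
    by rewrite normrM normrX ler_wpM2l ?sqr_ge0.
  have n2 : `|t ^+ 2 * (q22' - q22)| <= `|t| ^+ 2 * r.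
    by rewrite normrM normrX ler_wpM2l ?sqr_ge0.
  have n3 : `|2 * (s * t) * (q12' - q12)| <= 2 * (`|s| * `|t|) * r.
    have s0 := normr_ge0 s; have t0 := normr_ge0 t.
    by rewrite !normrM (ger0_norm (ler0n _ 2)); apply: ler_wpM2l => //;
      rewrite !mulr_ge0.
  have tri := ler_normD (s ^+ 2 * (q11' - q11) + 2 * (s * t) * (q12' - q12))
    (t ^+ 2 * (q22' - q22)).
  have tri2 := ler_normD (s ^+ 2 * (q11' - q11)) (2 * (s * t) * (q12' - q12)).
  have : r * B = `|s| ^+ 2 * r + 2 * (`|s| * `|t|) * r + `|t| ^+ 2 * r + r.
    by rewrite /B; ring.
  by lra.
rewrite -mulrBr -mulrBr normrM normrM distrC.
have c0 := normr_ge0 c.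
have cm := cos_max th.
have h3 : `|cos th| * `|expR x - expR x'| <= e / 2 / (`|c| + 1).
  by rewrite (le_trans _ (ltW hx))// ler_piMl.
apply: (@le_trans _ _ (`|c| * (e / 2 / (`|c| + 1)))); first by rewrite ler_wpM2l.
by rewrite mulrA ler_pdivrMr; nra.
Qed.

(** Three-epsilon argument through one trigonometric polynomial. The radius [r] is chosen before
    [Psi] and [Psi'], so it serves functionals on different spaces, and all frozen values of the
    lower layers at once. *)
Lemma gaussian_functional_continuous (sigma : R -> R) (M q11 q12 q22 e : R) :
  continuous sigma -> (forall t, `|sigma t| <= M) -> 0 < e ->
  exists2 r : R, 0 < r & forall Psi Psi' q11' q12' q22',
    gaussian_functional Psi q11 q12 q22 ->
    gaussian_functional Psi' q11' q12' q22' ->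
    `|q11' - q11| <= r -> `|q12' - q12| <= r -> `|q22' - q22| <= r ->
    `|Psi' (fun u v => sigma u * sigma v) - Psi (fun u v => sigma u * sigma v)| <= e.
Proof.
move=> cs sM e0.
(* [B] bounds the mean of the weight for every covariance whose diagonal exceeds that of [q] by at
   most 1; hence the radius is capped at 1 below. *)
pose B := 1 + 2 * expR ((q11 + 1) / 2) + 2 * expR ((q22 + 1) / 2).
have B0 : 0 < B.
  by have := expR_gt0 ((q11 + 1) / 2); have := expR_gt0 ((q22 + 1) / 2); rewrite /B; lra.
have e10 : 0 < e / (3 * B) by rewrite divr_gt0// mulr_gt0.
have [F [l lF] FS] := trig2_approx cs sM e10.
have [r1 r10 h1] := @trig_value_continuous l q11 q12 q22 (e / 3) (divr_gt0 e0 (ltr0n _ 3)).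
exists (Num.min r1 1); first by rewrite lt_min r10 ltr01.
have FE : F = (fun u v => \sum_(p <- l) p.1.1 * cos (p.1.2.1 * u + p.1.2.2 * v + p.2)).
  by apply/funext => u; apply/funext => v; rewrite lF.
pose SS := fun u v => sigma u * sigma v.
have gS : exp_growth SS.
  apply: (@exp_growth_bounded _ (M * M)); last first.
    by move=> u v; rewrite normrM ler_pM.
  have ms : measurable_fun setT sigma by exact: continuous_measurable_fun.
  by apply: measurable_funM; [apply: (measurableT_comp ms)|apply: (measurableT_comp ms)].
have key Psi a b c : gaussian_functional Psi a b c -> a <= q11 + 1 -> c <= q22 + 1 ->
    `|Psi SS - trig_value l a b c| <= e / 3.
  move=> G ha hc; have [gF <-] := gf_trig l G.
  rewrite -FE in gF *.
  pose W := fun u v : R => 1 + ecosh u + ecosh v.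
  have gW : exp_growth W := exp_growth_weight.
  have PW : e / (3 * B) * Psi W <= e / 3.
    rewrite (gf_weight G) invfM mulrA -[leRHS]mulr1 -mulrA ler_wpM2l//.
      by rewrite divr_ge0// ltW.
    rewrite mulrC ler_pdivrMr// mul1r /B.
    have : expR (a / 2) <= expR ((q11 + 1) / 2) by rewrite ler_expR; lra.
    have : expR (c / 2) <= expR ((q22 + 1) / 2) by rewrite ler_expR; lra.
    lra.
  have dif F1 F2 : exp_growth F1 -> exp_growth F2 ->
      (forall u v, F1 u v <= F2 u v + e / (3 * B) * W u v) ->
      Psi F1 <= Psi F2 + e / (3 * B) * Psi W.
    move=> g1 g2 h; rewrite -(gfZ G)// -(gfD G)//; last exact: exp_growthZ.
    by apply: (gf_le G) => //; apply: exp_growthD => //; exact: exp_growthZ.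
  have d1 := dif SS F gS gF; have d2 := dif F SS gF gS.
  rewrite ler_distl; apply/andP; split.
    rewrite lerBlDr (le_trans (d2 _)) ?lerD2l//.
    move=> u v; have := FS u v; rewrite ler_distl /W /SS /ecosh addrA => /andP[].
    by rewrite lerBlDr.
  rewrite (le_trans (d1 _)) ?lerD2l//.
  by move=> u v; have := FS u v; rewrite ler_distl /W /SS /ecosh addrA => /andP[].
move=> Psi Psi' q11' q12' q22' G G' d11 d12 d22.
have m1 : Num.min r1 1 <= r1 by rewrite ge_min lexx.
have m2 : Num.min r1 1 <= 1 by rewrite ge_min lexx orbT.
have k1 := key _ _ _ _ G; have k2 := key _ _ _ _ G'.
have {}k1 : `|Psi SS - trig_value l q11 q12 q22| <= e / 3 by apply: k1; lra.
have {}k2 : `|Psi' SS - trig_value l q11' q12' q22'| <= e / 3.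
  apply: k2.
    by move: d11; rewrite ler_distl => /andP[]; lra.
  by move: d22; rewrite ler_distl => /andP[]; lra.
have := h1 q11' q12' q22' (le_trans d11 m1) (le_trans d12 m1) (le_trans d22 m1).
move: k1 k2; rewrite -/SS !ler_distl => /andP[? ?] /andP[? ?] /andP[? ?].
by apply/andP; split; lra.
Qed.

End gaussian_functionals.

(** * Square roots of positive semidefinite matrices *)

Section psd_square_root.
Context {R : realType}.

Lemma poly_interpolation (s : seq R) (f : R -> R) : uniq s ->
  exists q : {poly R}, forall x, x \in s -> q.[x] = f x.
Proof.
elim: s => [_|x s ih /= /andP[xs us]]; first by exists 0.
have [q hq] := ih us.
pose w := \prod_(y <- s) ('X - y%:P).
have wx : w.[x] != 0 by rewrite -[_ == _]/(root w x) root_prod_XsubC.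
exists (q + ((f x - q.[x]) / w.[x]) *: w) => y.
rewrite in_cons => /orP[/eqP ->|ys].
  by rewrite !hornerE divfK// addrC subrK.
have /eqP wy : root w y by rewrite root_prod_XsubC.
by rewrite !hornerE wy mulr0 addr0 hq.
Qed.

Lemma trmx_horner_mx n (A : 'M[R]_n.+1) (q : {poly R}) : A^T = A ->
  (horner_mx A q)^T = horner_mx A q.
Proof.
move=> At; elim/poly_ind: q => [|q c ih]; first by rewrite !rmorph0 trmx0.
rewrite rmorphD rmorphM /= horner_mx_X horner_mx_C linearD /= tr_scalar_mx.
rewrite [(_ * _)^T]trmx_mul ih At; congr (_ + _).
exact: (comm_mx_horner q (erefl : comm_mx A A)).
Qed.

(** The spectral theorem used below is complex, and so is the eigenvector; since [A] and [d] are
    real, its real or its imaginary part is a nonzero real eigenvector. *)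
Lemma psd_real_eigenvalue n (A : 'M[R]_n) (u : 'rV[R[i]]_n) (d : R) :
  psd_mx A -> u != 0 -> u *m map_mx (real_complex R) A = (real_complex R d) *: u ->
  0 <= d.
Proof.
move=> [_ Apsd] u0 uA.
have key (v : 'rV[R]_n) : v *m A = d *: v -> v != 0 -> 0 <= d.
  move=> vA v0; have := Apsd v; rewrite vA -scalemxAl mxE.
  have : 0 < (v *m v^T) 0 0.
    rewrite mxE; have [j vj] : exists j, v 0 j != 0.
      apply/existsP; rewrite -negb_forall; apply: contra v0 => /forallP h.
      by apply/eqP/rowP => j; rewrite mxE; exact/eqP/h.
    rewrite (bigD1 j)//= ltr_pwDl//.
      by rewrite mxE -expr2 lt_neqAle eq_sym sqrf_eq0 vj sqr_ge0.
    by apply: sumr_ge0 => k _; rewrite mxE -expr2 sqr_ge0.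
  by move=> h; rewrite pmulr_lge0.
pose x : 'rV[R]_n := map_mx (@complex.Re R) u.
pose y : 'rV[R]_n := map_mx (@complex.Im R) u.
have reM (z : R[i]) (c : R) : complex.Re (z * (real_complex R c)) = complex.Re z * c.
  by case: z => a b /=; rewrite mulr0 subr0.
have imM (z : R[i]) (c : R) : complex.Im (z * (real_complex R c)) = complex.Im z * c.
  by case: z => a b /=; rewrite mulr0 add0r.
have xA : x *m A = d *: x.
  apply/rowP => j; move/rowP/(_ j)/(congr1 (@complex.Re R)) : uA.
  rewrite !mxE [X in _ = complex.Re X]mulrC reM mulrC => <-; rewrite raddf_sum.
  by apply: eq_bigr => k _; rewrite !mxE; exact: esym (reM _ _).
have yA : y *m A = d *: y.
  apply/rowP => j; move/rowP/(_ j)/(congr1 (@complex.Im R)) : uA.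
  rewrite !mxE [X in _ = complex.Im X]mulrC imM mulrC => <-; rewrite raddf_sum.
  by apply: eq_bigr => k _; rewrite !mxE; exact: esym (imM _ _).
have [x0|x0] := eqVneq x 0; last exact: key x0.
have [y0|y0] := eqVneq y 0; last exact: key y0.
move/eqP : u0; case; apply/rowP => j; rewrite mxE.
move/rowP/(_ j) : x0; move/rowP/(_ j) : y0; rewrite !mxE.
by case: (u 0 j) => a b /= -> ->.
Qed.

(** The root is sought as a real polynomial in [A], which keeps it real and symmetric although the
    diagonalization is complex. The polynomial interpolates the fourth roots of the eigenvalues:
    then B^4 = A, and B^2 is positive semidefinite as the square of a symmetric matrix. *)
Lemma psd_sqrt_exists n (A : 'M[R]_n) : psd_mx A ->
  exists S, psd_mx S /\ S *m S = A.
Proof.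
case: n A => [|n] A Apsd.
  exists A; split => //; by apply/matrixP => -[].
have [At Ap] := Apsd.
pose AC := map_mx (real_complex R) A.
have AH : AC \is hermsymmx.
  apply: realsym_hermsym.
    by apply/is_hermitianmxP; rewrite /= expr0 scale1r map_mx_id// map_trmx At.
  by apply/mxOverP => i j; rewrite mxE; apply/complex_realP; exists (A i j).
have /orthomx_spectralP E := hermitian_normalmx AH.
set U := spectralmx AC in E; set sp := spectral_diag AC in E.
have Uu : U \in unitmx by exact: spectral_unit.
pose d i : R := complex.Re (sp 0 i).
have spd i : sp 0 i = real_complex R (d i).
  have /mxOverP/(_ 0 i) := hermitian_spectral_diag_real AH.
  by rewrite /d -/sp => /complex_realP[c ->].
have d0 i : 0 <= d i.
  apply: (@psd_real_eigenvalue _ A (row i U) (d i)) => //.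
    apply/negP => /eqP rU; have := row_mul i U (invmx U).
    rewrite rU mul0mx mulmxV// => /rowP/(_ i); rewrite !mxE eqxx.
    by move/eqP; rewrite oner_eq0.
  rewrite -row_mul -/AC E mulmxA mulmxA mulmxV// mul1mx row_mul.
  by rewrite row_diag_mx -scalemxAl -rowE spd.
pose s := undup [seq d i | i : 'I_n.+1].
have [q hq] := poly_interpolation (fun x => Num.sqrt (Num.sqrt x)) (undup_uniq s).
pose B := horner_mx A q.
have Bt : B^T = B by exact: trmx_horner_mx.
(* B^4 = A is checked over the complex numbers, where [A] is conjugate to the diagonal of its
   eigenvalues, and pulled back by injectivity of the embedding. *)
have root4 : horner_mx A (q ^+ 4 - 'X) = 0.
  suff : map_mx (real_complex R) (horner_mx A (q ^+ 4 - 'X)) = 0.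
    by move/eqP; rewrite map_mx_eq0 => /eqP.
  rewrite map_horner_mx -/AC.
  rewrite E.
  rewrite (horner_mx_uconjC _ _ (Uu : U \is a GRing.unit)).
  rewrite horner_mx_diag.
  suff -> : map_mx (horner (map_poly (real_complex R) (q ^+ 4 - 'X))) sp = 0.
    by rewrite raddf0 mulmx0 mul0mx.
  apply/rowP => i; rewrite !mxE spd horner_map /= !hornerE hq.
    by rewrite (exprM _ 2 2) !sqr_sqrtr ?sqrtr_ge0// subrr.
  by rewrite !mem_undup; apply/mapP; exists i; rewrite ?mem_enum.
exists (B *m B); split; last first.
  move/eqP : root4; rewrite rmorphB rmorphXn /= horner_mx_X subr_eq0 => /eqP <-.
  by rewrite -/B !exprS expr0 mulr1 !mulmxE !mulrA.
split => [|v]; first by rewrite trmx_mul Bt.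
rewrite mulmxA -mulmxA -{2}Bt -trmx_mul mxE.
by apply: sumr_ge0 => k _; rewrite [X in _ * X]mxE -expr2 sqr_ge0.
Qed.

Lemma msqrtP n (A : 'M[R]_n) : psd_mx A ->
  psd_mx (msqrt A) /\ msqrt A *m msqrt A = A.
Proof. by move=> /psd_sqrt_exists h; exact: (xgetPex 0 h). Qed.

End psd_square_root.

(** * Gaussian means of linear statistics *)

Section iterated_gaussian_integral.
Context {R : realType}.
Local Notation N := (normal_prob (0 : R) 1).

Let coord (i : nat) (v : nat -> R) : R := v i.
(* sequences with the product sigma-algebra *)
Let Tv := sigma_of coord setT.

Let upd (v : nat -> R) (k : nat) (t : R) : nat -> R :=
  fun j => if j == k then t else v j.

Let size1 k (v : nat -> R) : R := \sum_(i < k) `|v i|.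

(** Exponential growth in the first [k] coordinates: wide enough for functions of [exp_growth] along
    linear forms, and stable under integrating out the last coordinate ([inner_class]). *)
Definition gint_class (k : nat) (f : (nat -> R) -> R) :=
  measurable_fun [set: Tv] (f : Tv -> R) /\
  exists A c, [/\ 0 <= A, 0 <= c & forall v, `|f v| <= A * expR (c * size1 k v)].

Let inner k (f : (nat -> R) -> R) v := \int[N]_t f (upd v k t).

Let gintS k f : gint k.+1 f = gint k (inner k f).
Proof. by []. Qed.

Let size1_ge0 k v : 0 <= size1 k v.
Proof. exact: sumr_ge0. Qed.

Let size1_upd k v t : size1 k.+1 (upd v k t) = size1 k v + `|t|.
Proof.
rewrite /size1 big_ord_recr /= /upd eqxx; congr (_ + _).
by apply: eq_bigr => i _; rewrite ltn_eqF.
Qed.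

Lemma measurable_into_sigma_of d (U : measurableType d) (I : eqType)
    (W : pointedType) (X : I -> W -> R) (J : set I) (g : U -> W) :
  (forall i, J i -> measurable_fun setT (X i \o g)) ->
  measurable_fun setT (g : U -> sigma_of X J).
Proof.
move=> mg.
apply: (@measurability _ _ U (sigma_of X J) setT g (sigma_gen X J) erefl).
move=> _ [_ [i Ji [B mB ->]] <-].
exact: (mg i Ji measurableT B mB).
Qed.

Let measurable_upd k : measurable_fun [set: Tv * R]
  ((fun z => upd z.1 k z.2) : Tv * R -> Tv).
Proof.
apply: measurable_into_sigma_of => i _; rewrite /comp /coord /upd.
case: (i == k); first exact: measurable_snd.
have mi : measurable_fun [set: Tv] (coord i : Tv -> R).
  exact: (sigma_of_measurable (X := coord) (J := setT)).
exact: (measurableT_comp mi measurable_fst).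
Qed.

Let C (c : R) : R := \int[N]_t expR (c * `|t|).

Let integrable_abs_exp (c : R) : 0 <= c -> N.-integrable setT (fun t => (expR (c * `|t|))%:E).
Proof.
move=> c0.
have m0 : measurable_fun [set: R] (fun t => expR (c * t)).
  by apply: measurableT_comp => //; exact: measurable_funM.
have mn : measurable_fun [set: R] (fun t : R => `|t|) by exact: normr_measurable.
have m1 : measurable_fun [set: R] (fun t : R => expR (c * `|t|)).
  exact: (measurableT_comp m0 mn).
apply: (@normal_integrable_dom _ _ 1 c); first exact: m1.
move=> y; rewrite mul1r ger0_norm ?expR_ge0//.
have := expR_ge0 (c * y); have := expR_ge0 (- c * y).
by have [y0|y0] := leP 0 y; [rewrite ger0_norm//; lra|rewrite ltr0_norm// mulrN -mulNr; lra].
Qed.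

Let slice_integrable k f v : gint_class k.+1 f ->
  N.-integrable setT (fun t => (f (upd v k t))%:E).
Proof.
move=> [mf [A [c [A0 c0 fA]]]].
have iG : N.-integrable setT
    (fun t => (A * expR (c * size1 k v))%:E * (expR (c * `|t|))%:E)%E.
  by apply: integrableZl => //; exact: integrable_abs_exp.
apply: le_integrable iG => //.
  apply/measurable_EFinP.
  have m1 : measurable_fun [set: R] (fun t => ((v : Tv), t)) by exact: pair1_measurable.
  exact: (measurableT_comp mf (measurableT_comp (measurable_upd k) m1)).
move=> t _ /=; rewrite lee_fin (le_trans (fA _))// size1_upd.
by rewrite mulrDr expRD mulrA ler_norm.
Qed.

Let inner_class k f : gint_class k.+1 f -> gint_class k (inner k f).
Proof.
move=> gf; have [mf [A [c [A0 c0 fA]]]] := gf; split.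
  (* The inner integral is signed; its measurability comes from Tonelli for the positive and
     negative parts separately. *)
  have mF : measurable_fun [set: Tv * R] (fun z => (f (upd z.1 k z.2))%:E).
    by apply/measurable_EFinP; exact: (measurableT_comp mf (measurable_upd k)).
  have mp := @measurable_fun_fubini_tonelli_F _ _ Tv (measurableTypeR R) R N _
    (measurable_funepos mF) (fun z => funepos_ge0 _ z).
  have mn := @measurable_fun_fubini_tonelli_F _ _ Tv (measurableTypeR R) R N _
    (measurable_funeneg mF) (fun z => funeneg_ge0 _ z).
  rewrite (_ : inner k f = fun v => fine (
     fubini_F N (fun z : Tv * R => (f (upd z.1 k z.2))%:E)^\+ v -
     fubini_F N (fun z : Tv * R => (f (upd z.1 k z.2))%:E)^\- v)%E).
    apply: measurableT_comp => //; exact: emeasurable_funB.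
  apply/funext => v; rewrite /inner /Rintegral integralE /fubini_F.
  by congr (fine (_ - _)%E); apply: eq_integral => t _; rewrite ?funeposE ?funenegE.
exists (A * C c), c; split => //.
  by apply: mulr_ge0 => //; apply: Rintegral_ge0 => t _; exact: expR_ge0.
move=> v; rewrite /inner.
have iv := slice_integrable v gf.
apply: (le_trans (le_normr_Rintegral measurableT iv)).
have iG := integrable_abs_exp c0.
rewrite mulrAC -RintegralZl//; apply: le_Rintegral => //.
- exact: integrable_norm.
- rewrite (_ : EFin \o _ = fun t => (A * expR (c * size1 k v))%:E * (expR (c * `|t|))%:E)%E.
    exact: integrableZl.
  by apply/funext => t.
by move=> t _; rewrite (le_trans (fA _))// size1_upd mulrDr expRD mulrA.
Qed.

Lemma gint_classD k f g : gint_class k f -> gint_class k g ->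
  gint_class k (fun v => f v + g v).
Proof.
move=> [mf [A [a [A0 a0 fA]]]] [mg [B [b [B0 b0 gB]]]]; split.
  exact: measurable_funD.
exists (A + B), (a + b); split; [exact: addr_ge0|exact: addr_ge0|].
move=> v; have s0 := size1_ge0 k v.
have h1 : expR (a * size1 k v) <= expR ((a + b) * size1 k v) by rewrite ler_expR; nra.
have h2 : expR (b * size1 k v) <= expR ((a + b) * size1 k v) by rewrite ler_expR; nra.
rewrite (le_trans (ler_normD _ _))// mulrDl lerD//.
  by rewrite (le_trans (fA v))// ler_wpM2l.
by rewrite (le_trans (gB v))// ler_wpM2l.
Qed.

Lemma gint_classZ k c f : gint_class k f -> gint_class k (fun v => c * f v).
Proof.
move=> [mf [A [a [A0 a0 fA]]]]; split; first exact: measurable_funM.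
exists (`|c| * A), a; split => //; first by rewrite mulr_ge0.
by move=> v; rewrite normrM -mulrA ler_wpM2l.
Qed.

Lemma gintD k f g : gint_class k f -> gint_class k g ->
  gint k (fun v => f v + g v) = gint k f + gint k g.
Proof.
elim: k f g => [|k ih] f g cf cg //.
rewrite !gintS -ih; [|exact: inner_class|exact: inner_class].
congr gint; apply/funext => v; rewrite /inner RintegralD//;
  exact: slice_integrable.
Qed.

Lemma gintZ k c f : gint_class k f -> gint k (fun v => c * f v) = c * gint k f.
Proof.
elim: k f => [|k ih] f cf //.
rewrite !gintS -ih; last exact: inner_class.
congr gint; apply/funext => v; rewrite /inner RintegralZl//.
exact: slice_integrable.
Qed.

Lemma gint_le k f g : gint_class k f -> gint_class k g ->
  (forall v, f v <= g v) -> gint k f <= gint k g.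
Proof.
elim: k f g => [|k ih] f g cf cg fg; first exact: fg.
rewrite !gintS; apply: ih; [exact: inner_class|exact: inner_class|].
by move=> v; rewrite /inner le_Rintegral//; exact: slice_integrable.
Qed.

Lemma gint_sum k (I : Type) (s : seq I) (f : I -> (nat -> R) -> R) :
  (forall i, gint_class k (f i)) ->
  gint_class k (fun v => \sum_(i <- s) f i v) /\
  gint k (fun v => \sum_(i <- s) f i v) = \sum_(i <- s) gint k (f i).
Proof.
move=> cf; elim: s => [|i s [ih1 ih2]].
  have -> : (fun v => \sum_(i <- [::]) f i v) = (fun v => 0 * (0 : R)).
    by apply/funext => v; rewrite big_nil mul0r.
  have c0 : gint_class k (fun=> 0).
    split; first exact: measurable_cst.
    by exists 0, 0; split => // v; rewrite normr0 mul0r.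
  by split; [exact: gint_classZ|rewrite gintZ// big_nil mul0r].
have -> : (fun v => \sum_(i <- i :: s) f i v) = (fun v => f i v + \sum_(i <- s) f i v).
  by apply/funext => v; rewrite big_cons.
by split; [exact: gint_classD|rewrite gintD// ih2 big_cons].
Qed.

Let lin k (c : nat -> R) (v : nat -> R) : R := \sum_(i < k) c i * v i.

Let measurable_lin_coord k c : measurable_fun [set: Tv] (lin k c : Tv -> R).
Proof.
apply: measurable_sum => i; apply: measurable_funM => //.
exact: (sigma_of_measurable (X := coord) (J := setT)).
Qed.

Let lin_bound k c v : `|lin k c v| <= (\sum_(i < k) `|c i|) * size1 k v.
Proof.
rewrite /lin /size1 mulr_suml (le_trans (ler_norm_sum _ _ _))//.
apply: ler_sum => i _; rewrite normrM ler_wpM2l//.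
by rewrite (bigD1 i)//= lerDl sumr_ge0.
Qed.

Lemma gint_class_lin k F (c c' : nat -> R) : exp_growth F ->
  gint_class k (fun v => F (lin k c v) (lin k c' v)).
Proof.
move=> [mF [A FA]]; split.
  exact: (measurableT_comp mF (measurable_fun_pair (measurable_lin_coord k c)
    (measurable_lin_coord k c'))).
have A0 : 0 <= A.
  have := FA 0 0; have := normr_ge0 (F 0 0).
  by rewrite /ecosh oppr0 expR0 => h1 h2; lra.
pose b := \sum_(i < k) `|c i|; pose b' := \sum_(i < k) `|c' i|.
have b0 : 0 <= b by exact: sumr_ge0.
have b0' : 0 <= b' by exact: sumr_ge0.
(* The weight has five terms, 1 and four exponentials, each at most exp((b + b') * size1 k v). *)
exists (A * 5), (b + b'); split; [by rewrite mulr_ge0|exact: addr_ge0|].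
move=> v; rewrite (le_trans (FA _ _))// -mulrA ler_wpM2l//.
have s0 := size1_ge0 k v.
have h (x y : R) : `|x| <= y * size1 k v -> y <= b + b' ->
    expR x <= expR ((b + b') * size1 k v).
  move=> xy yb; rewrite ler_expR (le_trans (ler_norm _))// (le_trans xy)//.
  by rewrite ler_wpM2r.
have l1 := lin_bound k c v; have l2 := lin_bound k c' v.
have h1 := h _ b l1; have h2 := h _ b' l2.
have h3 := h (- lin k c v) b; have h4 := h (- lin k c' v) b'.
rewrite !normrN in h3 h4; rewrite /ecosh.
have : 1 <= expR ((b + b') * size1 k v).
  by rewrite -[leLHS]expR0 ler_expR mulr_ge0// addr_ge0.
have := h1 ltac:(lra); have := h2 ltac:(lra); have := h3 l1 ltac:(lra).
have := h4 l2 ltac:(lra); lra.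
Qed.

Let linS k c v t : lin k.+1 c (upd v k t) = lin k c v + c k * t.
Proof.
rewrite /lin big_ord_recr /= /upd eqxx; congr (_ + _).
by apply: eq_bigr => i _; rewrite ltn_eqF.
Qed.

Lemma gint_cos k (c : nat -> R) (th : R) :
  gint k (fun v => cos (lin k c v + th)) =
  cos th * expR (- ((\sum_(i < k) c i ^+ 2) / 2)).
Proof.
elim: k th => [|k ih] th.
  by rewrite /= /lin !big_ord0 add0r mul0r oppr0 expR0 mulr1.
rewrite gintS.
have -> : inner k (fun v => cos (lin k.+1 c v + th)) =
    (fun v => expR (- (c k ^+ 2 / 2)) * cos (lin k c v + th)).
  apply/funext => v; rewrite /inner mulrC -normal_cos.
  by apply: eq_Rintegral => t _; rewrite linS addrAC [in RHS]addrC.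
rewrite gintZ; last first.
  have := gint_class_lin k c c (exp_growth_cos 1 0 th).
  by under eq_fun do rewrite mul1r mul0r addr0.
rewrite ih big_ord_recr /= mulrDl opprD expRD; ring.
Qed.

Lemma gint_exp k (c : nat -> R) :
  gint k (fun v => expR (lin k c v)) = expR ((\sum_(i < k) c i ^+ 2) / 2).
Proof.
elim: k => [|k ih]; first by rewrite /= /lin !big_ord0 mul0r.
rewrite gintS.
have -> : inner k (fun v => expR (lin k.+1 c v)) =
    (fun v => expR (c k ^+ 2 / 2) * expR (lin k c v)).
  apply/funext => v; rewrite /inner.
  transitivity (\int[N]_t (expR (lin k c v) * expR (c k * t))).
    by apply: eq_Rintegral => t _; rewrite linS expRD.
  rewrite RintegralZl//; last exact: integrable_normal_exp.
  by rewrite mulrC /Rintegral normal_mgf.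
rewrite gintZ; last first.
  have := gint_class_lin k c c (exp_growth_exp (_ : `|1| + `|0| <= 1) (mulr0 _)).
  rewrite normr1 normr0 addr0 => /(_ (lexx _)).
  by under eq_fun do rewrite mul1r mul0r addr0.
by rewrite ih big_ord_recr /= mulrDl expRD mulrC.
Qed.

Let lin2 k (c c' : nat -> R) s t v :
  s * lin k c v + t * lin k c' v = lin k (fun i => s * c i + t * c' i) v.
Proof.
rewrite /lin !mulr_sumr -big_split; apply: eq_bigr => i _ /=; ring.
Qed.

Lemma gint_functional k (c c' : nat -> R) :
  gaussian_functional (fun F => gint k (fun v => F (lin k c v) (lin k c' v)))
    (\sum_(i < k) c i ^+ 2) (\sum_(i < k) c i * c' i) (\sum_(i < k) c' i ^+ 2).
Proof.
have q s t : s ^+ 2 * (\sum_(i < k) c i ^+ 2) + 2 * s * t * (\sum_(i < k) c i * c' i) +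
    t ^+ 2 * (\sum_(i < k) c' i ^+ 2) = \sum_(i < k) (s * c i + t * c' i) ^+ 2.
  rewrite !mulr_sumr -!big_split; apply: eq_bigr => i _ /=; ring.
split.
- by move=> F1 F2 g1 g2; rewrite gintD//; exact: gint_class_lin.
- by move=> a F g1; rewrite gintZ//; exact: gint_class_lin.
- move=> F1 F2 g1 g2 h; apply: gint_le; [exact: gint_class_lin|exact: gint_class_lin|].
  by move=> v; exact: h.
- move=> s t th; rewrite q -(gint_cos k (fun i => s * c i + t * c' i) th); congr gint; apply/funext => v.
  by rewrite lin2.
- move=> s t; rewrite q -(gint_exp k (fun i => s * c i + t * c' i)); congr gint; apply/funext => v.
  by rewrite lin2.
Qed.

Let ext (m : nat) (S : 'M[R]_m) (i : 'I_m) (j : nat) : R := oapp (S i) 0 (insub j).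

Let lin_ext m (S : 'M[R]_m) i v : lin m (ext S i) v = \sum_(g < m) S i g * v g.
Proof. by apply: eq_bigr => g _; rewrite /ext valK. Qed.

Let ext_sum m (S : 'M[R]_m) i j : \sum_(g < m) ext S i g * ext S j g = (S *m S^T) i j.
Proof. by rewrite mxE; apply: eq_bigr => g _; rewrite /ext valK mxE. Qed.

(** The rows of the symmetric root S have inner products S S^T = q, so the linear forms entering
    [ymx] have covariance [q], invertible or not. *)
Lemma msqrt_functional m (q : 'M[R]_m) (i j : 'I_m) : psd_mx q ->
  gaussian_functional (fun F => gint m (fun v =>
     F (\sum_(g < m) msqrt q i g * v g) (\sum_(g < m) msqrt q j g * v g)))
    (q i i) (q i j) (q j j).
Proof.
move=> /msqrtP[[St _] SS].
have := gint_functional m (ext (msqrt q) i) (ext (msqrt q) j).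
have sq k l : \sum_(g < m) ext (msqrt q) k g * ext (msqrt q) l g = q k l.
  by rewrite ext_sum St SS.
rewrite -(sq i i) -(sq i j) -(sq j j) => G.
rewrite (_ : (fun F => _) = (fun F => gint m (fun v =>
  F (lin m (ext (msqrt q) i) v) (lin m (ext (msqrt q) j) v)))) //.
by apply/funext => F; congr gint; apply/funext => v; rewrite !lin_ext.
Qed.

(** The quadratic form of [ymx sigma q] at [v] is the mean of a square, that of the sum of the v_i
    phi_i. *)
Lemma ymx_psd (sigma : R -> R) (M : R) m (q : 'M[R]_m) : continuous sigma ->
  (forall t, `|sigma t| <= M) -> psd_mx (ymx sigma q).
Proof.
move=> cs sM; split.
  by apply/matrixP => i j; rewrite !mxE; congr gint; apply/funext => v; rewrite mulrC.
move=> v; pose phi i (w : nat -> R) := sigma (lin m (ext (msqrt q) i) w).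
have ms : measurable_fun setT sigma by exact: continuous_measurable_fun.
have cphi i j : gint_class m (fun w => phi i w * phi j w).
  apply: (@gint_class_lin m (fun u v => sigma u * sigma v)).
  apply: (@exp_growth_bounded _ _ (M * M)); last first.
    by move=> x y; rewrite normrM ler_pM.
  by apply: measurable_funM; apply: (measurableT_comp ms).
have yE i j : ymx sigma q i j = gint m (fun w => phi i w * phi j w).
  by rewrite mxE; congr gint; apply/funext => w; rewrite /phi !lin_ext.
have E1 i := gint_sum (index_enum 'I_m) (fun j => gint_classZ (v 0 i * v 0 j) (cphi i j)).
have E2 := gint_sum (index_enum 'I_m) (fun i => (E1 i).1).
have -> : (v *m ymx sigma q *m v^T) 0 0 = gint m (fun w =>
    \sum_i \sum_j v 0 i * v 0 j * (phi i w * phi j w)).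
  rewrite E2.2 mxE; under eq_bigr do rewrite mxE mulr_suml.
  rewrite exchange_big /=.
  apply: eq_bigr => i _; rewrite (E1 i).2; apply: eq_bigr => j _.
  by rewrite gintZ// -yE [v^T j 0]mxE; ring.
rewrite -[leLHS](mul0r (gint m (fun w => \sum_i \sum_j v 0 i * v 0 j * (phi i w * phi j w)))).
rewrite -gintZ; last exact: E2.1.
apply: gint_le; [by apply: gint_classZ; exact: E2.1|exact: E2.1|move=> w].
rewrite mul0r (_ : \sum_i _ = (\sum_i v 0 i * phi i w) ^+ 2) ?sqr_ge0//.
rewrite expr2 mulr_suml; apply: eq_bigr => i _; rewrite mulr_sumr.
by apply: eq_bigr => j _; ring.
Qed.

End iterated_gaussian_integral.

Section independent_gaussian_functional.
Context {R : realType} {d} {T : measurableType d} (P : probability T R).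
Context {I : eqType} (X : I -> T -> R) (J : set I) (v : I -> R).
Hypothesis mX : forall i, J i -> measurable_fun setT (X i).
Hypothesis indX : mutually_independent P X J.
Hypothesis lX : forall i, J i -> has_law P (X i) (gauss_law (v i)).
Hypothesis v0 : forall i, J i -> 0 <= v i.

Variable s : seq I.
Hypothesis us : uniq s.
Hypothesis sJ : forall j, j \in s -> J j.

Let lin (c : I -> R) (w : T) : R := \sum_(j <- s) c j * X j w.

Let mlin c : measurable_fun setT (lin c).
Proof. by apply: measurable_lin => j /sJ; exact: mX. Qed.

Let lin2 (c c' : I -> R) p q w :
  p * lin c w + q * lin c' w = lin (fun j => p * c j + q * c' j) w.
Proof.
rewrite /lin !mulr_sumr -big_split; apply: eq_bigr => i _ /=; ring.
Qed.

Let var (c : I -> R) := \sum_(j <- s) c j ^+ 2 * v j.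

Let exp_int c : (\int[P]_w (expR (lin c w))%:E = (expR (var c / 2))%:E)%E.
Proof.
have := integral_lin_exp mX indX lX v0 c 0 us sJ.
by rewrite add0r => <-; apply: eq_integral => w _; rewrite add0r.
Qed.

Let exp_integrable c : P.-integrable setT (fun w => (expR (lin c w))%:E).
Proof.
apply/integrableP; split.
  by apply/measurable_EFinP; apply: measurableT_comp.
rewrite (_ : (\int[P]_w _ = (expR (var c / 2))%:E)%E) ?ltry//.
rewrite -exp_int; apply: eq_integral => w _ /=.
by rewrite ger0_norm ?expR_ge0.
Qed.

Let F_integrable (c c' : I -> R) F : exp_growth F ->
  P.-integrable setT (fun w => (F (lin c w) (lin c' w))%:E).
Proof.
move=> [mF [A FA]].
have N1 (e : I -> R) w : - lin e w = lin (fun j => - e j) w.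
  by rewrite /lin -sumrN; apply: eq_bigr => j _; rewrite mulNr.
have ie (e : I -> R) : P.-integrable setT (fun w => (ecosh (lin e w))%:E).
  rewrite (_ : (fun w => _) = (fun w => (expR (lin e w))%:E +
    (expR (lin (fun j => - e j) w))%:E)%E); last first.
    by apply/funext => w; rewrite /ecosh -EFinD N1.
  exact: integrableD.
have i1 : P.-integrable setT (fun w : T => (1 : R)%:E).
  exact: finite_measure_integrable_cst.
have ig : P.-integrable setT (fun w =>
    A%:E * ((1%:E + (ecosh (lin c w))%:E) + (ecosh (lin c' w))%:E))%E.
  apply: integrableZl => //; apply: integrableD => //; exact: integrableD.
apply: le_integrable ig => //.
  apply/measurable_EFinP.
  exact: (measurableT_comp mF (measurable_fun_pair (mlin c) (mlin c'))).
by move=> w _ /=; rewrite lee_fin (le_trans (FA _ _))// ler_norm.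
Qed.

Lemma lin_functional (c c' : I -> R) :
  gaussian_functional
    (fun F => \int[P]_w F (\sum_(j <- s) c j * X j w) (\sum_(j <- s) c' j * X j w))
    (\sum_(j <- s) c j ^+ 2 * v j) (\sum_(j <- s) c j * c' j * v j)
    (\sum_(j <- s) c' j ^+ 2 * v j).
Proof.
have q p t : p ^+ 2 * var c + 2 * p * t * (\sum_(j <- s) c j * c' j * v j) +
    t ^+ 2 * var c' = var (fun j => p * c j + t * c' j).
  rewrite /var !mulr_sumr -!big_split; apply: eq_bigr => i _ /=; ring.
split.
- by move=> F1 F2 g1 g2; rewrite RintegralD//; exact: F_integrable.
- by move=> a F g1; rewrite RintegralZl//; exact: F_integrable.
- move=> F1 F2 g1 g2 h; apply: le_Rintegral => //; exact: F_integrable.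
- move=> p t th; rewrite q.
  have := integral_lin_cos mX indX lX v0 (fun j => p * c j + t * c' j) th us sJ.
  rewrite -/(var _) => H.
  have gc := exp_growth_cos p t th.
  have g1 := exp_growth_cst (1 : R).
  have -> : \int[P]_w cos (p * lin c w + t * lin c' w + th) =
     \int[P]_w (1 + cos (p * lin c w + t * lin c' w + th)) - \int[P]_w (1 : R).
    rewrite RintegralD//; [|exact: (F_integrable c c' g1)|exact: (F_integrable c c' gc)].
    by rewrite addrAC subrr add0r.
  rewrite [X in _ - X]/Rintegral integral_prob_cst /Rintegral.
  rewrite (_ : (\int[P]_w _ = (1 + cos th * expR (- (var (fun j => p * c j + t * c' j) / 2)))%:E)%E).
    by rewrite /= addrAC subrr add0r.
  by rewrite -H; apply: eq_integral => w _; rewrite lin2 [in RHS]addrC addrC [_ + th]addrC.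
- move=> p t; rewrite q /Rintegral -[RHS]/(fine (_%:E)) -exp_int.
  by congr fine; apply: eq_integral => w _; rewrite lin2.
Qed.

End independent_gaussian_functional.

(** * The quadratic rate function *)

Section inner_product.
Context {R : realType}.

Definition mxdot m p (x y : 'M[R]_(m, p)) : R := \sum_i \sum_j x i j * y i j.

Lemma mxdotE m p (x y : 'M[R]_(m, p)) : mxdot x y = \tr (x^T *m y).
Proof.
rewrite /mxdot exchange_big; apply: eq_bigr => j _.
by rewrite mxE; apply: eq_bigr => i _; rewrite mxE.
Qed.

Lemma mxdotC m p (x y : 'M[R]_(m, p)) : mxdot x y = mxdot y x.
Proof. by apply: eq_bigr => i _; apply: eq_bigr => j _; rewrite mulrC. Qed.

Lemma mxdotDr m p (x y z : 'M[R]_(m, p)) : mxdot x (y + z) = mxdot x y + mxdot x z.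
Proof. by rewrite !mxdotE mulmxDr mxtraceD. Qed.

Lemma mxdotBr m p (x y z : 'M[R]_(m, p)) : mxdot x (y - z) = mxdot x y - mxdot x z.
Proof. by rewrite !mxdotE mulmxBr raddfB. Qed.

Lemma mxdotDl m p (x y z : 'M[R]_(m, p)) : mxdot (y + z) x = mxdot y x + mxdot z x.
Proof. by rewrite !(mxdotC _ x) mxdotDr. Qed.

Lemma mxdotZr m p c (x y : 'M[R]_(m, p)) : mxdot x (c *: y) = c * mxdot x y.
Proof. by rewrite !mxdotE -scalemxAr mxtraceZ. Qed.

Lemma mxdotZl m p c (x y : 'M[R]_(m, p)) : mxdot (c *: x) y = c * mxdot x y.
Proof. by rewrite mxdotC mxdotZr mxdotC. Qed.

Lemma mxdot_mul m p (A : 'M[R]_m) (x y : 'M[R]_(m, p)) :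
  mxdot x (A *m y) = mxdot (A^T *m x) y.
Proof. by rewrite !mxdotE trmx_mul trmxK mulmxA. Qed.

Lemma mxdot_delta m p (y : 'M[R]_(m, p)) i j : mxdot (delta_mx i j) y = y i j.
Proof.
rewrite /mxdot (bigD1 i)//= (bigD1 j)//= mxE !eqxx mul1r.
rewrite big1 ?addr0; last by move=> k kj; rewrite mxE (negbTE kj) andbF mul0r.
rewrite big1 ?addr0// => k ki; rewrite big1// => l _.
by rewrite mxE (negbTE ki) mul0r.
Qed.

Lemma sqnormE m p (x : 'M[R]_(m, p)) : sqnorm x = mxdot x x.
Proof. by apply: eq_bigr => i _; apply: eq_bigr => j _; rewrite expr2. Qed.

Lemma sqnorm_ge0 m p (x : 'M[R]_(m, p)) : 0 <= sqnorm x.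
Proof. by do 2 (apply: sumr_ge0 => ? _); exact: sqr_ge0. Qed.

Lemma sqnorm_entry m p (x : 'M[R]_(m, p)) i j : x i j ^+ 2 <= sqnorm x.
Proof.
rewrite /sqnorm (bigD1 i)//= (bigD1 j)//= -addrA lerDl.
by rewrite addr_ge0// ?sumr_ge0// => k _; rewrite ?sqr_ge0//;
  apply: sumr_ge0 => l _; exact: sqr_ge0.
Qed.

Lemma sqnorm_eq0 m p (x : 'M[R]_(m, p)) : sqnorm x = 0 -> x = 0.
Proof.
move=> x0; apply/matrixP => i j; rewrite mxE; apply/eqP.
by rewrite -sqrf_eq0 eq_le sqr_ge0 andbT -x0 sqnorm_entry.
Qed.

Lemma sqnormD m p (x y : 'M[R]_(m, p)) :
  sqnorm (x + y) = sqnorm x + mxdot x y *+ 2 + sqnorm y.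
Proof. by rewrite !sqnormE mxdotDr !mxdotDl (mxdotC y x) mulr2n; ring. Qed.

End inner_product.

Section rate_function.
Context {R : realType} (m p : nat) (G : 'M[R]_m).
Let S := msqrt G.
Hypotheses (St : S^T = S) (SS : S *m S = G).
Implicit Types (z r la : 'M[R]_(m, p)).

(** The row space of a symmetric [S] meets its kernel trivially: v = D S and v S = 0 give v v^T = 0.
    Hence S and S^2 have equal rank, and [G] has the range of its root. *)
Let sub_sqr : (S <= S *m S)%MS.
Proof.
have h : (S *m S <= S)%MS by exact: submxMl.
have [_ <-] := mxrank_leqif_sup h.
rewrite -[X in _ == X](mxrank_mul_ker S S).
suff -> : (S :&: kermx S)%MS = 0 by rewrite mxrank0 addn0.
apply/eqP/rowV0P => v; rewrite sub_capmx => /andP[/submxP[D vD] /sub_kermxP vS].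
apply: sqnorm_eq0; rewrite sqnormE mxdotE mxtrace_mulC.
by rewrite {2}vD trmx_mul St mulmxA vS mul0mx mxtrace0.
Qed.

(** A point outside the range of [S] is detected by the cokernel [K]: la = K K^T z is killed by [S]
    and pairs with [z] to |K^T z|^2 > 0. The Laplace exponent vanishes along such [la]. *)
Lemma rate_trichotomy z : (exists la, z = G *m la) \/
  ((forall r, S *m r <> z) /\ exists la, S *m la = 0 /\ 0 < mxdot la z).
Proof.
have [zS|zS] := boolP (z^T <= S)%MS.
  left; have /submxP[D zD] := submx_trans zS sub_sqr.
  by exists D^T; rewrite -[z]trmxK zD !trmx_mul St SS.
right; split.
  by move=> r rz; move/negP : zS; apply; rewrite -rz trmx_mul St submxMl.
pose K := cokermx S.
exists (K *m (K^T *m z)); split.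
  by rewrite (mulmxA S K) mulmx_coker mul0mx.
rewrite mxdotC mxdot_mul -sqnormE lt_neqAle sqnorm_ge0 andbT eq_sym.
apply/negP => /eqP /sqnorm_eq0 h; move/negP : zS; apply.
by rewrite submxE -[_ *m _]trmxK trmx_mul trmxK h trmx0.
Qed.

Let sqnorm_S la : sqnorm (S *m la) = mxdot la (G *m la).
Proof. by rewrite sqnormE -SS -mulmxA [RHS]mxdot_mul St. Qed.

(** [S *m la] is the preimage of least norm: any other differs from it by an element of the kernel
    of [S], orthogonal to the range. *)
Lemma rateI_range la : rateI G (G *m la) = (mxdot la (G *m la) / 2)%:E.
Proof.
rewrite -sqnorm_S; apply/eqP; rewrite eq_le; apply/andP; split.
  apply: ereal_inf_lbound; exists (S *m la) => //=.
  by rewrite mulmxA SS.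
apply: le_ereal_inf_tmp => _ [r /= rz <-]; rewrite lee_fin ler_pM2r//.
have -> : r = S *m la + (r - S *m la) by rewrite addrC subrK.
have e0 : mxdot (S *m la) (r - S *m la) = 0.
  rewrite -[X in mxdot (X *m _)]St -mxdot_mul mulmxBr rz mulmxA SS subrr.
  by rewrite mxdotE mulmx0 mxtrace0.
by rewrite sqnormD e0 mul0rn addr0 lerDl sqnorm_ge0.
Qed.

Lemma rateI_out z : (forall r, S *m r <> z) -> rateI G z = +oo%E.
Proof.
move=> h; apply/ereal_inf_pinfty => y [r /= rz _]; by have := h r rz.
Qed.

Lemma rateI_ge0 z : (0 <= rateI G z)%E.
Proof.
apply: le_ereal_inf_tmp => _ [r _ <-].
by rewrite lee_fin divr_ge0// sqnorm_ge0.
Qed.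

(* the rate function is the Legendre transform of [la |-> <la, G la> / 2] *)
Lemma rateI_dual z (c : R) : (c%:E < rateI G z)%E ->
  exists la, c < mxdot la z - mxdot la (G *m la) / 2.
Proof.
have [[la ->]|[_ [la [la0 laz]]]] := rate_trichotomy z.
  by rewrite rateI_range lte_fin => h; exists la; lra.
(* In a direction killed by [S] the quadratic term is 0, and scaling brings the pairing with [z] to
   |c| + 1 > c. *)
move=> _; exists ((`|c| + 1) / mxdot la z *: la).
rewrite -scalemxAr -SS -mulmxA la0 mulmx0 scaler0 mxdotZl divfK ?gt_eqF//.
rewrite mxdotE mulmx0 mxtrace0 mul0r subr0.
by have := ler_norm c; lra.
Qed.

Lemma rateI_le z (c : R) : (rateI G z <= c%:E)%E ->
  exists2 r, S *m r = z & sqnorm r / 2 <= c.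
Proof.
have [[la ->]|[/rateI_out -> _]] := rate_trichotomy z; last by rewrite leye_eq.
rewrite rateI_range lee_fin => h; exists (S *m la); first by rewrite mulmxA SS.
by rewrite sqnorm_S.
Qed.

Lemma rateI_unit z : G \in unitmx -> rateI G z = (sqnorm (invmx S *m z) / 2)%:E.
Proof.
move=> uG; have uS : S \in unitmx.
  by move: uG; rewrite -SS unitmx_mul => /andP[].
apply/eqP; rewrite eq_le; apply/andP; split.
  by apply: ereal_inf_lbound; exists (invmx S *m z) => //=; rewrite mulKVmx.
by apply: le_ereal_inf_tmp => _ [r /= <- <-]; rewrite mulKmx.
Qed.

End rate_function.

(** * Continuity and compactness in matrix spaces *)

Section matrix_topology.
Context {R : realType} (m p : nat).

Lemma continuous_mx (U : topologicalType) (f : U -> 'M[R]_(m, p)) :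
  (forall i j, continuous (fun u => f u i j)) -> continuous f.
Proof.
move=> cf u A [B nB sBA].
have : \forall u' \near u, forall ij : 'I_m * 'I_p, B ij.1 ij.2 (f u' ij.1 ij.2).
  by apply: filter_forall => -[i j]; exact: (cf i j u _ (nB i j)).
by apply: filterS => u' h; apply: sBA => i j; exact: (h (i, j)).
Qed.

Lemma continuous_sum (U : topologicalType) (I : Type) (s : seq I) (f : I -> U -> R) :
  (forall i, continuous (f i)) -> continuous (fun u => \sum_(i <- s) f i u).
Proof.
move=> cf; elim: s => [|i s ih] u.
  rewrite (_ : (fun u => _) = cst 0); first exact: cvg_cst.
  by apply/funext => v; rewrite big_nil.
rewrite (_ : (fun u => _) = f i \+ (fun u => \sum_(i <- s) f i u)).
  by apply: cvgD; [exact: cf|exact: ih].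
by apply/funext => v; rewrite big_cons.
Qed.

Lemma continuous_mxdot (la : 'M[R]_(m, p)) : continuous (mxdot la).
Proof.
apply: (@continuous_sum _ _ _
  (fun i (y : 'M[R]_(m, p)) => \sum_j la i j * y i j)) => i.
apply: (@continuous_sum _ _ _ (fun j (y : 'M[R]_(m, p)) => la i j * y i j)) => j y.
apply: (cvg_comp (fun y : 'M[R]_(m, p) => y i j) ( *%R (la i j))).
  exact: coord_continuous.
exact: mulrl_continuous.
Qed.

Lemma continuous_sqnorm : continuous (@sqnorm R m p).
Proof.
apply: (@continuous_sum _ _ _
  (fun i (y : 'M[R]_(m, p)) => \sum_j y i j ^+ 2)) => i.
apply: (@continuous_sum _ _ _ (fun j (y : 'M[R]_(m, p)) => y i j ^+ 2)) => j y.
apply: (cvg_comp (fun y : 'M[R]_(m, p) => y i j) (fun x => x ^+ 2)).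
  exact: coord_continuous.
exact: sqr_continuous.
Qed.

Lemma continuous_mulmx (A : 'M[R]_m) : continuous (fun r : 'M[R]_(m, p) => A *m r).
Proof.
apply: continuous_mx => i j; under eq_fun do rewrite mxE.
apply: (@continuous_sum _ _ _ (fun k (r : 'M[R]_(m, p)) => A i k * r k j)) => k y.
apply: (cvg_comp (fun y : 'M[R]_(m, p) => y k j) ( *%R (A i k))).
  exact: coord_continuous.
exact: mulrl_continuous.
Qed.

Lemma mx_box_compact (K : R) :
  compact [set y : 'M[R]_(m, p) | forall i j, `|y i j| <= K].
Proof.
have -> : [set y : 'M[R]_(m, p) | forall i j, `|y i j| <= K] =
    vec_mx @` [set v : 'rV[R]_(m * p) | forall k, `[- K, K]%classic (v ord0 k)].
  apply/seteqP; split => [y /= h|_ [v /= h <-] i j].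
    exists (mxvec y); last by rewrite mxvecK.
    move=> k; case/mxvec_indexP : k => i j.
    by rewrite mxvecE in_itv/= -ler_norml.
  by rewrite mxE ler_norml; have := h (mxvec_index i j); rewrite in_itv.
apply: continuous_compact.
  apply: continuous_subspaceT; apply: continuous_mx => i j.
  under eq_fun do rewrite mxE; exact: coord_continuous.
by apply: (@rV_compact _ _ (fun=> `[- K, K]%classic)) => k; exact: segment_compact.
Qed.

Lemma mx_ball_entries (x y : 'M[R]_(m, p)) (e : R) :
  ball x e y <-> 0 < e /\ forall i j, `|x i j - y i j| < e.
Proof. by []. Qed.

End matrix_topology.

(** The infimum is attained ([rateI_le]), so a sublevel set is the image under [msqrt G] of a
    Euclidean ball, which is compact. *)
Lemma good_rate_rateI (R : realType) (m p : nat) (G : 'M[R]_m) :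
  (msqrt G)^T = msqrt G -> msqrt G *m msqrt G = G -> good_rate (@rateI R m p G).
Proof.
move=> St SS; split; first exact: rateI_ge0.
move=> c.
have -> : [set z | (rateI G z <= c%:E)%E] =
    (fun r : 'M[R]_(m, p) => msqrt G *m r) @` [set r | sqnorm r <= 2 * c].
  apply/seteqP; split => [z /= /(rateI_le St SS)[r rz rc]|_ [r /= rc <-]].
    by exists r => //=; lra.
  apply: (@le_trans _ _ (sqnorm r / 2)%:E); last by rewrite lee_fin; lra.
  by apply: ereal_inf_lbound; exists r.
apply: continuous_compact; first by apply: continuous_subspaceT; exact: continuous_mulmx.
apply: (subclosed_compact _ (@mx_box_compact R m p (2 * `|c| + 1))).
  apply: (@closed_comp _ _ (@sqnorm R m p) [set x | x <= 2 * c]).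
    by move=> x _; exact: continuous_sqnorm.
  exact: closed_le.
move=> r /= rc i j.
have h := sqnorm_entry r i j; have c2 := ler_norm c.
rewrite -ler_sqr ?nnegrE// -normrX ger0_norm ?sqr_ge0//.
  by apply: (le_trans h); have := normr_ge0 c; nra.
Qed.

(** * The network conditionally on its lower layers *)

Definition layer (p : param_index) : nat :=
  match p with inl (l, _, _) => l | inr (l, _) => l end.

Definition neuron (p : param_index) : nat :=
  match p with inl (_, i, _) => i | inr (_, i) => i end.

(** From exp(-x) >= 1 - x > 0 follows exp x <= 1 / (1 - x), and (1 - x)(1 + x + 2 x^2) >= 1 when x
    <= 1/2. *)
Lemma expR_le_quad (R : realType) (x : R) : `|x| <= 1 / 2 -> expR x <= 1 + x + 2 * x ^+ 2.
Proof.
rewrite ler_norml => /andP[x1 x2].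
have := expR_ge1Dx (- x); have := expR_gt0 x; have := expRxMexpNx_1 x.
nra.
Qed.

Lemma bounded_integrable (R : realType) d (T : measurableType d) (P : probability T R)
    (g : T -> R) (B : R) : measurable_fun setT g -> (forall w, `|g w| <= B) ->
  P.-integrable setT (fun w => (g w)%:E).
Proof.
move=> mg gB; have i1 : P.-integrable setT (fun w : T => B%:E).
  exact: finite_measure_integrable_cst.
apply: le_integrable i1 => //; first exact/measurable_EFinP.
by move=> t _ /=; rewrite lee_fin (le_trans (gB t))// ler_norm.
Qed.

Lemma mgf_bounded (R : realType) d (T : measurableType d) (P : probability T R)
    (g : T -> R) (B th y e : R) :
  measurable_fun setT g -> (forall w, `|g w| <= B) -> `|th| * B <= 1 / 2 ->
  `|\int[P]_w g w - y| <= e ->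
  (\int[P]_w (expR (th * g w))%:E <= (expR (th * y + `|th| * e + 2 * (th * B) ^+ 2))%:E)%E.
Proof.
move=> mg gB thB ge.
have ig := bounded_integrable P mg gB.
have i1 : P.-integrable setT (fun w : T => (1 + 2 * (th * B) ^+ 2)%:E).
  exact: finite_measure_integrable_cst.
have iz : P.-integrable setT (fun w : T => (th%:E * (g w)%:E)%E).
  exact: integrableZl.
have mz : measurable_fun setT (fun w => th * g w) by exact: measurable_funM.
apply: (@le_trans _ _ (\int[P]_w ((1 + 2 * (th * B) ^+ 2)%:E + th%:E * (g w)%:E))%E).
  apply: le_integral => //.
  - apply: (@bounded_integrable _ _ _ _ (fun w => expR (th * g w)) (expR (1 / 2))).
      exact: measurableT_comp.
    move=> w; rewrite ger0_norm ?expR_ge0// ler_expR (le_trans (ler_norm _))//.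
    by rewrite normrM (le_trans _ thB)// ler_wpM2l.
  - exact: integrableD.
  move=> w _; rewrite lee_fin.
  have h : `|th * g w| <= `|th| * B by rewrite normrM ler_wpM2l.
  have := expR_le_quad (le_trans h thB).
  have : (th * g w) ^+ 2 <= (th * B) ^+ 2.
    have B0 : 0 <= B by exact: le_trans (gB w).
    rewrite [leRHS]exprMn -(real_normK (num_real th)) -exprMn.
    by rewrite -(real_normK (num_real (th * g w))) ler_sqr ?nnegrE// mulr_ge0.
  lra.
rewrite integralD// integralZl// integral_prob_cst.
have -> : (\int[P]_w (g w)%:E = (\int[P]_w g w)%:E)%E.
  by rewrite /Rintegral fineK//; exact: integrable_fin_num.
rewrite lee_fin.
apply: (@le_trans _ _ (1 + (th * y + `|th| * e + 2 * (th * B) ^+ 2))); last exact: expR_ge1Dx.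
have : th * (\int[P]_w g w - y) <= `|th| * e.
  by rewrite (le_trans (ler_norm _))// normrM ler_wpM2l.
by rewrite mulrBr; lra.
Qed.

Lemma measurable_dist_gt (R : realType) d (T : measurableType d) (f : T -> R) (y del : R) :
  measurable_fun setT f -> measurable [set w | del < `|f w - y|].
Proof.
move=> mf; rewrite (_ : [set w | _] = (fun w => `|f w - y|) @^-1` `]del, +oo[); last first.
  by apply/seteqP; split => w /=; rewrite in_itv/= andbT.
rewrite -[X in measurable X]setTI.
have h : measurable_fun setT (fun w => `|f w - y|).
  by apply: measurableT_comp => //; exact: measurable_funB.
exact: h.
Qed.

Lemma prob_le_integral (R : realType) d (T : measurableType d) (P : probability T R)
    (A : set T) (g : T -> R) : measurable A -> measurable_fun setT g ->
  (forall w, 0 <= g w) -> (forall w, A w -> 1 <= g w) ->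
  (P A <= \int[P]_w (g w)%:E)%E.
Proof.
move=> mA mg g0 g1; rewrite -(setIT A) -integral_indic//; apply: ge0_le_integral => //.
- exact/measurable_EFinP.
- exact/measurable_EFinP.
move=> w _; rewrite lee_fin indicE; case: (boolP (w \in A)) => // /set_mem; exact: g1.
Qed.

Section network.
Context {R : realType} {d} {T : measurableType d} (P : probability T R).
Variables (L n0 nL1 : nat) (Cb CW : R) (sigma : R -> R) (w : nat -> nat).
Variables (m : nat) (xs : 'I_m -> nat -> R).
Variables (W : nat -> nat -> nat -> T -> R) (b : nat -> nat -> T -> R).

Local Notation wid := (width n0 nL1 L w).
Local Notation Z al := (preact sigma n0 nL1 L w W b (xs al)).
Local Notation X := (params W b).
Local Notation J0 := (param_set n0 nL1 L w).

Definition activation k (al : 'I_m) j (om : T) : R :=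
  if k is 0 then xs al j else sigma (Z al k j om).

(* conditional covariance of the pre-activations of layer [k.+1] given the layers up to [k] *)
Definition emp_cov k (om : T) : 'M[R]_m := \matrix_(al, be)
  (Cb + CW / (wid k)%:R * \sum_(j < wid k) activation k al j om * activation k be j om).

(* the pre-activation of layer [k.+1], with the layers up to [k] read in [om]
   and the parameters of layer [k.+1] read in [om'] *)
Definition frozen_preact k al i (om om' : T) : R :=
  b k.+1 i om' + \sum_(j < wid k) activation k al j om * W k.+1 i j om'.

Lemma preact_frozen k al i om : Z al k.+1 i om = frozen_preact k al i om om.
Proof.
rewrite /frozen_preact; case: k => [|k] /=; congr (_ + _);
  by apply: eq_bigr => j _; rewrite mulrC.
Qed.

(** The bias and the incoming weights of one neuron. These lists are disjoint for distinct neurons,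
    the source of conditional independence within a layer. *)
Definition feeds l i : seq param_index :=
  inr (l, i) :: [seq inl (l, i, j) | j <- index_iota 0 (wid l.-1)].

Lemma uniq_feeds l i : uniq (feeds l i).
Proof.
rewrite /feeds /= map_inj_uniq ?iota_uniq ?andbT; last by move=> j j' [].
by apply/mapP => -[].
Qed.

Lemma mem_feeds l i p : p \in feeds l i -> layer p = l /\ neuron p = i.
Proof. by rewrite inE => /predU1P[->|/mapP[j _ ->]]. Qed.

Lemma feeds_param_set k i p : (k <= L)%N -> (i < wid k.+1)%N ->
  p \in feeds k.+1 i -> J0 p.
Proof.
move=> kL iw; rewrite inE => /predU1P[->|/mapP[j]]; first by split.
by rewrite mem_index_iota => /= /[dup] jw _ ->; split.
Qed.

Lemma uniq_flatten_feeds l (s : seq nat) :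
  uniq s -> uniq (flatten [seq feeds l i | i <- s]).
Proof.
elim: s => [//|i s ih] /= /andP[is_ us].
change (uniq (feeds l i ++ flatten [seq feeds l i | i <- s])).
rewrite cat_uniq ih// uniq_feeds andbT /=.
apply/hasPn => p /flatten_mapP[j js pj]; apply/negP => pi.
by move: is_; rewrite -(mem_feeds pi).2 (mem_feeds pj).2 js.
Qed.

Lemma big_feeds (g : param_index -> R) k i : \sum_(p <- feeds k.+1 i) g p =
  g (inr (k.+1, i)) + \sum_(j < wid k) g (inl (k.+1, i, (j : nat))).
Proof. by rewrite big_cons big_map big_mkord. Qed.

Definition feed_coef k al om (p : param_index) : R :=
  match p with inl (_, _, j) => activation k al j om | inr _ => 1 end.

Definition param_var (p : param_index) : R :=
  match p with inl (l, _, _) => CW / (wid l.-1)%:R | inr _ => Cb end.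

Lemma frozen_preact_lin k al i om om' : frozen_preact k al i om om' =
  \sum_(p <- feeds k.+1 i) feed_coef k al om p * X p om'.
Proof. by rewrite big_feeds /= mul1r. Qed.

(** The value does not depend on [i]: given the lower layers, all neurons of layer [k.+1] share one
    Gaussian law. *)
Lemma feed_cov k al be i om :
  \sum_(p <- feeds k.+1 i) feed_coef k al om p * feed_coef k be om p * param_var p =
  emp_cov k om al be.
Proof.
rewrite big_feeds /= mxE !mul1r; congr (_ + _).
by rewrite -mulr_suml mulrC.
Qed.

Hypotheses (Cb0 : 0 <= Cb) (CW0 : 0 < CW).
Hypothesis hW : forall l i j, J0 (inl (l, i, j)) ->
  measurable_fun setT (W l i j) /\ has_law P (W l i j) (gauss_law (CW / (wid l.-1)%:R)).
Hypothesis hb : forall l i, J0 (inr (l, i)) ->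
  measurable_fun setT (b l i) /\ has_law P (b l i) (gauss_law Cb).
Hypothesis indX : mutually_independent P X J0.

Lemma measurable_param p : J0 p -> measurable_fun setT (X p).
Proof. by case: p => [[[l i] j]|[l i]] h; [exact: (hW h).1|exact: (hb h).1]. Qed.

Lemma law_param p : J0 p -> has_law P (X p) (gauss_law (param_var p)).
Proof. by case: p => [[[l i] j]|[l i]] h; [exact: (hW h).2|exact: (hb h).2]. Qed.

Lemma param_var_ge0 p : J0 p -> 0 <= param_var p.
Proof. by case: p => [[[l i] j]|[l i]] h //=; rewrite divr_ge0// ltW. Qed.

Lemma measurable_frozen_r k al i om : (k <= L)%N -> (i < wid k.+1)%N ->
  measurable_fun setT (frozen_preact k al i om).
Proof.
move=> kL iw; rewrite (_ : frozen_preact k al i om = fun om' =>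
    \sum_(p <- feeds k.+1 i) feed_coef k al om p * X p om'); last first.
  by apply/funext => om'; rewrite frozen_preact_lin.
apply: measurable_lin => p pf; apply: measurable_param.
exact: feeds_param_set pf.
Qed.

Lemma frozen_functional k al be i om : (k <= L)%N -> (i < wid k.+1)%N ->
  gaussian_functional
    (fun F => \int[P]_om' F (frozen_preact k al i om om') (frozen_preact k be i om om'))
    (emp_cov k om al al) (emp_cov k om al be) (emp_cov k om be be).
Proof.
move=> kL iw.
have := lin_functional measurable_param indX law_param param_var_ge0
  (uniq_feeds k.+1 i) (fun p => feeds_param_set kL iw (p := p))
  (feed_coef k al om) (feed_coef k be om).
rewrite -!(feed_cov k _ _ i om).
under [in X in gaussian_functional _ X]eq_bigr do rewrite expr2.
under [in X in gaussian_functional _ _ _ X]eq_bigr do rewrite expr2.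
congr (gaussian_functional _ _ _ _).
apply/funext => F; apply: eq_Rintegral => om' _.
by rewrite !frozen_preact_lin.
Qed.

Section measurability.
Hypothesis csigma : continuous sigma.

Let msigma : measurable_fun setT sigma.
Proof. exact: continuous_measurable_fun. Qed.

(** Stated for every [J] containing the parameters of the layers up to [k], so that the activation
    can be read in whichever sub-sigma-algebra a freezing step uses. *)
Lemma measurable_activation J k al j : (k <= L)%N -> (j < wid k)%N ->
  (forall p, J0 p -> (layer p <= k)%N -> J p) ->
  measurable_fun [set: sigma_of X J] (activation k al j : sigma_of X J -> R).
Proof.
elim: k j => [|k ih] j kL jw hJ; first exact: measurable_cst.
apply: (measurableT_comp msigma).
have jJ p : p \in feeds k.+1 j -> J p.
  move=> jp; have [e _] := mem_feeds jp.
  by apply: hJ; [exact: (feeds_param_set (ltnW kL) jw jp)|rewrite e].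
have mX p : J p -> measurable_fun [set: sigma_of X J] (X p : sigma_of X J -> R).
  exact: sigma_of_measurable.
rewrite (_ : Z al k.+1 j = fun om => frozen_preact k al j om om); last first.
  by apply/funext => om; rewrite preact_frozen.
apply: measurable_funD.
  by apply: (mX (inr (k.+1, j))); apply: jJ; rewrite mem_head.
apply: measurable_sum => i; apply: measurable_funM.
  by apply: ih => //; [exact: ltnW|move=> p Jp lp; apply: hJ => //; exact: leqW].
apply: (mX (inl (k.+1, j, (i : nat)))); apply: jJ; rewrite inE map_f ?orbT//.
by rewrite mem_index_iota /=.
Qed.

Lemma measurable_frozen J1 J2 k al i : (k <= L)%N -> (i < wid k.+1)%N ->
  (forall p, J0 p -> (layer p <= k)%N -> J1 p) ->
  (forall p, p \in feeds k.+1 i -> J2 p) ->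
  measurable_fun [set: sigma_of X J1 * sigma_of X J2]
    ((fun z => frozen_preact k al i z.1 z.2) : sigma_of X J1 * sigma_of X J2 -> R).
Proof.
move=> kL iw h1 h2.
have mX p : J2 p -> measurable_fun [set: sigma_of X J1 * sigma_of X J2] (fun z => X p z.2).
  move=> Jp; have h : measurable_fun [set: sigma_of X J2] (X p : sigma_of X J2 -> R).
    exact: sigma_of_measurable.
  exact: (measurableT_comp h measurable_snd).
apply: measurable_funD.
  by apply: (mX (inr (k.+1, i))); apply: h2; rewrite mem_head.
apply: measurable_sum => j; apply: measurable_funM.
  have ma : measurable_fun [set: sigma_of X J1] (activation k al j : sigma_of X J1 -> R).
    exact: measurable_activation.
  exact: (measurableT_comp ma measurable_fst).
apply: (mX (inl (k.+1, i, (j : nat)))); apply: h2; rewrite inE map_f ?orbT//.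
by rewrite mem_index_iota /=.
Qed.

Lemma measurable_emp_cov J k al be : (k <= L)%N ->
  (forall p, J0 p -> (layer p <= k)%N -> J p) ->
  measurable_fun [set: sigma_of X J] ((fun om => emp_cov k om al be) : sigma_of X J -> R).
Proof.
move=> kL hJ; under eq_fun do rewrite mxE.
apply: measurable_funD => //; apply: measurable_funM => //.
by apply: measurable_sum => j; apply: measurable_funM; exact: measurable_activation.
Qed.

Lemma measurable_preact al i : (i < nL1)%N -> measurable_fun setT (Z al L.+1 i).
Proof.
move=> iw.
have wE : wid L.+1 = nL1 by rewrite /width /= eqxx.
apply: (sigma_of_measurableT (X := X) measurable_param (subset_refl (A := J0))).
have mX p : J0 p -> measurable_fun [set: sigma_of X J0] (X p : sigma_of X J0 -> R).
  exact: sigma_of_measurable.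
rewrite (_ : Z al L.+1 i = fun om => frozen_preact L al i om om); last first.
  by apply/funext => om; rewrite preact_frozen.
have Jp p : p \in feeds L.+1 i -> J0 p by apply: feeds_param_set; rewrite ?wE.
apply: measurable_funD.
  by apply: (mX (inr (L.+1, i))); apply: Jp; rewrite mem_head.
apply: measurable_sum => j; apply: measurable_funM.
  exact: measurable_activation.
apply: (mX (inl (L.+1, i, (j : nat)))); apply: Jp; rewrite inE map_f ?orbT//.
by rewrite mem_index_iota /=.
Qed.

(** * Chernoff bound across the neurons of one layer *)

Section concentration.
Variables (M : R) (k : nat) (al be : 'I_m) (D : set T) (y e : R).
Hypothesis sM : forall t, `|sigma t| <= M.
Hypothesis kL : (k < L)%N.
Hypothesis mD : forall J, (forall p, J0 p -> (layer p <= k)%N -> J p) ->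
  @measurable _ (sigma_of X J) D.
Hypothesis De : forall om i, D om -> (i < wid k.+1)%N ->
  `|\int[P]_om' (sigma (frozen_preact k al i om om') * sigma (frozen_preact k be i om om'))
    - y| <= e.

Let N := wid k.+1.
Let ss j om := activation k.+1 al j om * activation k.+1 be j om.

Let kL' : (k <= L)%N. Proof. exact: ltnW. Qed.

Let prod_bound u v : `|sigma u * sigma v| <= M * M.
Proof. by rewrite normrM ler_pM. Qed.

Let mDT : measurable D.
Proof.
apply: (sigma_of_sub measurable_param (subset_refl (A := J0))).
by apply: mD.
Qed.

Let mss J j : (j < N)%N ->
  (forall p, J0 p -> (layer p <= k)%N -> J p) ->
  (forall p, p \in feeds k.+1 j -> J p) ->
  measurable_fun [set: sigma_of X J] (ss j : sigma_of X J -> R).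
Proof.
move=> jN h1 h2.
have mz ga : measurable_fun [set: sigma_of X J] (activation k.+1 ga j : sigma_of X J -> R).
  apply: (measurableT_comp msigma).
  rewrite (_ : Z ga k.+1 j = fun om => frozen_preact k ga j om om); last first.
    by apply/funext => om; rewrite preact_frozen.
  have mp := @measurable_frozen J J k ga j kL' jN h1 h2.
  have md : measurable_fun [set: sigma_of X J]
     ((fun om => (om, om)) : sigma_of X J -> sigma_of X J * sigma_of X J).
    exact: measurable_fun_pair.
  exact: (measurableT_comp mp md).
exact: measurable_funM.
Qed.

(** [D] is an event determined by the layers up to [k] on which the conditional mean is within [e]
    of [y]; carrying its indicator along lets that estimate be used at every neuron. *)
Let partial th i om := \1_D om * expR (th * \sum_(j < i) ss j om).

Let mpartial J th i : (i <= N)%N ->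
  (forall p, J0 p -> (layer p <= k)%N -> J p) ->
  (forall p j, (j < i)%N -> p \in feeds k.+1 j -> J p) ->
  measurable_fun [set: sigma_of X J] (partial th i : sigma_of X J -> R).
Proof.
move=> iN h1 h2; apply: measurable_funM.
  exact: (measurable_indic (mD h1)).
apply: measurableT_comp => //; apply: measurable_funM => //.
apply: measurable_sum => j; apply: mss => //; first exact: leq_trans iN.
by move=> p; exact: h2.
Qed.

Let mpartialT th i : (i <= N)%N -> measurable_fun setT (partial th i).
Proof.
move=> iN; apply: (sigma_of_measurableT measurable_param (subset_refl (A := J0))).
apply: mpartial => // p j ji; apply: feeds_param_set => //.
exact: leq_trans iN.
Qed.

Let partial_ge0 th i om : 0 <= partial th i om.
Proof. by rewrite mulr_ge0 ?expR_ge0// indicE. Qed.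

Lemma layer_mgf th i : `|th| * (M * M) <= 1 / 2 -> (i <= N)%N ->
  (\int[P]_om (partial th i om)%:E <=
   (expR (i%:R * (th * y + `|th| * e + 2 * (th * (M * M)) ^+ 2)))%:E)%E.
Proof.
move=> thM; set kap := th * y + _ + _; elim: i => [|i ih] iN.
  rewrite mul0r expR0 -[leRHS](integral_prob_cst P); apply: ge0_le_integral => //.
  - by move=> om _; rewrite lee_fin.
  - by apply/measurable_EFinP; exact: mpartialT.
  move=> om _; rewrite lee_fin /partial big_ord0 mulr0 expR0 mulr1 indicE.
  by case: (_ \in _).
pose f om om' := (partial th i om *
  expR (th * (sigma (frozen_preact k al i om om') * sigma (frozen_preact k be i om om'))))%:E.
pose J1 : set param_index := [set p | J0 p /\ ((layer p <= k)%N \/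
   (layer p = k.+1 /\ (neuron p < i)%N))].
pose J2 : set param_index := [set p | J0 p /\ p \in feeds k.+1 i].
have low p : J0 p -> (layer p <= k)%N -> J1 p by move=> Jp lp; split => //; left.
have J2f p : p \in feeds k.+1 i -> J2 p.
  by move=> pf; split => //; exact: feeds_param_set pf.
have mfr ga : measurable_fun [set: sigma_of X J1 * sigma_of X J2]
    (fun z => sigma (frozen_preact k ga i z.1 z.2)).
  by apply: (measurableT_comp msigma); exact: measurable_frozen.
have mf : measurable_fun [set: sigma_of X J1 * sigma_of X J2]
    ((fun z => f z.1 z.2) : sigma_of X J1 * sigma_of X J2 -> \bar R).
  apply/measurable_EFinP; apply: measurable_funM.
    have mp : measurable_fun [set: sigma_of X J1] (partial th i : sigma_of X J1 -> R).
      apply: mpartial => //; first exact: ltnW.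
      move=> p j ji pf; have [l1 l2] := mem_feeds pf; split.
        by apply: feeds_param_set pf => //; exact: ltn_trans ji _.
      by right; rewrite l1 l2.
    exact: (measurableT_comp mp measurable_fst).
  by apply: measurableT_comp => //; apply: measurable_funM => //; exact: measurable_funM.
have f0 om om' : (0 <= f om om')%E by rewrite lee_fin mulr_ge0 ?expR_ge0.
have E : (\int[P]_om (partial th i.+1 om)%:E = \int[P]_om f om om)%E.
  apply: eq_integral => om _; rewrite /f /partial big_ord_recr /= mulrDr expRD mulrA.
  by rewrite /ss /activation !preact_frozen.
rewrite E (integral_freeze measurable_param indX _ _ _ mf f0).
- apply: (@le_trans _ _ (\int[P]_om ((expR kap)%:E * (partial th i om)%:E))%E).
    apply: ge0_le_integral => //.
    + by move=> om _; apply: integral_ge0.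
    + apply: (@measurable_fun_fubini_tonelli_F _ _ _ _ _ P (fun z : T * T => f z.1 z.2)) => //.
      have i1 : measurable_fun [set: T] (id : T -> sigma_of X J1).
        by apply: (measurable_id_sigma_of measurable_param) => p [].
      have i2 : measurable_fun [set: T] (id : T -> sigma_of X J2).
        by apply: (measurable_id_sigma_of measurable_param) => p [].
      exact: (measurableT_comp mf (measurable_fun_pair
        (measurableT_comp i1 measurable_fst) (measurableT_comp i2 measurable_snd))).
    + apply: emeasurable_funM => //; apply/measurable_EFinP; apply: mpartialT; exact: ltnW.
    move=> om _; rewrite /f.
    under eq_integral do rewrite EFinM.
    have msl : measurable_fun setT (fun om' =>
       sigma (frozen_preact k al i om om') * sigma (frozen_preact k be i om om')).
      by apply: measurable_funM; apply: (measurableT_comp msigma);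
        exact: measurable_frozen_r.
    rewrite ge0_integralZl//; last 2 first.
      by apply/measurable_EFinP; apply: measurableT_comp => //; exact: measurable_funM.
      by rewrite lee_fin.
    rewrite muleC; have [Dom|nD] := pselect (D om).
      apply: lee_pmul => //; [by apply: integral_ge0|by rewrite lee_fin|].
      apply: (mgf_bounded msl _ thM); first by move=> om'; exact: prod_bound.
      exact: De.
    by rewrite /partial indicE (memNset nD) mul0r !mule0.
  rewrite ge0_integralZl//; last 2 first.
  + by apply/measurable_EFinP; apply: mpartialT; exact: ltnW.
  + by move=> om _; rewrite lee_fin.
  rewrite -natr1 mulrDl mul1r (expRD (i%:R * kap)) [leRHS]EFinM muleC.
  rewrite lee_pmul ?lee_fin ?expR_ge0 ?lexx//; last exact: ih (ltnW iN).
  by apply: integral_ge0 => om _; rewrite lee_fin.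
- by move=> p [].
- by move=> p [].
- move=> p [_ h1] [_ /mem_feeds[l1 l2]]; move: h1; rewrite l1 l2 ltnn.
  by rewrite ltnn => -[|[]].
Qed.

Let S om := \sum_(j < N) ss j om.

Let mS : measurable_fun setT S.
Proof.
apply: (sigma_of_measurableT measurable_param (subset_refl (A := J0))).
apply: measurable_sum => j; apply: mss => // p pf.
exact: feeds_param_set pf.
Qed.

(** Exponential Markov inequality with [th] equal to th' or - th', so that one statement yields both
    tails. The condition on [c] says what is left of th' del after the bias th' e and the quadratic
    remainder. *)
Let side (th th' del c : R) : `|th| = th' -> th' * (M * M) <= 1 / 2 ->
  c <= th' * del - th' * e - 2 * (th' * (M * M)) ^+ 2 ->
  let A := D `&` [set om | N%:R * th' * del <= th * (S om - N%:R * y)] in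
  measurable A /\ (P A <= (expR (- (N%:R * c)))%:E)%E.
Proof.
move=> thE thM hc A.
have mA : measurable A.
  apply: measurableI => //.
  rewrite (_ : [set om | _] = (fun om => th * (S om - N%:R * y)) @^-1`
     `[N%:R * th' * del, +oo[); last first.
    by apply/seteqP; split => om /=; rewrite in_itv/= andbT.
  rewrite -[X in measurable X]setTI.
  have h : measurable_fun setT (fun om => th * (S om - N%:R * y)).
    by apply: measurable_funM => //; exact: measurable_funB.
  exact: h.
split => //.
pose u := - (th * (N%:R * y)) - N%:R * th' * del.
have mp := mpartialT th (leqnn N).
have mg : measurable_fun setT (fun om => expR u * partial th N om).
  exact: measurable_funM.
apply: (@le_trans _ _ (\int[P]_om (expR u * partial th N om)%:E)%E).
  apply: prob_le_integral => // [om|om [Dom /= hom]].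
    by rewrite mulr_ge0// expR_ge0.
  rewrite /partial indicE (mem_set Dom) mul1r -expRD -[leLHS]expR0 ler_expR /u.
  by move: hom; rewrite mulrBr -/(S om); lra.
under eq_integral do rewrite EFinM.
rewrite ge0_integralZl//; last 2 first.
  exact/measurable_EFinP.
  by move=> om _; rewrite lee_fin.
have hm : `|th| * (M * M) <= 1 / 2 by rewrite thE.
apply: (@le_trans _ _ ((expR u)%:E *
  (expR (N%:R * (th * y + `|th| * e + 2 * (th * (M * M)) ^+ 2)))%:E)%E).
  by rewrite lee_pmul ?lee_fin ?expR_ge0 ?lexx//; [apply: integral_ge0 => om _; rewrite lee_fin|exact: layer_mgf].
rewrite -EFinM lee_fin -expRD ler_expR /u thE.
have -> : (th * (M * M)) ^+ 2 = (th' * (M * M)) ^+ 2.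
  by rewrite -thE !exprMn real_normK ?num_real.
have := ler_wpM2l (ler0n R N) hc; rewrite !mulrBr !mulrDr; lra.
Qed.

Lemma layer_deviation (th del c : R) : 0 < th -> th * (M * M) <= 1 / 2 -> (0 < N)%N ->
  c <= th * del - th * e - 2 * (th * (M * M)) ^+ 2 ->
  (P (D `&` [set om | (del < `|N%:R^-1 * (\sum_(j < N) ss j om) - y|)%R]) <=
   (2 * expR (- (N%:R * c)))%:E)%E.
Proof.
move=> th0 thM N0 hc.
have [m1 p1] := side (gtr0_norm th0) thM hc.
have [|m2 p2] := @side (- th) th del c _ thM hc; first by rewrite normrN gtr0_norm.
rewrite (_ : 2 * _ = expR (- (N%:R * c)) + expR (- (N%:R * c))); last by ring.
rewrite EFinD; apply: le_trans (leeD p1 p2).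
have U := @measureU2 _ _ _ P _ _ m1 m2.
apply: (le_trans _ U); apply: le_measure; rewrite ?inE//.
- apply: measurableI => //; apply: (measurable_dist_gt (f := fun om => N%:R^-1 * S om)).
  exact: measurable_funM.
- exact: measurableU.
move=> om [Dom /= hom].
have Nr : 0 < N%:R :> R by rewrite ltr0n.
have E : S om - N%:R * y = N%:R * (N%:R^-1 * S om - y).
  by rewrite mulrBr mulVKf// gt_eqF.
have thN : 0 < N%:R * th by exact: mulr_gt0.
move: hom; rewrite -/(S om) ltr_normr => /orP[h|h]; [left|right]; split => //=; rewrite E.
  have := ler_wpM2l (ltW thN) (ltW h); lra.
have := ler_wpM2l (ltW thN) (ltW h); lra.
Qed.

End concentration.
Let lext (la : 'M[R]_(m, nL1)) al (h : nat) : R := oapp (la al) 0 (insub h).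

(** Given the hidden layers the outputs are exactly jointly Gaussian, so this is an identity at
    every finite width; the remaining randomness is that of [emp_cov L]. *)
Lemma output_mgf (la : 'M[R]_(m, nL1)) :
  (\int[P]_om (expR (mxdot la (\matrix_(al, h) Z al L.+1 h om)))%:E =
   \int[P]_om (expR (mxdot la (emp_cov L om *m la) / 2))%:E)%E.
Proof.
pose f om om' := (expR (\sum_al \sum_h la al h * frozen_preact L al h om om'))%:E.
have wE : wid L.+1 = nL1 by rewrite /width /= eqxx.
pose J1 : set param_index := [set p | J0 p /\ (layer p <= L)%N].
pose J2 : set param_index := [set p | J0 p /\ layer p = L.+1].
have fJ p h : (h < nL1)%N -> p \in feeds L.+1 h -> J0 p.
  by move=> hL; apply: feeds_param_set; rewrite ?wE.
have mf : measurable_fun [set: sigma_of X J1 * sigma_of X J2]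
    ((fun z => f z.1 z.2) : sigma_of X J1 * sigma_of X J2 -> \bar R).
  apply/measurable_EFinP; apply: measurableT_comp => //.
  apply: measurable_sum => al; apply: measurable_sum => h; apply: measurable_funM => //.
  apply: measurable_frozen; rewrite ?wE// => p pf.
  by split; [exact: fJ pf|exact: (mem_feeds pf).1].
have f0 om om' : (0 <= f om om')%E by rewrite lee_fin expR_ge0.
transitivity (\int[P]_om f om om)%E.
  apply: eq_integral => om _; congr (expR _)%:E.
  by apply: eq_bigr => al _; apply: eq_bigr => h _; rewrite mxE preact_frozen.
rewrite (integral_freeze measurable_param indX _ _ _ mf f0); first last.
- by move=> p [_ h1] [_ h2]; move: h1; rewrite h2 ltnn.
- by move=> p [].
- by move=> p [].
apply: eq_integral => om _.
(* All output neurons are integrated out together: [s] lists the parameters of the last layer and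
   [c] gives their coefficients in the linear form defined by [la]. *)
pose s := flatten [seq feeds L.+1 h | h <- index_iota 0 nL1].
pose c p := \sum_al lext la al (neuron p) * feed_coef L al om p.
have us : uniq s by apply: uniq_flatten_feeds; exact: iota_uniq.
have sJ p : p \in s -> J0 p.
  by move=> /flatten_mapP[h]; rewrite mem_index_iota => /= hL; exact: fJ.
have bs (g : param_index -> R) : \sum_(p <- s) g p = \sum_(h < nL1) \sum_(p <- feeds L.+1 h) g p.
  by rewrite big_flatten big_map big_mkord.
have cE (h : 'I_nL1) p : p \in feeds L.+1 h -> c p = \sum_al la al h * feed_coef L al om p.
  by move=> pf; apply: eq_bigr => al _; rewrite (mem_feeds pf).2 /lext valK.
have V : \sum_(p <- s) c p ^+ 2 * param_var p = mxdot la (emp_cov L om *m la).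
  rewrite bs /mxdot exchange_big /=; apply: eq_bigr => h _.
  under [LHS]eq_big_seq => p pf do rewrite (cE h p pf) expr2 mulr_suml mulr_suml.
  rewrite exchange_big /=; apply: eq_bigr => al _; rewrite mxE mulr_sumr.
  under eq_bigr do rewrite mulr_sumr mulr_suml.
  rewrite exchange_big /=; apply: eq_bigr => be _.
  rewrite -(feed_cov L al be h om) !mulr_suml mulr_sumr; apply: eq_bigr => p _; ring.
have H := integral_lin_exp measurable_param indX law_param param_var_ge0 c 0 us sJ.
rewrite -V -[X in expR X]add0r.
rewrite -H; apply: eq_integral => om' _; congr (expR _)%:E.
rewrite add0r bs exchange_big /=; apply: eq_bigr => h _.
under [RHS]eq_big_seq => p pf do rewrite (cE h p pf) mulr_suml.
rewrite exchange_big /=; apply: eq_bigr => al _.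
by rewrite frozen_preact_lin mulr_sumr; apply: eq_bigr => p _; rewrite mulrA.
Qed.

End measurability.
End network.

(** * Large deviations from Laplace transforms *)

Section deviations.
Context {R : realType}.

(** On the scale 1 / a n a fixed factor costs an arbitrarily small [e], since exp(e / a n) tends to
    infinity. *)
Lemma mulr_expR_le (N : R) (c e : R) (a : nat -> R) : 0 < e -> 0 <= N ->
  (forall n, 0 < a n) -> a n @[n --> \oo] --> (0 : R) ->
  \forall n \near \oo, N * expR (c / a n) <= expR ((c + e) / a n).
Proof.
move=> e0 N0 a0 ca.
have eN : 0 < e / (N + 1) by rewrite divr_gt0//; lra.
move/cvgrPdist_lt : ca => /(_ _ eN); apply: filterS => n.
rewrite sub0r normrN gtr0_norm// ltr_pdivlMr; last by lra.
move=> h; rewrite mulrDl expRD mulrC ler_pM2l ?expR_gt0//.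
have := expR_ge1Dx (e / a n).
have : N <= e / a n by rewrite ler_pdivlMr//; have := a0 n; nra.
lra.
Qed.

Lemma lnE_le (r : R) (x : \bar R) : (x <= (expR r)%:E -> lnE x <= r%:E)%E.
Proof.
case: x => [x| |]//=; rewrite ?leNye// lee_fin => xr.
case: ifPn => [x0|_]; last by rewrite leNye.
by rewrite lee_fin -[leRHS]expRK ler_ln ?posrE ?expR_gt0.
Qed.

Lemma lnE_ge (r : R) (x : \bar R) : ((expR r)%:E <= x -> r%:E <= lnE x)%E.
Proof.
case: x => [x| |]//=; rewrite ?leey// lee_fin => xr.
have x0 : 0 < x by rewrite (lt_le_trans _ xr)// expR_gt0.
by rewrite x0 lee_fin -[leLHS]expRK ler_ln ?posrE ?expR_gt0.
Qed.

Lemma limn_esup_le_near (u : (\bar R)^nat) (l : \bar R) :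
  (\forall n \near \oo, (u n <= l)%E) -> (limn_esup u <= l)%E.
Proof.
move=> [N _ h]; rewrite limn_esup_lim; apply: lime_le.
  exact: is_cvg_esups.
exists N => // n /= Nn; apply: ge_ereal_sup => _ [k /= nk <-].
by apply: h => /=; exact: leq_trans nk.
Qed.

Lemma limn_einf_ge_near (u : (\bar R)^nat) (l : \bar R) :
  (\forall n \near \oo, (l <= u n)%E) -> (l <= limn_einf u)%E.
Proof.
move=> h; rewrite /limn_einf leeNr; apply: limn_esup_le_near.
by apply: filterS h => n; rewrite leeN2.
Qed.

End deviations.

Section measurability.
Context {R : realType} {d} {T : measurableType d} (m p : nat).

(** Only the entries are known to be measurable. An open set is a countable union of entrywise balls
    with rational centres and radii 1 / (k + 1), and each ball is a finite intersection of
    conditions on entries. *)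
Lemma measurable_preimage_open (f : T -> 'M[R]_(m, p)) (O : set 'M[R]_(m, p)) :
  (forall i j, measurable_fun setT (fun w => f w i j)) -> open O ->
  measurable (f @^-1` O).
Proof.
move=> mf oO.
pose C (q : 'M[rat]_(m, p)) : 'M[R]_(m, p) := map_mx ratr q.
pose B (n : nat) : set 'M[R]_(m, p) :=
  if @unpickle ('M[rat]_(m, p) * nat)%type n is Some (q, k)
  then [set y | ball (C q) k.+1%:R^-1 y /\ ball (C q) k.+1%:R^-1 `<=` O] else set0.
have OB : O = \bigcup_n B n.
  apply/seteqP; split => [z Oz|z [n _]]; last first.
    by rewrite /B; case: unpickle => [[q k] /= [h]|//]; apply.
  have /nbhs_ballP[e /= e0 eO] := open_nbhs_nbhs (conj oO Oz).
  (* Since 2 / (k + 1) < e, a ball of radius 1 / (k + 1) containing [z] lies in the [e]-ball around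
     [z]. *)
  pose k := Num.truncn (2 / e).
  have k0 : 0 < k.+1%:R^-1 :> R by rewrite invr_gt0.
  have ke : k.+1%:R^-1 * 2 < e.
    rewrite mulrC ltr_pdivrMr// -ltr_pdivrMl// mulrC.
    exact: truncnS_gt.
  have hq (ij : 'I_m * 'I_p) : exists q : rat, `|ratr q - z ij.1 ij.2| < k.+1%:R^-1.
    have zz : z ij.1 ij.2 - k.+1%:R^-1 < z ij.1 ij.2 + k.+1%:R^-1.
      by rewrite ltrD2l (lt_trans _ k0)// oppr_lt0.
    have [q] := rat_in_itvoo zz.
    by rewrite in_itv /= => h; exists q; rewrite ltr_distl.
  have [q qz] := choice hq.
  pose Q := \matrix_(i, j) q (i, j).
  have bQ : ball (C Q) k.+1%:R^-1 z.
    by apply/mx_ball_entries; split => // i j; rewrite !mxE; exact: (qz (i, j)).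
  exists (pickle (Q, k)) => //; rewrite /B pickleK; split => //.
  move=> y By; apply: eO; apply: (@le_ball _ _ _ (k.+1%:R^-1 + k.+1%:R^-1)).
    by move: ke; rewrite mulr_natr mulr2n; exact: ltW.
  exact: ball_triangle (ball_sym bQ) By.
rewrite OB preimage_bigcup; apply: bigcupT_measurable => n.
rewrite /B; case: unpickle => [[q k]|]; last by rewrite preimage_set0.
have [sub|nsub] := pselect (ball (C q) k.+1%:R^-1 `<=` O); last first.
  rewrite (_ : _ @^-1` _ = set0)//; apply/seteqP; split => // w /= [_] //.
rewrite (_ : _ @^-1` _ = \bigcap_(ij in [set: 'I_m * 'I_p])
    ((fun w => f w ij.1 ij.2) @^-1` ball (C q ij.1 ij.2) k.+1%:R^-1)).
  apply: fin_bigcap_measurable; first exact: finite_finset.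
  move=> [i j] _; rewrite -[X in measurable X]setTI; apply: mf => //.
  exact: measurable_ball.
apply/seteqP; split => w /=.
  by move=> [/mx_ball_entries[_ h] _] [i j] _; exact: h.
move=> h; split => //; apply/mx_ball_entries; split => [|i j].
  by rewrite invr_gt0.
exact: (h (i, j)).
Qed.

Lemma measurable_mxdot (f : T -> 'M[R]_(m, p)) (la : 'M[R]_(m, p)) :
  (forall i j, measurable_fun setT (fun w => f w i j)) ->
  measurable_fun setT (fun w => mxdot la (f w)).
Proof.
move=> mf; apply: measurable_sum => i; apply: measurable_sum => j.
exact: measurable_funM.
Qed.

End measurability.

Lemma lee_of_reals (R : realType) (x y : \bar R) :
  (forall c : R, (c%:E < x)%E -> (c%:E <= y)%E) -> (x <= y)%E.
Proof.
case: x => [x| |] h; last exact: leNye.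
  apply/lee_subgt0Pr => e e0; rewrite -EFinB; apply: h.
  by rewrite lte_fin; lra.
by rewrite (_ : y = +oo%E)//; apply/eqyP => A _; apply: h; exact: ltry.
Qed.

Lemma chernoff (R : realType) d (T : measurableType d) (P : probability T R)
    (f : T -> R) : measurable_fun setT f ->
  (P [set w | 0 <= f w]%R <= \int[P]_w (expR (f w))%:E)%E.
Proof.
move=> mf; apply: prob_le_integral => [||w|w f0]; last first.
- by rewrite -[leLHS]expR0 ler_expR.
- exact: expR_ge0.
- exact: measurableT_comp.
rewrite -[X in measurable X]setTI (_ : [set w | _] = f @^-1` `[0, +oo[%classic).
  by apply: mf => //; exact: measurable_itv.
by apply/seteqP; split => w /=; rewrite in_itv/= andbT.
Qed.

Section exponential_bounds.
Context {R : realType} {d} {T : measurableType d} (P : probability T R).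
Variable a : nat -> R.
Hypotheses (a0 : forall n, 0 < a n) (ca : a n @[n --> \oo] --> (0 : R)).

(** Probability at most exp(-(c - o(1)) / a n); the slack [e] absorbs the number of sets in a finite
    union. *)
Definition exp_bound (A : nat -> set T) (c : R) := forall e : R, 0 < e ->
  \forall n \near \oo, (P (A n) <= (expR ((e - c) / a n))%:E)%E.

Lemma exp_bound_bigcup (I : eqType) (s : seq I) (A : I -> nat -> set T) c :
  (forall i n, measurable (A i n)) -> (forall i, exp_bound (A i) c) ->
  exp_bound (fun n => \bigcup_(i in [set i | i \in s]) A i n) c.
Proof.
move=> mA hA; elim: s => [|i s ih] e e0.
  apply: nearW => n; rewrite (_ : bigcup _ _ = set0).
    by rewrite measure0 lee_fin expR_ge0.
  by apply/seteqP; split => // w [].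
have e20 : 0 < e / 2 by rewrite divr_gt0.
have h3 := @mulr_expR_le R 2 (e / 2 - c) (e / 2) a e20 (ler0n _ _) a0 ca.
apply: filterS3 (hA i _ e20) (ih _ e20) h3 => n h1 h2 h3.
have mB : measurable (\bigcup_(i in [set i | i \in s]) A i n).
  by apply: fin_bigcup_measurable => // ; exact: finite_seq.
have -> : \bigcup_(i0 in [set i0 | i0 \in i :: s]) A i0 n =
    A i n `|` \bigcup_(i in [set i | i \in s]) A i n.
  apply/seteqP; split => w /=.
    move=> [j /=]; rewrite in_cons => /orP[/eqP ->|js] Aj; [by left|right].
    by exists j.
  move=> [Ai|[j /= js Aj]]; first by exists i => //=; rewrite mem_head.
  by exists j => //=; rewrite in_cons js orbT.
rewrite (le_trans (measureU2 _ _ _))// (le_trans (leeD h1 h2))//.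
rewrite -EFinD lee_fin (_ : e - c = e / 2 - c + e / 2); last by lra.
by rewrite (le_trans _ h3)//; lra.
Qed.

End exponential_bounds.

(** * Large deviation bounds from a quadratic Laplace exponent *)

Section quadratic_deviations.
Context {R : realType} {d} {T : measurableType d} (P : probability T R).
Context (m p : nat) (Y : nat -> T -> 'M[R]_(m, p)) (a : nat -> R) (G : 'M[R]_m).
Hypotheses (a0 : forall n, 0 < a n) (ca : a n @[n --> \oo] --> (0 : R)).
Hypothesis mY : forall n i j, measurable_fun setT (fun w => Y n w i j).
Hypotheses (Gt : G^T = G).
Implicit Types la : 'M[R]_(m, p).

Let Lam la := mxdot la (G *m la) / 2.
Let M n la : \bar R := (\int[P]_w (expR (mxdot la (Y n w) / a n))%:E)%E.

Hypothesis hM : forall la (e : R), 0 < e -> \forall n \near \oo,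
  ((expR ((Lam la - e) / a n))%:E <= M n la /\
   M n la <= (expR ((Lam la + e) / a n))%:E)%E.

Local Notation EB := (exp_bound P a).

Let mdot n la : measurable_fun setT (fun w => mxdot la (Y n w)).
Proof. by apply: measurable_mxdot => i j; exact: mY. Qed.

Let M_shift n la c :
  (\int[P]_w (expR ((mxdot la (Y n w) + c) / a n))%:E =
   (expR (c / a n))%:E * M n la)%E.
Proof.
rewrite /M -ge0_integralZl//.
- by apply: eq_integral => w _; rewrite -EFinM -expRD; congr (expR _)%:E; ring.
- apply/measurable_EFinP; apply: measurableT_comp => //.
  by apply: measurable_funM => //; exact: mdot.
Qed.

Let half la (c : R) : set 'M[R]_(m, p) := [set y | c <= mxdot la y - Lam la].

Let mhalf n la c : measurable (Y n @^-1` half la c).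
Proof.
rewrite (_ : _ @^-1` _ =
    (fun w => mxdot la (Y n w) - Lam la) @^-1` `[c, +oo[%classic).
  rewrite -[X in measurable X]setTI.
  by apply: measurable_funB; [exact: mdot|exact: measurable_cst|
    exact: measurableT|exact: measurable_itv].
by apply/seteqP; split => w /=; rewrite in_itv/= andbT.
Qed.

Let EB_half la c : EB (fun n => Y n @^-1` half la c) c.
Proof.
move=> e e0; apply: filterS (hM la e0) => n [_ h].
have -> : Y n @^-1` half la c =
    [set w | 0 <= (mxdot la (Y n w) + (- Lam la - c)) / a n].
  apply/seteqP; split => w /=; rewrite /half/= pmulr_lge0 ?invr_gt0//; lra.
apply: le_trans (chernoff _ _) _.
  by apply: measurable_funM => //; apply: measurable_funD => //; exact: mdot.
rewrite M_shift (le_trans (lee_wpmul2l _ h)) ?lee_fin ?expR_ge0//.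
by rewrite -expRD -mulrDl ler_expR ler_pM2r ?invr_gt0//; lra.
Qed.

(** The signed coordinate directions: their half-spaces give exponential tightness in the upper
    bound and detect the exit from a ball in the lower bound. *)
Let dirs : seq 'M[R]_(m, p) :=
  [seq delta_mx ij.1 ij.2 | ij : 'I_m * 'I_p] ++
  [seq - delta_mx ij.1 ij.2 | ij : 'I_m * 'I_p].

Let dirsP y r : (forall k, k \in dirs -> mxdot k y < r) ->
  forall i j, `|y i j| < r.
Proof.
move=> h i j; rewrite ltr_norml; apply/andP; split.
  rewrite ltrNl; have := h (- delta_mx i j).
  rewrite -scaleN1r mxdotZl mxdot_delta mulN1r; apply.
  rewrite mem_cat scaleN1r; apply/orP; right; apply/mapP.
  by exists (i, j); rewrite ?mem_enum.
have := h (delta_mx i j); rewrite mxdot_delta; apply.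
by rewrite mem_cat; apply/orP; left; apply/mapP; exists (i, j); rewrite ?mem_enum.
Qed.

Let Lam_ub : exists2 A, 0 < A & forall k, k \in dirs -> Lam k <= A.
Proof.
exists (1 + \sum_(k <- dirs) `|Lam k|).
  by rewrite ltr_pwDl// sumr_ge0.
move=> k kd; rewrite (big_rem k)//=.
have := ler_norm (Lam k).
have : 0 <= \sum_(y <- rem k dirs) `|Lam y| by exact: sumr_ge0.
lra.
Qed.

Let GE_upper (C : set 'M[R]_(m, p)) c : closed C ->
  (forall z, C z -> exists la, c < mxdot la z - Lam la) ->
  EB (fun n => Y n @^-1` C) c.
Proof.
move=> cC hC; have [A A0 hA] := Lam_ub.
(* Outside the box some [k] in [dirs] pairs to at least K >= c + Lam k, so its half-space already
   has exponential order [c]; inside, compactness extracts finitely many half-spaces covering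
   [C]. *)
pose K : R := `|c| + A.
have cCK : compact ([set y : 'M[R]_(m, p) | forall i j, `|y i j| <= K] `&` C).
  by apply: compact_closedI => //; exact: mx_box_compact.
pose f la : set 'M[R]_(m, p) := [set y | c < mxdot la y - Lam la].
have fo la : setT la -> open (f la).
  move=> _; rewrite (_ : f la = mxdot la @^-1` [set x | c + Lam la < x]).
    by apply: open_comp; [move=> y _; exact: continuous_mxdot|exact: open_gt].
  by apply/seteqP; split => y; rewrite /f /=; lra.
move: cCK; rewrite compact_cover => /(_ _ setT f fo)[].
  by move=> z [_ Cz]; have [la h] := hC z Cz; exists la.
move=> D' _ cov e e0.
have H : EB (fun n => \bigcup_(la in [set la | la \in finmap.enum_fset D' ++ dirs])
    (Y n @^-1` half la c)) c.
  exact: exp_bound_bigcup.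
apply: filterS (H e e0) => n.
apply: le_trans; apply: le_measure; rewrite ?inE.
- rewrite -[X in measurable X]setCK; apply: measurableC; rewrite preimage_setC.
  by apply: measurable_preimage_open; [exact: mY|exact: closed_openC].
- by apply: fin_bigcup_measurable => [|la _]; [exact: finite_seq|exact: mhalf].
move=> w /= Cw.
have [h|h] := pselect (forall k, k \in dirs -> mxdot k (Y n w) < K).
  have /cov[la /= laD hla] : ([set y : 'M[R]_(m, p) | forall i j, `|y i j| <= K] `&` C) (Y n w).
    by split => //= i j; apply: ltW; exact: dirsP.
  by exists la => /=; [rewrite mem_cat laD|exact: ltW].
move/existsNP : h => [k /not_implyP[kd /negP]]; rewrite -leNgt => hk.
exists k => /=; first by rewrite mem_cat kd orbT.
rewrite /half /=; have := hA k kd; have := ler_norm c; rewrite /K in hk; lra.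
Qed.

Let Lam_shift la k (mu : R) :
  Lam (la + mu *: k) = Lam la + mu * mxdot k (G *m la) + mu ^+ 2 * Lam k.
Proof.
rewrite /Lam mulmxDr -scalemxAr !(mxdotDr, mxdotDl, mxdotZl, mxdotZr).
rewrite (mxdot_mul G la k) Gt (mxdotC _ k).
by field.
Qed.

(** No tilted measure is introduced. If [Y] leaves the ball around [z] in a direction [k], the
    integrand of [M n la] is dominated by that of the tilt la + mu k times a small factor. As [z] is
    the gradient of [Lam] at [la], the gain mu r is of first order and the loss mu^2 Lam k of second
    order, so exits are negligible in [M n la] and the ball carries it. *)
Let GE_lower (O : set 'M[R]_(m, p)) la (kap : R) : open O -> O (G *m la) ->
  0 < kap -> \forall n \near \oo,
  ((expR ((- Lam la - kap) / a n))%:E <= P (Y n @^-1` O))%E.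
Proof.
move=> oO Oz kap0; set z := G *m la.
have [A A0 hA] := Lam_ub.
have /nbhs_ballP[r0 /= r00 r0O] := open_nbhs_nbhs (conj oO Oz).
pose nrm := \sum_i \sum_j `|la i j|.
have nrm0 : 0 <= nrm by do 2 (apply: sumr_ge0 => ? _).
(* The ball must lie in [O], and <la, y> may vary by at most kap / 4 on it. *)
pose r := Num.min r0 (kap / (4 * (nrm + 1))).
have r_gt0 : 0 < r by rewrite lt_min r00 divr_gt0// mulr_gt0//; lra.
have rO : ball z r `<=` O.
  by apply: subset_trans r0O; apply: le_ball; rewrite ge_min lexx.
have nr : nrm * r <= kap / 4.
  have : r <= kap / (4 * (nrm + 1)) by rewrite ge_min lexx orbT.
  rewrite ler_pdivlMr; last by lra.
  by nra.
(* [mu] minimizes mu^2 A - mu r, with minimum - r^2 / (4 A) = - 4 eta. One [eta] is spent on the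
   Laplace bound and one on the factor 2 N; what remains still exceeds [e']. *)
pose mu := r / (2 * A); have mu0 : 0 < mu by rewrite divr_gt0// mulr_gt0.
pose eta := r ^+ 2 / (16 * A).
have eta0 : 0 < eta by rewrite divr_gt0// ?exprn_gt0// mulr_gt0.
have mur : mu ^+ 2 * A - mu * r = - (4 * eta).
  by rewrite /mu /eta; field; rewrite gt_eqF.
pose e' := Num.min eta (kap / 4).
have e'0 : 0 < e' by rewrite lt_min eta0 divr_gt0.
have e'1 : e' <= eta by rewrite ge_min lexx.
have e'2 : e' <= kap / 4 by rewrite ge_min lexx orbT.
have k40 : 0 < kap / 4 by rewrite divr_gt0.
pose N : R := (size dirs)%:R.
have Hk : \forall n \near \oo, forall k, k \in dirs ->
    (M n (la + mu *: k) <= (expR ((Lam (la + mu *: k) + eta) / a n))%:E)%E.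
  have Hs : \forall n \near \oo, forall k : seq_sub dirs, (M n (la + mu *: val k) <=
      (expR ((Lam (la + mu *: val k) + eta) / a n))%:E)%E.
    by apply: filter_forall => k; apply: filterS (hM (la + mu *: val k) eta0) => n [].
  by apply: filterS Hs => n h k kd; exact: (h (SeqSub kd)).
have H1 := @mulr_expR_le R (2 * N) (Lam la - 3 * eta) eta a eta0
  (mulr_ge0 (ler0n _ _) (ler0n _ _)) a0 ca.
have H2 := @mulr_expR_le R 2 (Lam la - kap / 2) (kap / 4) a k40 (ler0n _ _) a0 ca.
apply: filterS3 (filterI Hk (hM la e'0)) H1 H2 => n [hk [hla _]] h1 h2.
have an0 := a0 n.
have mB : measurable (Y n @^-1` ball z r).
  by apply: measurable_preimage_open; [exact: mY|exact: ball_open].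
have PBO : (P (Y n @^-1` ball z r) <= P (Y n @^-1` O))%E.
  apply: le_measure; rewrite ?inE//; last by move=> w; exact: rO.
  by apply: measurable_preimage_open; [exact: mY|].
apply: le_trans PBO.
pose x := expR ((mxdot la z + nrm * r) / a n).
have Mle : (M n la <= x%:E * P (Y n @^-1` ball z r) +
    \sum_(k <- dirs) (expR ((- mu * (mxdot k z + r)) / a n))%:E * M n (la + mu *: k))%E.
  have mfk k : measurable_fun setT (fun w =>
    (expR ((mxdot (la + mu *: k) (Y n w) - mu * (mxdot k z + r)) / a n))%:E).
    apply/measurable_EFinP; apply: measurableT_comp => //.
    by apply: measurable_funM => //; apply: measurable_funB => //; exact: mdot.
  have mfB : measurable_fun setT (fun w => (x * \1_(Y n @^-1` ball z r) w)%:E).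
    by apply/measurable_EFinP; apply: measurable_funM => //; exact: measurable_indic.
  have -> : (x%:E * P (Y n @^-1` ball z r) =
      \int[P]_w (x * \1_(Y n @^-1` ball z r) w)%:E)%E.
    under eq_integral do rewrite EFinM.
    rewrite ge0_integralZl//.
    - by rewrite integral_indic// setIT.
    - by apply/measurable_EFinP; exact: measurable_indic.
    - by rewrite lee_fin expR_ge0.
  under eq_bigr do rewrite mulNr -M_shift.
  rewrite -ge0_integral_sum//.
  rewrite -ge0_integralD//; last 3 first.
  - by move=> w _; rewrite lee_fin mulr_ge0// expR_ge0.
  - by move=> w _; apply: sume_ge0 => k _; rewrite lee_fin expR_ge0.
  - by apply: emeasurable_sum.
  apply: ge0_le_integral => //.
  - apply/measurable_EFinP; apply: measurableT_comp => //.
    by apply: measurable_funM => //; exact: mdot.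
  - by apply: emeasurable_funD => //; exact: emeasurable_sum.
  move=> w _; rewrite sumEFin -EFinD lee_fin.
  have [h|h] := pselect (forall k, k \in dirs -> mxdot k (Y n w - z) < r).
    have yz := dirsP h.
    rewrite ler_wpDr//; first by apply: sumr_ge0 => k _; exact: expR_ge0.
    rewrite indicE mem_set; last first.
      by apply/mx_ball_entries; split => // i j; have := yz i j; rewrite !mxE distrC.
    rewrite mulr1 ler_expR ler_pM2r ?invr_gt0//.
    rewrite -[X in mxdot _ X](subrK z) mxdotDr addrC lerD2l /nrm mulr_suml.
    apply: ler_sum => i _; rewrite mulr_suml; apply: ler_sum => j _.
    by rewrite (le_trans (ler_norm _))// normrM ler_wpM2l// ltW.
  move/existsNP : h => [k /not_implyP[kd /negP]]; rewrite -leNgt mxdotBr => hk'.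
  rewrite ler_wpDl ?mulr_ge0 ?expR_ge0//.
  rewrite (big_rem k)//= ler_wpDr//; first by apply: sumr_ge0 => ? _; exact: expR_ge0.
  rewrite ler_expR ler_pM2r ?invr_gt0// mxdotDl mxdotZl.
  by nra.
have sumle : (\sum_(k <- dirs)
    (expR ((- mu * (mxdot k z + r)) / a n))%:E * M n (la + mu *: k) <=
    (N * expR ((Lam la - 3 * eta) / a n))%:E)%E.
  have -> : N * expR ((Lam la - 3 * eta) / a n) =
      \sum_(k <- dirs) expR ((Lam la - 3 * eta) / a n).
    by rewrite big_const_seq count_predT iter_addr addr0 /N mulr_natl.
  rewrite -sumEFin big_seq [leRHS]big_seq; apply: lee_sum => k kd.
  rewrite (le_trans (lee_wpmul2l _ (hk k kd))) ?lee_fin ?expR_ge0//.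
  rewrite -expRD -mulrDl ler_expR ler_pM2r ?invr_gt0// Lam_shift -/z.
  by have := hA k kd; have := sqr_ge0 mu; nra.
have PBf : P (Y n @^-1` ball z r) \is a fin_num by exact: fin_num_measure.
move: hla => /le_trans/(_ Mle)/le_trans/(_ (leeD2l _ sumle)).
rewrite -(fineK PBf) -EFinM -EFinD !lee_fin.
set b := fine _; have b0 : 0 <= b by exact: fine_ge0.
move=> hb.
(* The exits take at most half of the lower bound on [M n la]; the other half is at least exp((Lam
   la - kap / 2) / a n). *)
have hb2 : expR ((Lam la - kap / 2) / a n) <= x * b.
  have t1 : expR ((Lam la - 3 * eta + eta) / a n) <= expR ((Lam la - e') / a n).
    by rewrite ler_expR ler_pM2r ?invr_gt0//; lra.
  have t2 : expR ((Lam la - kap / 2 + kap / 4) / a n) <= expR ((Lam la - e') / a n).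
    by rewrite ler_expR ler_pM2r ?invr_gt0//; lra.
  lra.
have x0 : 0 < x by exact: expR_gt0.
rewrite -(ler_pM2l x0) (le_trans _ hb2)// /x -expRD -mulrDl ler_expR.
rewrite ler_pM2r ?invr_gt0//.
(* Euler's identity for the quadratic form turns Lam la - <la, z> into - Lam la, minus the rate at
   [z]. *)
have : mxdot la z = 2 * Lam la by rewrite /Lam -/z; lra.
lra.
Qed.

Theorem quadratic_LDP : (msqrt G)^T = msqrt G -> msqrt G *m msqrt G = G ->
  LDP P Y (fun n => (a n)^-1) (@rateI R m p G).
Proof.
move=> St SS; split => [C cC|O oO].
- rewrite leeNr; apply: lee_of_reals => c hc.
  rewrite leeNr; apply/lee_addgt0Pr => e e0.
  have H : EB (fun n => Y n @^-1` C) c.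
    apply: GE_upper => // z Cz; apply: rateI_dual => //.
    by apply: (lt_le_trans hc); apply: ereal_inf_lbound; exists z.
  apply: limn_esup_le_near; apply: filterS (H e e0) => n /lnE_le h.
  rewrite invrK; apply: (le_trans (lee_wpmul2l _ h)); first by rewrite lee_fin ltW.
  by rewrite -EFinM lee_fin mulrC divfK ?gt_eqF// addrC.
- rewrite leeNl; apply: le_ereal_inf_tmp => _ [z Oz <-].
  have [[la zla]|[/rateI_out -> _]] := rate_trichotomy St SS z; last by rewrite leey.
  rewrite zla rateI_range// leeNl; apply/lee_subgt0Pr => e e0.
  apply: limn_einf_ge_near; rewrite zla in Oz.
  apply: filterS (GE_lower oO Oz e0) => n /lnE_ge h.
  rewrite invrK; apply: (le_trans _ (lee_wpmul2l _ h)); last by rewrite lee_fin ltW.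
  by rewrite -EFinM lee_fin (mulrC (a n)) divfK ?gt_eqF.
Qed.

End quadratic_deviations.

(** * Laplace asymptotics under superexponential concentration *)

Section laplace.
Context {R : realType} {d} {T : measurableType d} (P : probability T R).
Variables (a : nat -> R) (Q : nat -> T -> R) (q C : R).
Hypotheses (a0 : forall n, 0 < a n) (ca : a n @[n --> \oo] --> (0 : R)).
Hypothesis mQ : forall n, measurable_fun setT (Q n).
Hypothesis QC : forall n w, `|Q n w| <= C.
Hypothesis conc : forall del K : R, 0 < del -> \forall n \near \oo,
  (P [set w | (del < `|Q n w - q|)%R] <= (expR (- K / a n))%:E)%E.

Let E n (del : R) := [set w | del < `|Q n w - q|].

Let mE n del : measurable (E n del).
Proof. exact: measurable_dist_gt. Qed.

Let int_ind n del (c : R) : 0 <= c ->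
  (\int[P]_w (c * \1_(E n del) w)%:E = c%:E * P (E n del))%E.
Proof.
move=> c0; under eq_integral do rewrite EFinM.
have mi : measurable_fun [set: T] (fun w => ((\1_(E n del) w)%:E : \bar R)).
  by apply/measurable_EFinP; exact: measurable_indic.
rewrite ge0_integralZl//.
by rewrite integral_indic// setIT.
Qed.

Let mexp n : measurable_fun setT (fun w => expR (Q n w / a n)).
Proof. by apply: measurableT_comp => //; exact: measurable_funM. Qed.

Lemma laplace_concentrated (e : R) : 0 < e -> \forall n \near \oo,
  ((expR ((q - e) / a n))%:E <= \int[P]_w (expR (Q n w / a n))%:E /\
   \int[P]_w (expR (Q n w / a n))%:E <= (expR ((q + e) / a n))%:E)%E.
Proof.
move=> e0; have e2 : 0 < e / 2 by rewrite divr_gt0.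
have two : 0 <= 2 :> R by [].
have N1 := mulr_expR_le (q + e / 2) e2 two a0 ca.
have N2 := mulr_expR_le (q - e) e2 two a0 ca.
have N3 := mulr_expR_le (- 1) (ltr01 : (0 : R) < 1) two a0 ca.
(* Concentration is used at two rates: K = C - q compensates the largest value exp(C / a n) on the
   bad event, for the upper bound; K = 1 gives that event probability at most 1/2, enough for the
   lower bound. *)
apply: filterS3 (filterI (conc (C - q) e2) (conc 1 e2)) (filterI N1 N2) N3.
move=> n [c1 c2] [n1 n2] n3; have an := a0 n.
have sc (x y : R) : x <= y -> x / a n <= y / a n.
  by move=> xy; rewrite ler_wpM2r// invr_ge0 ltW.
have out w : ~ E n (e / 2) w -> q - e / 2 <= Q n w <= q + e / 2.
  by move=> /negP; rewrite -leNgt ler_norml => /andP[? ?]; lra.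
have dich w : \1_(E n (e / 2)) w = 1 :> R \/
    (\1_(E n (e / 2)) w = 0 :> R /\ q - e / 2 <= Q n w <= q + e / 2).
  rewrite indicE; have [h|h] := pselect (E n (e / 2) w).
    by left; rewrite mem_set.
  by right; split; [rewrite memNset|exact: out].
have Cw w : Q n w <= C by rewrite (le_trans (ler_norm _)).
split.
  pose x := expR ((q - e / 2) / a n).
  have x0 : 0 <= x by exact: expR_ge0.
  have H : (x%:E <= \int[P]_w (expR (Q n w / a n))%:E + x%:E * P (E n (e / 2)))%E.
    have mi : measurable_fun setT (fun w => x * \1_(E n (e / 2)) w).
      by apply: measurable_funM => //; exact: measurable_indic.
    rewrite -int_ind// -ge0_integralD//; last 3 first.
    - by apply/measurable_EFinP; exact: mexp.
    - by move=> w _; rewrite lee_fin mulr_ge0// indicE.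
    - exact/measurable_EFinP.
    rewrite -(integral_prob_cst P x); apply: ge0_le_integral => //.
    - by apply: emeasurable_funD; apply/measurable_EFinP.
    move=> w _; rewrite -EFinD lee_fin.
    have := expR_ge0 (Q n w / a n).
    have [->|[-> /andP[h _]]] := dich w; first by lra.
    rewrite mulr0 addr0 => _.
    by rewrite ler_expR sc.
  have Hp : (x%:E * P (E n (e / 2)) <= (x / 2)%:E)%E.
    rewrite EFinM lee_pmul ?lee_fin ?lexx// (le_trans c2)// lee_fin.
    by move: n3; rewrite addNr mul0r expR0; lra.
  have H2 := le_trans H (leeD2l _ Hp).
  have : ((x / 2)%:E <= \int[P]_w (expR (Q n w / a n))%:E)%E.
    move: H2; case: (\int[P]_w _)%E => [r| |]; last 2 first.
    - by move=> _; rewrite leey.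
    - by rewrite addNye leeNy_eq.
    by rewrite -EFinD !lee_fin; lra.
  apply: le_trans; rewrite lee_fin.
  move: n2; rewrite (_ : q - e + e / 2 = q - e / 2); last by lra.
  by rewrite -/x; lra.
pose x := expR ((q + e / 2) / a n); pose y := expR (C / a n).
have y0 : 0 <= y by exact: expR_ge0.
have mi : measurable_fun setT (fun w => y * \1_(E n (e / 2)) w).
  by apply: measurable_funM => //; exact: measurable_indic.
apply: (@le_trans _ _ (\int[P]_w (x%:E + (y * \1_(E n (e / 2)) w)%:E))%E).
  apply: ge0_le_integral => //.
  - by apply/measurable_EFinP; exact: mexp.
  - by apply: emeasurable_funD => //; apply/measurable_EFinP.
  move=> w _; rewrite -EFinD lee_fin.
  have x0 : 0 <= x by exact: expR_ge0.
  have [->|[-> /andP[_ h]]] := dich w.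
    by rewrite mulr1 (@le_trans _ _ y) ?lerDr// ler_expR sc.
  by rewrite mulr0 addr0 ler_expR sc.
rewrite ge0_integralD//; last 3 first.
- by move=> w _; rewrite lee_fin expR_ge0.
- by move=> w _; rewrite lee_fin mulr_ge0// indicE.
- exact/measurable_EFinP.
rewrite integral_prob_cst int_ind//.
have Hp : (y%:E * P (E n (e / 2)) <= (expR (q / a n))%:E)%E.
  apply: (@le_trans _ _ (y%:E * (expR (- (C - q) / a n))%:E)%E).
    by rewrite lee_pmul ?lee_fin ?lexx.
  by rewrite -EFinM lee_fin -expRD -mulrDl opprB addrC subrK.
apply: le_trans (leeD2l _ Hp) _.
have -> : q + e = q + e / 2 + e / 2 by lra.
rewrite -EFinD lee_fin; apply: le_trans n1.
have : expR (q / a n) <= x by rewrite ler_expR sc//; lra.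
by rewrite -/x; lra.
Qed.

End laplace.

(** * Concentration of the conditional covariances *)

Section exp_bounds.
Context {R : realType} {d} {T : measurableType d} (P : probability T R).
Variable a : nat -> R.
Hypotheses (a0 : forall n, 0 < a n) (ca : a n @[n --> \oo] --> (0 : R)).

Lemma exp_bound_le (A : nat -> set T) (c : R) : exp_bound P a A (c + 1) ->
  \forall n \near \oo, (P (A n) <= (expR (- c / a n))%:E)%E.
Proof. by move/(_ 1 ltr01); rewrite opprD addrCA subrr addr0. Qed.

Lemma exp_boundU (A B : nat -> set T) (c : R) :
  (forall n, measurable (A n)) -> (forall n, measurable (B n)) ->
  exp_bound P a A c -> exp_bound P a B c -> exp_bound P a (fun n => A n `|` B n) c.
Proof.
move=> mA mB hA hB e e0.
have H : exp_bound P a (fun n => \bigcup_(i in [set i | i \in [:: true; false]])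
    (if i then A n else B n)) c.
  by apply: exp_bound_bigcup => // -[].
apply: filterS (H e e0) => n; apply: le_trans; apply: le_measure; rewrite ?inE//.
- exact: measurableU.
- by apply: fin_bigcup_measurable => [|[]//]; exact: finite_seq.
by move=> w [Aw|Bw]; [exists true|exists false].
Qed.

Lemma exp_bound_sub (A B : nat -> set T) (c : R) :
  (forall n, measurable (A n)) -> (forall n, measurable (B n)) ->
  (forall n, A n `<=` B n) -> exp_bound P a B c -> exp_bound P a A c.
Proof.
move=> mA mB AB hB e e0; apply: filterS (hB e e0) => n.
by apply: le_trans; apply: le_measure; rewrite ?inE.
Qed.

End exp_bounds.

(** With [B] above M^2, 1 and [del], th = del / (8 B^2) makes the quadratic remainder at most th del
    / 4; the bias th e takes another quarter of th del, and [c] is a quarter. *)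
Lemma chernoff_constants (R : realType) (del M : R) : 0 < del ->
  exists th e c : R, [/\ 0 < th, 0 < e, 0 < c, th * (M * M) <= 1 / 2 &
    c <= th * del - th * e - 2 * (th * (M * M)) ^+ 2].
Proof.
move=> d0; pose B := M * M + 1 + del.
have MM : 0 <= M * M by rewrite -expr2 sqr_ge0.
have B0 : 0 < B by rewrite /B; lra.
pose th := del / (8 * B ^+ 2).
have th0 : 0 < th by rewrite divr_gt0// mulr_gt0// exprn_gt0.
have thB : th * B ^+ 2 = del / 8 by rewrite /th invfM; field; rewrite gt_eqF.
exists th, (del / 4), (th * del / 4); split => //.
- by rewrite divr_gt0.
- by apply: divr_gt0 => //; exact: mulr_gt0.
  have : th * B <= 1 / 8.
    have : th * B * B <= 1 / 8 * B by rewrite -mulrA -expr2 thB /B; lra.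
    by rewrite ler_pM2r.
  have : th * (M * M) <= th * B by rewrite ler_pM2l// /B; lra.
  lra.
have : th * (th * (M * M) ^+ 2) <= th * (del / 8).
  rewrite ler_pM2l// -thB ler_pM2l// ler_sqr ?nnegrE ?(ltW B0)// /B; lra.
rewrite exprMn expr2 -mulrA; nra.
Qed.

Lemma width_hidden n0 nL1 L w k : (0 < k <= L)%N -> width n0 nL1 L w k = w k.
Proof. by case: k => [|k]//= kL; rewrite /width /= eqSS ltn_eqF. Qed.

Lemma psd_gram (R : realType) m p (A : 'M[R]_(m, p)) : psd_mx (A *m A^T).
Proof.
split=> [|v]; first by rewrite trmx_mul trmxK.
rewrite mulmxA -mulmxA -trmx_mul mxE; apply: sumr_ge0 => j _.
by rewrite [_^T _ _]mxE -expr2 sqr_ge0.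
Qed.

Lemma psdD (R : realType) m (A B : 'M[R]_m) : psd_mx A -> psd_mx B -> psd_mx (A + B).
Proof.
move=> [At A0] [Bt B0]; split=> [|v]; first by rewrite linearD /= At Bt.
by rewrite mulmxDr mulmxDl mxE addr_ge0.
Qed.

Lemma psdZ (R : realType) m c (A : 'M[R]_m) : 0 <= c -> psd_mx A -> psd_mx (c *: A).
Proof.
move=> c0 [At A0]; split=> [|v]; first by rewrite linearZ /= At.
by rewrite -scalemxAr -scalemxAl mxE mulr_ge0.
Qed.

Lemma mxdot_mul_bound (R : realType) m p (la : 'M[R]_(m, p)) : exists2 S : R, 0 < S &
  forall (A : 'M[R]_m) r, 0 <= r -> (forall i j, `|A i j| <= r) ->
    `|mxdot la (A *m la)| <= S * r.
Proof.
pose S := \sum_i \sum_h \sum_j `|la i h| * `|la j h|.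
have S0 : 0 <= S by do 3 (apply: sumr_ge0 => ? _); rewrite mulr_ge0.
exists (S + 1); first by lra.
move=> A r r0 Ar; apply: (@le_trans _ _ (S * r)); last by rewrite ler_wpM2r//; lra.
rewrite mulr_suml (le_trans (ler_norm_sum _ _ _))//; apply: ler_sum => i _.
rewrite mulr_suml (le_trans (ler_norm_sum _ _ _))//; apply: ler_sum => h _.
rewrite mxE mulr_sumr mulr_suml (le_trans (ler_norm_sum _ _ _))//; apply: ler_sum => j _.
by rewrite !normrM -mulrA ler_wpM2l// mulrC ler_wpM2l.
Qed.

Lemma activation_bounded (R : realType) d (T : measurableType d) L n0 nL1 (sigma : R -> R) w m
    (xs : 'I_m -> nat -> R) (W : nat -> nat -> nat -> T -> R)
    (b : nat -> nat -> T -> R) k al j om (M : R) :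
  (forall t, `|sigma t| <= M) -> (0 < k)%N ->
  `|activation L n0 nL1 sigma w xs W b k al j om| <= M.
Proof. by move=> h; case: k => // k _; exact: h. Qed.

Section concentration.
Context {R : realType} {d : measure_display} {T : measurableType d}.
Variables (P : probability T R) (L n0 nL1 : nat) (Cb CW : R) (sigma : R -> R).
Variables (w : nat -> nat -> nat) (m : nat) (xs : 'I_m -> nat -> R).
Variables (W : nat -> nat -> nat -> nat -> T -> R) (b : nat -> nat -> nat -> T -> R).
Variables (a : nat -> R) (M : R).
Hypotheses (Cb0 : 0 <= Cb) (CW0 : 0 < CW).
Hypothesis w0 : forall n l, (1 <= l <= L)%N -> (0 < w n l)%N.
Hypothesis hW : forall n l i j, param_set n0 nL1 L (w n) (inl (l, i, j)) ->
  measurable_fun setT (W n l i j) /\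
  has_law P (W n l i j) (gauss_law (CW / (width n0 nL1 L (w n) l.-1)%:R)).
Hypothesis hb : forall n l i, param_set n0 nL1 L (w n) (inr (l, i)) ->
  measurable_fun setT (b n l i) /\ has_law P (b n l i) (gauss_law Cb).
Hypothesis indX : forall n,
  mutually_independent P (params (W n) (b n)) (param_set n0 nL1 L (w n)).
Hypothesis csigma : continuous sigma.
Hypothesis sM : forall t, `|sigma t| <= M.
Hypotheses (a0 : forall n, 0 < a n) (ca : a n @[n --> \oo] --> (0 : R)).
Hypothesis growth : forall l (K : R), (1 <= l <= L)%N ->
  \forall n \near \oo, K / a n <= (w n l)%:R.

Local Notation g := (ghat sigma Cb CW n0 xs).
Local Notation cov n := (emp_cov L n0 nL1 Cb CW sigma (w n) xs (W n) (b n)).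

Lemma ghat_psd l : psd_mx (g l).
Proof.
have psd1 : psd_mx (const_mx 1 : 'M[R]_m).
  rewrite (_ : const_mx 1 = (const_mx 1 : 'M[R]_(m, 1)) *m (const_mx 1)^T).
    exact: psd_gram.
  by apply/matrixP => i j; rewrite !mxE big_ord_recl big_ord0 !mxE mulr1 addr0.
case: l => [|l] /=; last first.
  apply: psdD; first exact: psdZ.
  by apply: psdZ; [exact: ltW|exact: ymx_psd csigma sM].
rewrite (_ : \matrix_(_, _) _ = Cb *: const_mx 1 + (CW / n0%:R) *:
    ((\matrix_(i < m, r < n0) xs i r) *m (\matrix_(i < m, r < n0) xs i r)^T)).
  apply: psdD; first exact: psdZ.
  by apply: psdZ; [rewrite divr_ge0// ltW|exact: psd_gram].
apply/matrixP => i j; rewrite !mxE mulr1; congr (_ + _ * _).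
by apply: eq_bigr => r _; rewrite !mxE.
Qed.

Let mcov n k al be : (k <= L)%N -> measurable_fun setT (fun om => cov n k om al be).
Proof.
move=> kL; apply: (sigma_of_measurableT (measurable_param (@hW n) (@hb n))
  (subset_refl (A := param_set n0 nL1 L (w n)))).
exact: measurable_emp_cov.
Qed.

Let far n k al be (del : R) : set T := [set om | del < `|cov n k om al be - g k al be|].

Let mfar n k al be del : (k <= L)%N -> measurable (far n k al be del).
Proof. by move=> kL; apply: measurable_dist_gt; exact: mcov. Qed.

(** Any [c] is allowed because the Chernoff exponent is a constant times the width, which [growth]
    puts above every multiple of 1 / a n. In the induction either an entry of the covariance one
    layer below is off ([U]), or the layer average deviates although the layer below is good
    ([V]). *)
Lemma emp_cov_concentration k al be (del c : R) : (k <= L)%N -> 0 < del ->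
  exp_bound P a (fun n => [set om | del < `|cov n k om al be - g k al be|]) c.
Proof.
elim: k al be del c => [|k ih] al be del c kL del0.
  (* The inputs are deterministic: at layer 0 the empirical covariance is exactly [ghat] at 0. *)
  move=> e e0; apply: nearW => n; rewrite (_ : [set _ | _] = set0).
    by rewrite measure0 lee_fin expR_ge0.
  by apply/seteqP; split => // om /=; rewrite !mxE subrr normr0 ltNge ltW.
(* The tolerance is del / CW because the covariance error is CW times the deviation of the layer
   average. *)
have [th [e [c0 [th0 e0 c00 thM hc]]]] := chernoff_constants M (divr_gt0 del0 CW0).
pose q := g k; pose y := ymx sigma q al be.
have [r r0 hr] := gaussian_functional_continuous (q al al) (q al be) (q be be) csigma sM e0.
(* This event involves only the layers up to [k]; on it, continuity in the covariance gives the
   conditional mean up to [e]. *)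
pose D n := [set om | forall i j, `|cov n k om i j - q i j| <= r].
pose U n := \bigcup_(p in [set p | p \in enum {: 'I_m * 'I_m}]) far n k p.1 p.2 r.
have kL' : (k <= L)%N by exact: ltnW.
have DU n om : ~ U n om -> D n om.
  move=> nU i j; rewrite leNgt; apply/negP => h; apply: nU.
  by exists (i, j) => //=; rewrite mem_enum.
have mU n : measurable (U n).
  by apply: fin_bigcup_measurable => [|p _]; [exact: finite_seq|exact: mfar].
have bU c' : exp_bound P a U c'.
  apply: exp_bound_bigcup => // [p n|p]; first exact: mfar.
  exact: ih.
have wk n : (0 < width n0 nL1 L (w n) k.+1)%N by rewrite width_hidden// w0.
have mD n J : (forall p, param_set n0 nL1 L (w n) p -> (layer p <= k)%N -> J p) ->
    @measurable _ (sigma_of (params (W n) (b n)) J) (D n).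
  move=> hJ; rewrite (_ : D n = \bigcap_(p in [set: 'I_m * 'I_m])
      (fun om => cov n k om p.1 p.2) @^-1` `[q p.1 p.2 - r, q p.1 p.2 + r]); last first.
    apply/seteqP; split => om /=.
      by move=> h p _ /=; rewrite in_itv /= -ler_distlC distrC.
    by move=> h i j; have := h (i, j) I; rewrite /= in_itv /= -ler_distlC distrC.
  apply: (@fin_bigcap_measurable _ (sigma_of (params (W n) (b n)) J)).
    exact: finite_finset.
  move=> p _; rewrite -[X in measurable X]setTI.
  have h := measurable_emp_cov Cb CW xs csigma p.1 p.2 kL' hJ (b := b n) (nL1 := nL1) (n0 := n0).
  exact: h.
have De n om i : D n om -> (i < width n0 nL1 L (w n) k.+1)%N ->
    `|\int[P]_om' (sigma (frozen_preact L n0 nL1 sigma (w n) xs (W n) (b n) k al i om om') *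
       sigma (frozen_preact L n0 nL1 sigma (w n) xs (W n) (b n) k be i om om')) - y| <= e.
  move=> Dom iw.
  have G1 := msqrt_functional al be (ghat_psd k).
  have G2 := frozen_functional sigma xs Cb0 CW0 (@hW n) (@hb n) (@indX n) al be om kL' iw.
  have := hr _ _ _ _ _ G1 G2 (Dom al al) (Dom al be) (Dom be be).
  by rewrite /y mxE.
pose V n := D n `&` [set om | del / CW < `|(width n0 nL1 L (w n) k.+1)%:R^-1 *
   (\sum_(j < width n0 nL1 L (w n) k.+1)
     (activation L n0 nL1 sigma (w n) xs (W n) (b n) k.+1 al j om *
      activation L n0 nL1 sigma (w n) xs (W n) (b n) k.+1 be j om)) - y|].
have PV n := layer_deviation (@hW n) (@hb n) (@indX n) csigma sM kL (@mD n) (@De n)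
  th0 thM (wk n) hc.
have covE n om : cov n k.+1 om al be - g k.+1 al be =
    CW * ((width n0 nL1 L (w n) k.+1)%:R^-1 * (\sum_(j < width n0 nL1 L (w n) k.+1)
     (activation L n0 nL1 sigma (w n) xs (W n) (b n) k.+1 al j om *
      activation L n0 nL1 sigma (w n) xs (W n) (b n) k.+1 be j om)) - y).
  by rewrite mulrBr mulrA /y /q !mxE mulr1; ring.
have VE n : V n = D n `&` far n k.+1 al be del.
  by congr (_ `&` _); apply/seteqP; split => om;
    rewrite /far /= covE normrM gtr0_norm// ltr_pdivrMr// mulrC.
have mDT n : measurable (D n).
  apply: (sigma_of_sub (measurable_param (@hW n) (@hb n))
    (subset_refl (A := param_set n0 nL1 L (w n)))).
  exact: mD.
have mV n : measurable (V n) by rewrite VE; apply: measurableI => //; exact: mfar.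
have bV : exp_bound P a V c.
  move=> e' e'0.
  have two : 0 <= 2 :> R by [].
  have kr : (1 <= k.+1 <= L)%N by [].
  have h1 := mulr_expR_le (- c) e'0 two a0 ca.
  apply: filterS2 (growth (c / c0) kr) h1 => n hg h1.
  apply: (le_trans (PV n)); rewrite lee_fin addrC; apply: le_trans h1.
  rewrite ler_pM2l// ler_expR width_hidden// mulNr lerN2.
  by have := ler_wpM2r (ltW c00) hg; rewrite mulrAC divfK// gt_eqF.
apply: (exp_bound_sub (B := fun n => V n `|` U n)).
- by move=> n; exact: mfar.
- by move=> n; exact: measurableU.
- move=> n om hom; have [Uom|/DU Dom] := pselect (U n om); [by right|left].
  by rewrite VE.
- exact: exp_boundU.
Qed.

Let Q (la : 'M[R]_(m, nL1)) n om : R := mxdot la (cov n L om *m la) / 2.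

Hypothesis L0 : (0 < L)%N.

Let mQ (la : 'M[R]_(m, nL1)) n : measurable_fun setT (Q la n).
Proof.
apply: measurable_funM => //; apply: measurable_mxdot => i j.
under eq_fun do rewrite mxE.
by apply: measurable_sum => k; apply: measurable_funM => //; exact: mcov.
Qed.

Let cov_bound n om i j : `|cov n L om i j| <= Cb + CW * (M * M).
Proof.
have wL : (0 < width n0 nL1 L (w n) L)%N.
  by have h : (0 < L <= L)%N by [rewrite L0 leqnn]; rewrite width_hidden// w0.
have wL' : 0 < (width n0 nL1 L (w n) L)%:R :> R by rewrite ltr0n.
rewrite mxE (le_trans (ler_normD _ _))// ger0_norm// lerD2l -mulrA normrM gtr0_norm//.
rewrite ler_pM2l// normrM gtr0_norm ?invr_gt0// ler_pdivrMl//.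
rewrite (le_trans (ler_norm_sum _ _ _))//.
rewrite (le_trans (ler_sum _ (G := fun=> M * M) _))//; last first.
  by rewrite sumr_const card_ord mulr_natl.
by move=> k _; rewrite normrM ler_pM// activation_bounded.
Qed.

Let Q_concentration (la : 'M[R]_(m, nL1)) (del c : R) : 0 < del ->
  exp_bound P a (fun n => [set om | del < `|Q la n om - mxdot la (g L *m la) / 2|]) c.
Proof.
move=> del0; have [S S0 hS] := mxdot_mul_bound la.
pose r := del / S; have r0 : 0 < r by exact: divr_gt0.
pose U n := \bigcup_(p in [set p | p \in enum {: 'I_m * 'I_m}]) far n L p.1 p.2 r.
have bU : exp_bound P a U c.
  apply: exp_bound_bigcup => // [p n|p]; first exact: mfar.
  exact: emp_cov_concentration.
apply: (exp_bound_sub (B := U)) bU.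
- by move=> n; exact: measurable_dist_gt.
- by move=> n; apply: fin_bigcup_measurable => [|p _]; [exact: finite_seq|exact: mfar].
move=> n om /= hom; apply: contrapT => nU; move: hom; apply/negP; rewrite -leNgt.
have far' i j : `|(cov n L om - g L) i j| <= r.
  rewrite leNgt; apply/negP => h; apply: nU.
  by exists (i, j) => /=; [rewrite mem_enum|move: h; rewrite /far /= !mxE].
have := hS _ _ (ltW r0) far'; rewrite mulmxBl mxdotBr /r mulrC divfK ?gt_eqF// => h.
rewrite /Q -mulrBl normrM (ger0_norm (_ : 0 <= 2^-1))// ?invr_ge0//.
have := normr_ge0 (mxdot la (cov n L om *m la) - mxdot la (g L *m la)); lra.
Qed.

Lemma network_LDP : LDP P (fun n om => \matrix_(al < m, h < nL1)
    (Num.sqrt (a n) * preact sigma n0 nL1 L (w n) (W n) (b n) (xs al) L.+1 h om))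
  (fun n => (a n)^-1) (@rateI R m nL1 (g L)).
Proof.
have pg := ghat_psd L; have [[St _] SS] := msqrtP pg.
apply: quadratic_LDP => //.
- move=> n i j; under eq_fun do rewrite mxE.
  apply: measurable_funM => //.
  exact: (measurable_preact xs (@hW n) (@hb n) csigma).
- exact: pg.1.
move=> la e e0; have [S S0 hS] := mxdot_mul_bound la.
have QC n om : `|Q la n om| <= S * (Cb + CW * (M * M)).
  have b0 : 0 <= Cb + CW * (M * M).
    by rewrite addr_ge0// mulr_ge0 ?(ltW CW0)// -expr2 sqr_ge0.
  have := hS _ _ b0 (cov_bound n om); rewrite /Q normrM (ger0_norm (_ : 0 <= 2^-1)) ?invr_ge0//.
  by have := normr_ge0 (mxdot la (cov n L om *m la)); lra.
have conc (del K : R) : 0 < del -> \forall n \near \oo,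
    (P [set om | (del < `|Q la n om - mxdot la (g L *m la) / 2|)%R] <= (expR (- K / a n))%:E)%E.
  by move=> del0; exact: exp_bound_le (Q_concentration _ _ del0).
have := laplace_concentrated a0 ca (mQ la) QC conc e0.
apply: filterS => n.
have an := a0 n; have sa : Num.sqrt (a n) ^+ 2 = a n by rewrite sqr_sqrtr// ltW.
have sa0 : Num.sqrt (a n) != 0 by rewrite sqrtr_eq0 -ltNge.
have E : (\int[P]_om (expR (mxdot la (\matrix_(al < m, h < nL1)
    (Num.sqrt (a n) * preact sigma n0 nL1 L (w n) (W n) (b n) (xs al) L.+1 h om)) / a n))%:E =
    \int[P]_om (expR (Q la n om / a n))%:E)%E.
  (* With Y = sqrt(a n) Z, <la, Y> / a n is <la / sqrt(a n), Z>; the conditional variance term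
     becomes <la, cov la> / (2 a n), of the order of the speed. *)
  have := output_mgf xs Cb0 CW0 (@hW n) (@hb n) (@indX n) csigma ((Num.sqrt (a n))^-1 *: la).
  move=> H; etransitivity; last (etransitivity; first exact: H).
    apply: eq_integral => om _; congr (expR _)%:E.
    rewrite (_ : (\matrix_(_, _) (_ * _)) = Num.sqrt (a n) *: (\matrix_(al < m, h < nL1)
      preact sigma n0 nL1 L (w n) (W n) (b n) (xs al) L.+1 h om)); last first.
      by apply/matrixP => i j; rewrite !mxE.
    by rewrite mxdotZr mxdotZl -{2}sa; field.
  apply: eq_integral => om _; congr (expR _)%:E.
  rewrite -scalemxAr mxdotZr mxdotZl /Q; move: sa sa0; set t := Num.sqrt _ => <- t0.
  by field.
by move=> [h1 h2]; split; rewrite E.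
Qed.

End concentration.

(** Since gam l >= 1, infinite values included, every width is eventually at least half of
    [w n lhat], and a n * w n lhat eventually exceeds 2 K. *)
Lemma growth_of_ratio (R : realType) (L lhat : nat) (w : nat -> nat -> nat)
    (gam : nat -> \bar R) (a : nat -> R) :
  (forall n l, (1 <= l <= L)%N -> (0 < w n l)%N) -> (1 <= lhat <= L)%N ->
  (forall l, (1 <= l <= L)%N ->
     (1 <= gam l)%E /\
     (((w n l)%:R : R) / (w n lhat)%:R)%:E @[n --> \oo] --> gam l) ->
  (forall n, 0 < a n) -> a n * (w n lhat)%:R @[n --> \oo] --> +oo ->
  forall l (K : R), (1 <= l <= L)%N -> \forall n \near \oo, K / a n <= (w n l)%:R.
Proof.
move=> w0 lh hgam a0 av l K lL.
have [g1 cg] := hgam l lL.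
have hr : \forall n \near \oo, ((1 / 2)%:E < (((w n l)%:R : R) / (w n lhat)%:R)%:E)%E.
  have ng : nbhs (gam l) [set y : \bar R | ((1 / 2)%:E < y)%E].
    apply: open_nbhs_nbhs; split; first exact: open_ereal_gt_ereal.
    by apply: lt_le_trans g1; rewrite lte_fin; lra.
  exact: (cg _ ng).
have hv := (cvgryPge _).1 av (2 * K).
apply: filterS (filterI hr (hv _)) => n [] /=; rewrite lte_fin => h1 h2.
have v0 : 0 < (w n lhat)%:R :> R by rewrite ltr0n w0.
rewrite ler_pdivrMr//; move: h1; rewrite ltr_pdivlMr// => h1.
have := ler_wpM2l (ltW (a0 n)) (ltW h1); lra.
Qed.

Unset Implicit Arguments.

Theorem theorem2p2 (R : realType) (d : measure_display) (T : measurableType d)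
  (P : probability T R)
  (L n0 nL1 : nat) (Cb CW : R) (sigma : R -> R) (w : nat -> nat -> nat)
  (m : nat) (xs : 'I_m -> nat -> R)
  (W : nat -> nat -> nat -> nat -> T -> R) (b : nat -> nat -> nat -> T -> R)
  (lhat : nat) (gam : nat -> \bar R) (a : nat -> R) :
  (1 <= L)%N -> (1 <= n0)%N -> (1 <= nL1)%N -> 0 <= Cb -> 0 < CW ->
  (forall n l, (1 <= l <= L)%N -> (0 < w n l)%N) ->
  (forall l, (1 <= l <= L)%N -> ((w n l)%:R : R) @[n --> \oo] --> +oo) ->
  (* the Gaussian parameters, for each n *)
  (forall n l i j, param_set n0 nL1 L (w n) (inl (l, i, j)) ->
     measurable_fun setT (W n l i j) /\
     has_law P (W n l i j) (gauss_law (CW / (width n0 nL1 L (w n) l.-1)%:R))) ->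
  (forall n l i, param_set n0 nL1 L (w n) (inr (l, i)) ->
     measurable_fun setT (b n l i) /\ has_law P (b n l i) (gauss_law Cb)) ->
  (forall n, mutually_independent P (params (W n) (b n)) (param_set n0 nL1 L (w n))) ->
  (* (i) *)
  continuous sigma -> (exists M : R, forall t, `|sigma t| <= M) ->
  (* (ii) *)
  (1 <= lhat <= L)%N ->
  (forall l, (1 <= l <= L)%N ->
     (1 <= gam l)%E /\
     (((w n l)%:R : R) / (w n lhat)%:R)%:E @[n --> \oo] --> gam l) ->
  (* the sequence a_n *)
  (forall n, 0 < a n) -> a n @[n --> \oo] --> 0 ->
  a n * (w n lhat)%:R @[n --> \oo] --> +oo ->
  let Y := fun n om => \matrix_(al < m, h < nL1)
      (Num.sqrt (a n) * preact sigma n0 nL1 L (w n) (W n) (b n) (xs al) L.+1 h om) in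
  let G := ghat sigma Cb CW n0 xs L in
  LDP P Y (fun n => (a n)^-1) (@rateI R m nL1 G) /\
  good_rate (@rateI R m nL1 G) /\
  (G \in unitmx -> forall z : 'M[R]_(m, nL1),
     rateI G z = (sqnorm (invmx (msqrt G) *m z) / 2)%:E).
Proof.
move=> L1 n01 nL11 Cb0 CW0 w0 _ hW hb indX csigma [M sM] lh hgam a0 ca av Y G.
have growth := growth_of_ratio w0 lh hgam a0 av.
have pg : psd_mx G by exact: (ghat_psd n0 xs Cb0 CW0 csigma sM L).
have [[St _] SS] := msqrtP pg.
split; first exact: (network_LDP xs Cb0 CW0 w0 hW hb indX csigma sM a0 ca growth L1).
split; first exact: good_rate_rateI.
by move=> uG z; exact: rateI_unit.
Qed.
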